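(* There is a constant $c_n>0$ depending only on $n$ such that for every $f\in L^2(\mathbb{H}^n)$, $$\int_{\mathbb{C}^{2n}}\int_{-\infty}^\infty\big|\langle Tf,\Pi(\zeta,s)p_{1/2}\rangle\big|^2\,ds\,d\zeta=c_n\int_{\mathbb{H}^n}|f(h)|^2\,dh.$$
   Context: Symplectic form on $\mathbb{R}^{2n}$: $[(x,u),(y,v)]=u\cdot y-v\cdot x$. The Heisenberg group is $\mathbb{H}^n=\mathbb{R}^{2n}\times\mathbb{R}$ with $(\xi,t)(\eta,s)=(\xi+\eta,t+s+\tfrac12[\xi,\eta])$ and Lebesgue measure as Haar measure. For $f$ on $\mathbb{H}^n$, $f^\lambda(\xi)=\int_{\mathbb{R}}f(\xi,t)e^{i\lambda t}dt$ (in the $L^2$ sense). For $\lambda\neq0$, acting on functions on $\mathbb{R}^{2n}$: $\tau_\lambda(\eta)g(\xi)=g(\xi-\eta)e^{-i\frac{\lambda}{2}[\xi,\eta]}$; $e_\lambda(a,b)g(x,u)=g\big(x-\tanh(\tfrac\lambda2)b,\,u+\tanh(\tfrac\lambda2)a\big)e^{-i\frac\lambda2\coth(\frac\lambda2)(x\cdot a+u\cdot b)}$; for $\zeta=\xi+i\eta$ with $\xi,\eta\in\mathbb{R}^{2n}$, $\Pi_\lambda(\zeta)=e^{i\frac\lambda2(\coth\lambda)\xi\cdot\eta}e_\lambda(\eta)\tau_\lambda(\xi)$. For $\zeta\in\mathbb{C}^{2n}$, $s\in\mathbb{R}$, $\Pi(\zeta,s)$ is the unitary operator on $L^2(\mathbb{H}^n)$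 given by $\Pi(\zeta,s)f(\xi,t)=(2\pi)^{-1}\int_{\mathbb{R}}e^{-i\lambda t}e^{i\lambda s}\,\Pi_\lambda(\zeta)f^\lambda(\xi)\,d\lambda$. $c_\lambda=(4\pi)^{-n}(\lambda/\sinh\lambda)^n$; $T$ is the Fourier multiplier in the central variable with $(Tf)^\lambda=\sqrt{c_\lambda}\,f^\lambda$; $p_{1/2}$ is the time-$\tfrac12$ heat kernel of the sublaplacian on $\mathbb{H}^n$, determined by $p_{1/2}^\lambda(x,u)=(4\pi)^{-n}\lambda^n(\sinh\tfrac\lambda2)^{-n}e^{-\frac14\lambda\coth(\frac\lambda2)(|x|^2+|u|^2)}$. $\langle\cdot,\cdot\rangle$ is the inner product of $L^2(\mathbb{H}^n)$. *)

(* Defs.v *)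
From HB Require Import structures.
From mathcomp Require Import all_boot all_order all_algebra.
From mathcomp Require Import all_classical all_reals all_analysis.
From mathcomp Require Import complex.

Set Implicit Arguments.
Unset Strict Implicit.
Unset Printing Implicit Defensive.

Import Order.TTheory GRing.Theory Num.Theory.
Import numFieldNormedType.Exports.
Import ComplexField.Normc.

Local Open Scope classical_set_scope.
Local Open Scope ring_scope.

(* The coordinates live in [measurableTypeR R], the copy of [R] on which the
   library's [lebesgue_measure] is defined. *)
Notation Rn R n := (n.-tuple (measurableTypeR R)).
Notation R2n R n := (Rn R n * Rn R n)%type.
(* Points of C^(2n): the pair (xi, eta) stands for xi + i eta. *)
Notation C2n R n := (R2n R n * R2n R n)%type.
Notation Heis R n := (R2n R n * measurableTypeR R)%type.

Section ProductSigmaFinite.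
Local Open Scope ereal_scope.
Context d1 d2 (T1 : measurableType d1) (T2 : measurableType d2) (R : realType).

(* In the library this fact is a [Let], and its canonical instance is masked
   by the one for products of subprobabilities. *)
Lemma product_sigma_finite (m1 : {sigma_finite_measure set T1 -> \bar R})
    (m2 : {sigma_finite_measure set T2 -> \bar R}) :
  sigma_finite setT (m1 \x m2).
Proof.
have /sigma_finiteP[F [TF ndF Foo]] := sigma_finiteT m1.
have /sigma_finiteP[G [TG ndG Goo]] := sigma_finiteT m2.
exists (fun n => F n `*` G n).
  rewrite -setXTT TF TG predeqE => -[x y]; split.
    move=> [/= [n _ Fnx] [k _ Gky]]; exists (maxn n k) => //; split.
    - by move: x Fnx; exact/subsetPset/ndF/leq_maxl.
    - by move: y Gky; exact/subsetPset/ndG/leq_maxr.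
  by move=> [n _ []/= ? ?]; split; exists n.
move=> k; have [? ?] := Foo k; have [? ?] := Goo k.
split; first exact: measurableX.
by rewrite product_measure1E// lte_mul_pinfty// ge0_fin_numE.
Qed.

End ProductSigmaFinite.

Section LebesgueMeasures.
Context (R : realType).

Definition consn n (p : measurableTypeR R * Rn R n) : Rn R n.+1 :=
  [tuple of p.1 :: p.2].

Lemma measurable_consn n : measurable_fun [set: _] (@consn n).
Proof. exact: measurable_cons. Qed.

Fixpoint lebesgue_n n : set (Rn R n) -> \bar R :=
  match n with
  | 0 => dirac [tuple]
  | m.+1 => pushforward (@lebesgue_measure R \x @lebesgue_n m)%E (@consn m)
  end.


Section LebesgueStep.
Variables (n : nat) (m : {sigma_finite_measure set (Rn R n) -> \bar R}).

Definition step : set (Rn R n.+1) -> \bar R :=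
  pushforward (@lebesgue_measure R \x m)%E (@consn n).

Let step0 : step set0 = 0%E.
Proof. by apply: measure0; exact: measurable_consn. Qed.

Let step_ge0 A : (0 <= step A)%E.
Proof. by apply: measure_ge0; exact: measurable_consn. Qed.

Let step_sigma_additive : semi_sigma_additive step.
Proof. by apply: measure_semi_sigma_additive; exact: measurable_consn. Qed.

HB.instance Definition _ := isMeasure.Build _ _ _ step
  step0 step_ge0 step_sigma_additive.

Let step_sigma_finite : sigma_finite setT step.
Proof.
have [F TF Ffin] : sigma_finite setT (@lebesgue_measure R \x m)%E.
  exact: product_sigma_finite.
pose unc (x : Rn R n.+1) : measurableTypeR R * Rn R n :=
  (tnth x ord0, [tuple of behead x]).
have munc : measurable_fun [set: _] unc.
  apply/measurable_fun_pairP; split.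
    exact: (measurable_tnth (ord0 : 'I_n.+1)).
  exact: measurable_behead.
have consnK p : unc (consn p) = p.
  by case: p => a b; rewrite /unc/consn /=; congr pair; apply/val_inj.
exists (fun k => unc @^-1` F k).
  by apply/esym; rewrite -preimage_bigcup -TF preimage_setT.
move=> k; have [mF foo] := Ffin k; split.
  by rewrite -[X in measurable X]setTI; exact: munc.
suff -> : step (unc @^-1` F k) = (@lebesgue_measure R \x m)%E (F k) by [].
rewrite /step /pushforward; congr ((_ \x _)%E _).
by apply/seteqP; split=> p /=; rewrite consnK.
Qed.

HB.instance Definition _ := Measure_isSigmaFinite.Build _ _ _ step
  step_sigma_finite.

Lemma lebesgue_step :
  exists m' : {sigma_finite_measure set (Rn R n.+1) -> \bar R},
    step = m' :> (set _ -> _).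
Proof. by exists step. Qed.

End LebesgueStep.

Lemma lebesgue_nP n :
  exists m : {sigma_finite_measure set (Rn R n) -> \bar R},
    @lebesgue_n n = m :> (set _ -> _).
Proof.
elim: n => [|n [m IH]] /=; first by exists (dirac [tuple]).
by rewrite IH; exact: lebesgue_step.
Qed.

Section LebesgueInstances.
Variable n : nat.

Let lebesgue_n0 : @lebesgue_n n set0 = 0%E.
Proof. by have [m ->] := lebesgue_nP n; exact: measure0. Qed.

Let lebesgue_n_ge0 A : (0 <= @lebesgue_n n A)%E.
Proof. by have [m ->] := lebesgue_nP n; exact: measure_ge0. Qed.

Let lebesgue_n_sigma_additive : semi_sigma_additive (@lebesgue_n n).
Proof.
by have [m ->] := lebesgue_nP n; exact: measure_semi_sigma_additive.
Qed.

HB.instance Definition _ := isMeasure.Build _ _ _ (@lebesgue_n n)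
  lebesgue_n0 lebesgue_n_ge0 lebesgue_n_sigma_additive.

Let lebesgue_n_sigma_finite : sigma_finite setT (@lebesgue_n n).
Proof. by have [m ->] := lebesgue_nP n; exact: sigma_finiteT. Qed.

HB.instance Definition _ := Measure_isSigmaFinite.Build _ _ _ (@lebesgue_n n)
  lebesgue_n_sigma_finite.

End LebesgueInstances.


Definition leb2n n : set (R2n R n) -> \bar R :=
  (@lebesgue_n n \x @lebesgue_n n)%E.

HB.instance Definition _ n := Measure.on (@leb2n n).
HB.instance Definition _ n := Measure_isSigmaFinite.Build _ _ _ (@leb2n n)
  (product_sigma_finite (@lebesgue_n n) (@lebesgue_n n)).

Definition lebC2n n : set (C2n R n) -> \bar R := (@leb2n n \x @leb2n n)%E.

HB.instance Definition _ n := Measure.on (@lebC2n n).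
HB.instance Definition _ n := Measure_isSigmaFinite.Build _ _ _ (@lebC2n n)
  (product_sigma_finite (@leb2n n) (@leb2n n)).

Definition haar n : set (Heis R n) -> \bar R :=
  (@leb2n n \x @lebesgue_measure R)%E.

HB.instance Definition _ n := Measure.on (@haar n).
HB.instance Definition _ n := Measure_isSigmaFinite.Build _ _ _ (@haar n)
  (product_sigma_finite (@leb2n n) (@lebesgue_measure R)).

End LebesgueMeasures.
Arguments lebesgue_n R n : clear implicits.
Arguments leb2n R n : clear implicits.
Arguments lebC2n R n : clear implicits.
Arguments haar R n : clear implicits.

Section ComplexFunctions.
Context d (T : measurableType d) (R : realType).
Variable mu : {measure set T -> \bar R}.
Implicit Types f g : T -> R[i].

Definition cmeasurable f :=
  measurable_fun [set: T] (fun x => complex.Re (f x)) /\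
  measurable_fun [set: T] (fun x => complex.Im (f x)).

Definition cintegral (D : set T) f : R[i] :=
  Complex (\int[mu]_(x in D) complex.Re (f x))
          (\int[mu]_(x in D) complex.Im (f x)).

Definition sqL2norm f : \bar R := (\int[mu]_x (normc (f x) ^+ 2)%:E)%E.

Definition L2 f := cmeasurable f /\ (sqL2norm f < +oo)%E.

Definition L2inner f g : R[i] := cintegral [set: T] (fun x => f x * conjc (g x)).

End ComplexFunctions.

Section Heisenberg.
Context (R : realType).
Implicit Types (lam s : R) (n : nat).

Definition sinh lam : R := (expR lam - expR (- lam)) / 2.
Definition cosh lam : R := (expR lam + expR (- lam)) / 2.
Definition tanh lam : R := sinh lam / cosh lam.
(* [coth 0 = 0]; only the values at nonzero reals matter below, as the
   Fourier variable [lam] is always integrated out. *)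
Definition coth lam : R := cosh lam / sinh lam.

Definition cis (theta : R) : R[i] := Complex (cos theta) (sin theta).

Definition addv n (x y : Rn R n) : Rn R n :=
  [tuple tnth x i + tnth y i | i < n].
Definition subv n (x y : Rn R n) : Rn R n :=
  [tuple tnth x i - tnth y i | i < n].
Definition scalev n (a : R) (x : Rn R n) : Rn R n :=
  [tuple a * tnth x i | i < n].
Definition dotv n (x y : Rn R n) : R := \sum_(i < n) tnth x i * tnth y i.

Definition sub2 n (xi eta : R2n R n) : R2n R n :=
  (subv xi.1 eta.1, subv xi.2 eta.2).
Definition dot2 n (xi eta : R2n R n) : R :=
  dotv xi.1 eta.1 + dotv xi.2 eta.2.

Definition symplectic n (xi eta : R2n R n) : R :=
  dotv xi.2 eta.1 - dotv eta.2 xi.1.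

Section Fourier.
Variable n : nat.
Implicit Types f F : Heis R n -> R[i].

(* [sg] is the sign of the exponent: the integral of
   f(xi, t) e^(i sg lam t) over |t| <= N. *)
Definition central_trunc (sg : R) (N : nat) f (k : Heis R n) : R[i] :=
  cintegral (@lebesgue_measure R) `[- N%:R, N%:R]
    (fun t => f (k.1, t) * cis (sg * k.2 * t)).

Definition is_central_transform (sg : R) f F :=
  L2 (haar R n) F /\
  (fun N => sqL2norm (haar R n) (fun k => F k - central_trunc sg N f k))
    @ \oo --> 0%E.

(* The L^2 limit is only determined almost everywhere; a representative is
   chosen. *)
Definition central_transform (sg : R) f : Heis R n -> R[i] :=
  xget (fun=> 0) [set F | is_central_transform sg f F].

(* [FT f (xi, lam)] is f^lam(xi). *)
Definition FT f := central_transform 1 f.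

Definition invFT F : Heis R n -> R[i] :=
  fun h => ((2 * pi)^-1)%:C%C * central_transform (-1) F h.

End Fourier.

Section Operators.
Variable n : nat.
Implicit Types (g : R2n R n -> R[i]) (f : Heis R n -> R[i]).
Implicit Types (xi eta : R2n R n) (zeta : C2n R n).

Definition tau lam eta g : R2n R n -> R[i] := fun xi =>
  g (sub2 xi eta) * cis (- (lam / 2 * symplectic xi eta)).

Definition e_lam lam (ab : R2n R n) g : R2n R n -> R[i] := fun xi =>
  g (subv xi.1 (scalev (tanh (lam / 2)) ab.2),
     addv xi.2 (scalev (tanh (lam / 2)) ab.1))
  * cis (- (lam / 2 * coth (lam / 2) * dot2 xi ab)).

Definition Pi_lam lam zeta g : R2n R n -> R[i] := fun xi =>
  cis (lam / 2 * coth lam * dot2 zeta.1 zeta.2) *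
  e_lam lam zeta.2 (tau lam zeta.1 g) xi.

Definition Pi zeta s f : Heis R n -> R[i] :=
  invFT (fun k => cis (k.2 * s) * Pi_lam k.2 zeta (fun xi => FT f (xi, k.2)) k.1).

Definition c_lam lam : R := (4 * pi) ^- n * (lam / sinh lam) ^+ n.

(* The operator T of the central variable. *)
Definition Tmul f : Heis R n -> R[i] :=
  xget (fun=> 0) [set g | L2 (haar R n) g /\
    is_central_transform 1 g (fun k => (Num.sqrt (c_lam k.2))%:C%C * FT f k)].

Definition heat_half_FT (k : Heis R n) : R :=
  (4 * pi) ^- n * k.2 ^+ n * sinh (k.2 / 2) ^- n *
  expR (- (k.2 * coth (k.2 / 2) / 4 * dot2 k.1 k.1)).

(* [heat_half] is p_(1/2). *)
Definition heat_half : Heis R n -> R[i] :=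
  xget (fun=> 0) [set p | L2 (haar R n) p /\
    is_central_transform 1 p (fun k => (heat_half_FT k)%:C%C)].

End Operators.
End Heisenberg.

Arguments heat_half {R n}.

(* Main.v *)
From HB Require Import structures.
Require Import Defs.
From mathcomp Require Import all_boot all_order all_algebra.
From mathcomp Require Import all_classical all_reals all_analysis.
From mathcomp Require Import measurable_realfun complex zify ring lra.

(** Since the central Fourier transform is unitary up to a constant,
    [<Tf, Pi zeta s p>] is, up to [1 / (2 pi)], the integral over [lam] of
    [e^(- i lam s) G_zeta(lam)], where
    [G_zeta(lam) = sqrt c_lam <f^lam, Pi_lam zeta p^lam>], and Plancherel on the
    line integrates [s] out.  For fixed [lam] the operator [Pi_lam zeta] is, up to
    a phase, a translation by [m] followed by a modulation by [w], where
    [zeta -> (m, w)] is linear of determinant [(lam / sinh lam)^(2n)];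
    Plancherel in [w] and translation invariance in [m] then give
    [\int |<g, Pi_lam zeta p>|^2 dzeta = const (sinh lam / lam)^(2n) |g|^2 |p|^2].
    As [|p^lam|^2 = const (lam / sinh lam)^n] is a Gaussian integral, the weight
    [c_lam] makes the product independent of [lam].

    Plancherel on the line is proved without Fourier inversion.  The integral
    [\int_s |\int_l G(l) e(s, l)|^2 q(s)] depends on the system [(e, q)] only through
    the Gram kernel [\int_s e(s, l) conj(e(s, l')) q(s)], and this kernel is the same
    multiple of the positive part of [eps - |l - l'|] for the characters with the
    Fejer weight [2 (1 - cos (eps s)) / (eps s)^2] and for the indicators of the
    intervals [s <= l <= s + eps] with a suitable constant weight.  When [eps] tends to
    [0] the first system gives [|G^|^2], and the second one [|G|^2] by Lebesgue
    differentiation. *)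

Set Implicit Arguments.
Unset Strict Implicit.
Unset Printing Implicit Defensive.

Import Order.TTheory GRing.Theory Num.Theory.
Import numFieldNormedType.Exports.
Import ComplexField.Normc.

Local Open Scope classical_set_scope.
Local Open Scope ring_scope.

(** Why these two systems: the positive part of [eps - |u|] is the autocorrelation of an interval of
    length [eps], and it is also, up to a constant, the Fourier transform of the Fejer weight. The
    regularization by [eps] is what makes both Gram kernels absolutely convergent, so that Fubini
    applies to them.

    Two obstacles shape the rest. After [s] is integrated out, each [G_zeta] is known to be
    integrable in [lam], but its square integrability is only visible after integration over [zeta];
    every identity is therefore stated in [[0, +oo]], Plancherel is formulated for integrable
    functions, and the orders of integration are exchanged by Tonelli.

    Moreover [f^lam], [Tf] and [p] are representatives picked by [xget]. Nothing is known about them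
    until a candidate exists, which for [Tf] and [p] is the surjectivity of the central transform,
    and afterwards they are known only up to null sets. Each operation applied to them must be shown
    to respect equality almost everywhere. *)

Local Notation Re := complex.Re.
Local Notation Im := complex.Im.

(** * Complex-valued functions *)

Section ComplexAlgebra.
Context (R : realType).
Implicit Types (z w : R[i]) (x y : R).

Lemma complex_ext z w : Re z = Re w -> Im z = Im w -> z = w.
Proof. by case: z w => [a b] [c d] /= -> ->. Qed.

Lemma ReD z w : Re (z + w) = Re z + Re w. Proof. by case: z; case: w. Qed.
Lemma ImD z w : Im (z + w) = Im z + Im w. Proof. by case: z; case: w. Qed.
Lemma ReN z : Re (- z) = - Re z. Proof. by case: z. Qed.
Lemma ImN z : Im (- z) = - Im z. Proof. by case: z. Qed.
Lemma ReB z w : Re (z - w) = Re z - Re w. Proof. by rewrite ReD ReN. Qed.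
Lemma ImB z w : Im (z - w) = Im z - Im w. Proof. by rewrite ImD ImN. Qed.
Lemma ReM z w : Re (z * w) = Re z * Re w - Im z * Im w.
Proof. by case: z; case: w. Qed.
Lemma ImM z w : Im (z * w) = Re z * Im w + Im z * Re w.
Proof. by case: z; case: w. Qed.
Lemma Re_conjc z : Re (conjc z) = Re z. Proof. by case: z. Qed.
Lemma Im_conjc z : Im (conjc z) = - Im z. Proof. by case: z. Qed.

Definition complexE := (ReD, ImD, ReN, ImN, ReM, ImM, Re_conjc, Im_conjc).

Lemma normc_sqr z : normc z ^+ 2 = Re z ^+ 2 + Im z ^+ 2.
Proof. by case: z => a b /=; rewrite sqr_sqrtr// addr_ge0// sqr_ge0. Qed.

Lemma normc_ge0 z : 0 <= normc z.
Proof. by case: z => a b; exact: sqrtr_ge0. Qed.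

Lemma normcE z : normc z = Num.sqrt (Re z ^+ 2 + Im z ^+ 2).
Proof. by case: z. Qed.

Lemma normc_conjc z : normc (conjc z) = normc z.
Proof. by case: z => a b /=; rewrite sqrrN. Qed.

Lemma normcN z : normc (- z) = normc z.
Proof. by case: z => a b /=; rewrite !sqrrN. Qed.

Lemma normc_real x : normc x%:C%C = `|x|.
Proof. by rewrite /= expr0n/= addr0 sqrtr_sqr. Qed.

Lemma normc_cis x : normc (cis x) = 1.
Proof. by rewrite /= cos2Dsin2 sqrtr1. Qed.

Lemma cisD x y : cis (x + y) = cis x * cis y.
Proof. by apply: complex_ext; rewrite complexE /= ?cosD// sinD addrC [X in X + _]mulrC mulrC addrC [X in _ + X]mulrC. Qed.

Lemma cisN x : cis (- x) = conjc (cis x).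
Proof. by rewrite /cis cosN sinN. Qed.

Lemma cis0 : cis 0 = 1 :> R[i].
Proof. by rewrite /cis cos0 sin0. Qed.

Lemma conjcM z w : conjc (z * w) = conjc z * conjc w.
Proof. by apply: complex_ext; rewrite !complexE; ring. Qed.

Lemma mulc_conj z : z * conjc z = (normc z ^+ 2)%:C%C.
Proof. by rewrite normc_sqr; apply: complex_ext; rewrite !complexE /=; ring. Qed.

Lemma normr_Re_le z : `|Re z| <= normc z.
Proof.
by rewrite normcE -sqrtr_sqr ler_wsqrtr// lerDl sqr_ge0.
Qed.

Lemma normr_Im_le z : `|Im z| <= normc z.
Proof.
by rewrite normcE -sqrtr_sqr ler_wsqrtr// lerDr sqr_ge0.
Qed.

Lemma normc_le z : normc z <= `|Re z| + `|Im z|.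
Proof.
rewrite -(@ler_pXn2r _ 2) ?nnegrE ?normc_ge0 ?addr_ge0//.
rewrite normc_sqr sqrrD !real_normK ?num_real//.
by rewrite lerD2r lerDl mulrn_wge0// mulr_ge0.
Qed.

End ComplexAlgebra.

Section ComplexMeasurable.
Context d (T : measurableType d) (R : realType).
Implicit Types (f g : T -> R[i]) (u : T -> R).

Lemma measurable_normc_sqr f : cmeasurable f ->
  measurable_fun setT (fun x => normc (f x) ^+ 2).
Proof.
move=> [mr mi]; under eq_fun do rewrite normc_sqr.
by apply: measurable_funD; apply: measurable_funX.
Qed.

Lemma measurable_normc f : cmeasurable f ->
  measurable_fun setT (fun x => normc (f x)).
Proof.
move=> [mr mi]; under eq_fun do rewrite normcE.
apply: (@measurableT_comp _ _ _ _ _ _ (@Num.sqrt R)).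
  by apply: continuous_measurable_fun; exact: sqrt_continuous.
by apply: measurable_funD; apply: measurable_funX.
Qed.

Lemma cmeasurableD f g : cmeasurable f -> cmeasurable g ->
  cmeasurable (fun x => f x + g x).
Proof.
move=> [fr fi] [gr gi]; split.
  by under eq_fun do rewrite ReD; exact: measurable_funD.
by under eq_fun do rewrite ImD; exact: measurable_funD.
Qed.

Lemma cmeasurableN f : cmeasurable f -> cmeasurable (fun x => - f x).
Proof.
move=> [fr fi]; split.
  by under eq_fun do rewrite ReN; exact: measurableT_comp.
by under eq_fun do rewrite ImN; exact: measurableT_comp.
Qed.

Lemma cmeasurableB f g : cmeasurable f -> cmeasurable g ->
  cmeasurable (fun x => f x - g x).
Proof. by move=> mf mg; apply: cmeasurableD => //; exact: cmeasurableN. Qed.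

Lemma cmeasurableM f g : cmeasurable f -> cmeasurable g ->
  cmeasurable (fun x => f x * g x).
Proof.
move=> [fr fi] [gr gi]; split.
  under eq_fun do rewrite ReM.
  by apply: measurable_funB; exact: measurable_funM.
under eq_fun do rewrite ImM.
by apply: measurable_funD; exact: measurable_funM.
Qed.

Lemma cmeasurable_conjc f : cmeasurable f -> cmeasurable (fun x => conjc (f x)).
Proof.
move=> [fr fi]; split; first by under eq_fun do rewrite Re_conjc.
by under eq_fun do rewrite Im_conjc; exact: measurableT_comp.
Qed.

Lemma cmeasurable_real u : measurable_fun setT u ->
  cmeasurable (fun x => (u x)%:C%C).
Proof. by move=> mu; split => //=. Qed.

Lemma cmeasurable_cst (z : R[i]) : cmeasurable (fun _ : T => z).
Proof. by split; exact: measurable_cst. Qed.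

Lemma cmeasurable_cis u : measurable_fun setT u ->
  cmeasurable (fun x => cis (u x)).
Proof.
move=> mu; split => /=.
  by apply: measurableT_comp mu; apply: continuous_measurable_fun; exact: continuous_cos.
by apply: measurableT_comp mu; apply: continuous_measurable_fun; exact: continuous_sin.
Qed.

Lemma cmeasurable_comp d' (T' : measurableType d') (h : T' -> T) f :
  cmeasurable f -> measurable_fun setT h -> cmeasurable (fun x => f (h x)).
Proof. by move=> [fr fi] mh; split; [exact: (measurableT_comp fr mh)|exact: (measurableT_comp fi mh)]. Qed.

End ComplexMeasurable.

Section ComplexIntegrable.
Context d (T : measurableType d) (R : realType) (mu : {measure set T -> \bar R}).
Implicit Types (f g : T -> R[i]).

Definition cintegrable f :=
  mu.-integrable setT (EFin \o (fun x => Re (f x))) /\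
  mu.-integrable setT (EFin \o (fun x => Im (f x))).

Lemma cintegrable_cmeasurable f : cintegrable f -> cmeasurable f.
Proof. by move=> [/measurable_int/measurable_EFinP ? /measurable_int/measurable_EFinP ?]. Qed.

Lemma cintegrableP f : cmeasurable f ->
  cintegrable f <-> (\int[mu]_x (normc (f x))%:E < +oo)%E.
Proof.
move=> mf; split=> [[ir ii]|foo].
  have i2 : mu.-integrable setT (fun x => (`|Re (f x)| + `|Im (f x)|)%:E).
    under eq_fun do rewrite EFinD.
    by apply: integrableD => //; exact: integrable_norm.
  apply: le_lt_trans (integrable_lty _ i2) => //.
  apply: ge0_le_integral => //.
  - by move=> x _; rewrite lee_fin normc_ge0.
  - exact/measurable_EFinP/measurable_normc.
  - exact: measurable_int i2.
  - by move=> x _; rewrite lee_fin normc_le.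
have mn : measurable_fun setT (EFin \o (fun x => normc (f x))).
  exact/measurable_EFinP/measurable_normc.
have [mr mi] := mf.
suff H (p : R[i] -> R) : measurable_fun setT (fun x => p (f x)) ->
    (forall z, `|p z| <= normc z) ->
    mu.-integrable setT (EFin \o (fun x => p (f x))).
  by split; apply: H => // z; [exact: normr_Re_le|exact: normr_Im_le].
move=> mp lep; apply/integrableP; split; first exact/measurable_EFinP.
apply: le_lt_trans foo; apply: ge0_le_integral => //=.
- exact/measurable_EFinP/measurableT_comp.
- by move=> x _; rewrite lee_fin.
Qed.

Lemma le_cintegrable f (g : T -> R) : cmeasurable f ->
  mu.-integrable setT (EFin \o g) -> (forall x, normc (f x) <= g x) ->
  cintegrable f.
Proof.
move=> mf ig fg; apply/(cintegrableP mf).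
apply: le_lt_trans (integrable_lty _ ig) => //.
apply: ge0_le_integral => //.
- by move=> x _; rewrite lee_fin normc_ge0.
- exact/measurable_EFinP/measurable_normc.
- exact: measurable_int ig.
- by move=> x _; rewrite lee_fin fg.
Qed.

Lemma cintegrable_normc f : cintegrable f ->
  mu.-integrable setT (EFin \o (fun x => normc (f x))).
Proof.
move=> cif; have mf := cintegrable_cmeasurable cif.
apply/integrableP; split; first exact/measurable_EFinP/measurable_normc.
under eq_integral do rewrite /= ger0_norm ?normc_ge0//.
exact/(cintegrableP mf).
Qed.

Lemma cintegrableD f g : cintegrable f -> cintegrable g ->
  cintegrable (fun x => f x + g x).
Proof.
move=> [fr fi] [gr gi]; split; rewrite /comp.
  by under eq_fun do rewrite ReD EFinD; exact: integrableD.
by under eq_fun do rewrite ImD EFinD; exact: integrableD.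
Qed.

Lemma cintegrableN f : cintegrable f -> cintegrable (fun x => - f x).
Proof.
move=> [fr fi]; split; rewrite /comp.
  by under eq_fun do rewrite ReN EFinN; exact: integrableN.
by under eq_fun do rewrite ImN EFinN; exact: integrableN.
Qed.

Lemma cintegrableB f g : cintegrable f -> cintegrable g ->
  cintegrable (fun x => f x - g x).
Proof. by move=> ? ?; apply: cintegrableD => //; exact: cintegrableN. Qed.

Lemma cintegrable_conjc f : cintegrable f -> cintegrable (fun x => conjc (f x)).
Proof.
move=> [fr fi]; split; rewrite /comp.
  by under eq_fun do rewrite Re_conjc.
by under eq_fun do rewrite Im_conjc EFinN; exact: integrableN.
Qed.

Lemma cintegrable_mulb f g : cintegrable f -> cmeasurable g ->
  (forall x, normc (g x) <= 1) -> cintegrable (fun x => f x * g x).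
Proof.
move=> fi mg g1; have mf := cintegrable_cmeasurable fi.
apply: (le_cintegrable _ (cintegrable_normc fi)); first exact: cmeasurableM.
by move=> x; rewrite normcM ler_piMr ?normc_ge0.
Qed.

Lemma cintegralD f g : cintegrable f -> cintegrable g ->
  cintegral mu setT (fun x => f x + g x) =
  cintegral mu setT f + cintegral mu setT g.
Proof.
move=> [fr fi] [gr gi]; apply: complex_ext; rewrite complexE /=.
  by under eq_Rintegral do rewrite ReD; rewrite RintegralD.
by under eq_Rintegral do rewrite ImD; rewrite RintegralD.
Qed.

Lemma cintegralZ (z : R[i]) f : cintegrable f ->
  cintegral mu setT (fun x => z * f x) = z * cintegral mu setT f.
Proof.
move=> [fr fi]; apply: complex_ext; rewrite complexE /=.
  under eq_Rintegral do rewrite ReM.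
  rewrite RintegralB ?RintegralZl//; rewrite /comp;
  by under eq_fun do rewrite EFinM; exact: integrableZl.
under eq_Rintegral do rewrite ImM.
rewrite RintegralD ?RintegralZl//; rewrite /comp;
by under eq_fun do rewrite EFinM; exact: integrableZl.
Qed.

Lemma cintegralN f : cintegrable f ->
  cintegral mu setT (fun x => - f x) = - cintegral mu setT f.
Proof.
move=> fi; rewrite -[RHS]mulN1r -cintegralZ//.
by congr cintegral; apply/funext => x; rewrite mulN1r.
Qed.

Lemma cintegralB f g : cintegrable f -> cintegrable g ->
  cintegral mu setT (fun x => f x - g x) =
  cintegral mu setT f - cintegral mu setT g.
Proof.
move=> fi gi; rewrite cintegralD//; last exact: cintegrableN.
by rewrite cintegralN.
Qed.

Lemma cintegral_conjc f : cintegrable f ->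
  cintegral mu setT (fun x => conjc (f x)) = conjc (cintegral mu setT f).
Proof.
move=> [fr fi]; apply: complex_ext; rewrite complexE /=.
  by under eq_Rintegral do rewrite Re_conjc.
under eq_Rintegral do rewrite Im_conjc -mulN1r.
by rewrite RintegralZl// mulN1r.
Qed.

Lemma cintegral_mkcond (D : set T) f : cintegral mu D f =
  cintegral mu setT (fun x => (\1_D x)%:C%C * f x).
Proof.
rewrite /cintegral; apply: complex_ext => /=; rewrite Rintegral_mkcond;
  apply: eq_Rintegral => x _; rewrite patchE indicE; case: ifP => _;
  rewrite complexE /= ?mul1r ?mul0r ?subr0 ?addr0//.
Qed.

Lemma ae_eq_Rintegral (u v : T -> R) : measurable_fun setT u ->
  measurable_fun setT v -> ae_eq mu setT u v ->
  \int[mu]_x u x = \int[mu]_x v x.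
Proof.
move=> mu_ mv uv; rewrite /Rintegral; congr fine; apply: ae_eq_integral => //.
- exact/measurable_EFinP.
- exact/measurable_EFinP.
- by apply: filterS uv => x /= /[apply] ->.
Qed.

Lemma ae_eq_cintegral f g : cmeasurable f -> cmeasurable g ->
  ae_eq mu setT f g -> cintegral mu setT f = cintegral mu setT g.
Proof.
move=> [fr fi] [gr gi] fg; apply: complex_ext => /=; apply: ae_eq_Rintegral => //;
  by apply: filterS fg => x /= /[apply] ->.
Qed.

End ComplexIntegrable.

(** * Fubini and Tonelli for real and complex integrands *)

Section FineIntegral.
Context d (T : measurableType d) (R : realType) (mu : {measure set T -> \bar R}).

(** An integrable function is finite almost everywhere, so [fine] changes it only on a null set.
    This turns the extended-real marginals of Fubini into the real integrals of which [cintegral] is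
    made. *)
Lemma integrable_fine (F : T -> \bar R) : mu.-integrable setT F ->
  mu.-integrable setT (EFin \o (fun x => fine (F x))) /\
  (\int[mu]_x (fine (F x))%:E = \int[mu]_x F x)%E.
Proof.
move=> iF; have mF := measurable_int _ iF.
have mfF : measurable_fun setT (EFin \o (fun x => fine (F x))).
  by apply/measurable_EFinP; apply: measurableT_comp => //; exact: fine_measurable.
have aeF : ae_eq mu setT F (EFin \o (fun x => fine (F x))).
  have := integrable_ae measurableT iF; apply: filterS => x /= /(_ I) fx _.
  by rewrite fineK.
split; last by apply: ae_eq_integral => //; exact: ae_eq_sym.
apply/integrableP; split => //.
rewrite -(@ge0_ae_eq_integral _ _ _ mu setT (fun x => `|F x|%E)) => //.
- by have /integrableP[] := iF.
- exact: measurableT_comp.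
- exact: measurableT_comp.
- by apply: filterS aeF => x /= /[apply] ->.
Qed.

End FineIntegral.

Section ProductMeasure.
Context d1 d2 (T1 : measurableType d1) (T2 : measurableType d2) (R : realType).
Variables (m1 : {sigma_finite_measure set T1 -> \bar R})
          (m2 : {sigma_finite_measure set T2 -> \bar R}).

(** A named product measure carrying a sigma-finite structure, so that products can be iterated. *)
Definition prodm : set (T1 * T2) -> \bar R := (m1 \x m2)%E.

HB.instance Definition _ := Measure.on prodm.
HB.instance Definition _ := Measure_isSigmaFinite.Build _ _ _ prodm
  (product_sigma_finite m1 m2).

End ProductMeasure.

Lemma integral_normc_ge0 d (T : measurableType d) (R : realType)
    (mu : {measure set T -> \bar R}) (f : T -> R[i]) :
  (0 <= \int[mu]_x (normc (f x))%:E)%E.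
Proof. by apply: integral_ge0 => x _; rewrite lee_fin normc_ge0. Qed.

Section ParametricIntegral.
Context d1 d2 (T1 : measurableType d1) (T2 : measurableType d2) (R : realType).
Variables (m1 : {sigma_finite_measure set T1 -> \bar R})
          (m2 : {sigma_finite_measure set T2 -> \bar R}).

(** Tonelli makes the integrals of the positive and negative parts measurable, and [fine] of their
    difference is measurable whatever values it takes. Parametric integrals can thus be used before
    their convergence is known. *)
Lemma measurable_Rintegral1 (f : T1 * T2 -> R) : measurable_fun setT f ->
  measurable_fun setT (fun x => \int[m2]_y f (x, y)).
Proof.
move=> mf; apply: (@measurableT_comp _ _ _ _ _ _ fine); first exact: fine_measurable.
pose g : T1 * T2 -> \bar R := EFin \o f.
have mg : measurable_fun setT g by exact/measurable_EFinP.
rewrite [X in measurable_fun _ X](_ : _ = (fun x => \int[m2]_y g^\+ (x, y)) \-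
  (fun x => \int[m2]_y g^\- (x, y)))%E; last first.
  apply/funext => x; rewrite integralE.
  by congr (_ - _)%E; apply: eq_integral => y _; rewrite ?funeposE ?funenegE.
apply: emeasurable_funB; apply: measurable_fun_fubini_tonelli_F => //.
- exact: measurable_funepos.
- exact: measurable_funeneg.
Qed.

Lemma cmeasurable_cintegral1 (f : T1 * T2 -> R[i]) : cmeasurable f ->
  cmeasurable (fun x => cintegral m2 setT (fun y => f (x, y))).
Proof.
move=> [fr fi]; split => /=; first exact: (measurable_Rintegral1 fr).
exact: (measurable_Rintegral1 fi).
Qed.

Lemma Rintegral_prodm1 (f : T1 * T2 -> R) :
  (prodm m1 m2).-integrable setT (EFin \o f) ->
  m1.-integrable setT (EFin \o (fun x => \int[m2]_y f (x, y))) /\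
  \int[m1]_x \int[m2]_y f (x, y) = \int[prodm m1 m2]_z f z.
Proof.
move=> fi; have := @integrable_fubini_F _ _ _ _ _ m1 m2 _ fi.
move=> /integrable_fine[iF eF]; split => //.
by rewrite /Rintegral eF (integral12_prod_meas1 fi).
Qed.

Lemma Rintegral_prodm2 (f : T1 * T2 -> R) :
  (prodm m1 m2).-integrable setT (EFin \o f) ->
  m2.-integrable setT (EFin \o (fun y => \int[m1]_x f (x, y))) /\
  \int[m2]_y \int[m1]_x f (x, y) = \int[prodm m1 m2]_z f z.
Proof.
move=> fi.
have : m2.-integrable setT (fubini_G m1 (EFin \o f)).
  (* The second marginal of [f] is the first marginal of [f] with its variables swapped. *)
  have sfi : (prodm m2 m1).-integrable setT (EFin \o (f \o fun z : T2 * T1 => (z.2, z.1))).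
    have mf := measurable_int _ fi.
    have mfs : measurable_fun setT (EFin \o (f \o fun z : T2 * T1 => (z.2, z.1))).
      by rewrite compA; apply: measurableT_comp => //; exact: measurable_fun_pair.
    apply/(integrable12ltyP _ _ mfs) => /=.
    by move/(integrable21ltyP m1 m2 mf) : fi.
  exact: (@integrable_fubini_F _ _ _ _ _ m2 m1 _ sfi).
move=> /integrable_fine[iF eF]; split => //.
by rewrite /Rintegral eF (integral21_prod_meas1 fi).
Qed.

Lemma cintegrable_prodm1 (f : T1 * T2 -> R[i]) : cintegrable (prodm m1 m2) f ->
  cintegrable m1 (fun x => cintegral m2 setT (fun y => f (x, y))).
Proof.
by move=> [/Rintegral_prodm1[fr _] /Rintegral_prodm1[fi _]]; split.
Qed.

Lemma cintegrable_prodm2 (f : T1 * T2 -> R[i]) : cintegrable (prodm m1 m2) f ->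
  cintegrable m2 (fun y => cintegral m1 setT (fun x => f (x, y))).
Proof.
by move=> [/Rintegral_prodm2[fr _] /Rintegral_prodm2[fi _]]; split.
Qed.

Lemma cintegral_prodm1 (f : T1 * T2 -> R[i]) : cintegrable (prodm m1 m2) f ->
  cintegral m1 setT (fun x => cintegral m2 setT (fun y => f (x, y))) =
  cintegral (prodm m1 m2) setT f.
Proof.
by move=> [/Rintegral_prodm1[_ fr] /Rintegral_prodm1[_ fi]]; apply: complex_ext.
Qed.

Lemma cintegral_prodm2 (f : T1 * T2 -> R[i]) : cintegrable (prodm m1 m2) f ->
  cintegral m2 setT (fun y => cintegral m1 setT (fun x => f (x, y))) =
  cintegral (prodm m1 m2) setT f.
Proof.
by move=> [/Rintegral_prodm2[_ fr] /Rintegral_prodm2[_ fi]]; apply: complex_ext.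
Qed.

Lemma cintegrable_prodm1P (f : T1 * T2 -> R[i]) : cmeasurable f ->
  cintegrable (prodm m1 m2) f <->
  (\int[m1]_x \int[m2]_y (normc (f (x, y)))%:E < +oo)%E.
Proof.
move=> mf; rewrite (@cintegrableP _ _ _ (prodm m1 m2) _ mf) /prodm fubini_tonelli1//.
- exact/measurable_EFinP/measurable_normc.
- by move=> x; rewrite lee_fin normc_ge0.
Qed.

Lemma cintegrable_prodm2P (f : T1 * T2 -> R[i]) : cmeasurable f ->
  cintegrable (prodm m1 m2) f <->
  (\int[m2]_y \int[m1]_x (normc (f (x, y)))%:E < +oo)%E.
Proof.
move=> mf; rewrite (@cintegrableP _ _ _ (prodm m1 m2) _ mf) /prodm fubini_tonelli2//.
- exact/measurable_EFinP/measurable_normc.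
- by move=> x; rewrite lee_fin normc_ge0.
Qed.

Lemma ae_cintegrable_prodm2 (f : T1 * T2 -> R[i]) : cintegrable (prodm m1 m2) f ->
  {ae m2, forall y, cintegrable m1 (fun x => f (x, y))}.
Proof.
move=> [fr fi].
have /= := @ae_integrable2 _ _ _ _ _ m1 m2 _ fr.
have /= := @ae_integrable2 _ _ _ _ _ m1 m2 _ fi.
by apply: filterS2 => x.
Qed.

(** The cylinder over a null set is null even when [m2] is infinite, since [0 * +oo = 0]. *)
Lemma ae_prodm1 (P : T1 -> Prop) : {ae m1, forall x, P x} ->
  {ae prodm m1 m2, forall z, P z.1}.
Proof.
move=> [N [mN N0 PN]]; exists (N `*` setT); split.
- exact: measurableX.
- by apply: etrans (@product_measure1E _ _ _ _ _ m1 m2 N setT mN measurableT) _; rewrite [X in (X * _)%E]N0 mul0e.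
- by move=> z /= nPz; split => //; exact: PN.
Qed.

Lemma cintegrable_tensor (u : T1 -> R[i]) (v : T2 -> R[i]) :
  cintegrable m1 u -> cintegrable m2 v ->
  cintegrable (prodm m1 m2) (fun z => u z.1 * v z.2).
Proof.
move=> ui vi.
have mu_ := cintegrable_cmeasurable ui; have mv := cintegrable_cmeasurable vi.
have muv : cmeasurable (fun z : T1 * T2 => u z.1 * v z.2).
  by apply: cmeasurableM; [exact: (cmeasurable_comp mu_)|exact: (cmeasurable_comp mv)].
apply/(cintegrable_prodm1P muv) => /=.
have fv : (\int[m2]_x (normc (v x))%:E \is a fin_num)%E.
  by rewrite ge0_fin_numE ?integral_normc_ge0//; exact/cintegrableP.
rewrite (eq_integral (fun x => (normc (u x))%:E * \int[m2]_x (normc (v x))%:E)%E).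
  rewrite -(fineK fv) ge0_integralZr//.
  - by rewrite fineK// lte_mul_pinfty ?integral_normc_ge0 ?ge0_fin_numE ?integral_normc_ge0//; exact/cintegrableP.
  - exact/measurable_EFinP/measurable_normc.
  - by move=> x _; rewrite lee_fin normc_ge0.
  - by rewrite lee_fin fine_ge0// integral_normc_ge0.
move=> x _; rewrite -ge0_integralZl//.
- by apply: eq_integral => y _; rewrite normcM EFinM.
- exact/measurable_EFinP/measurable_normc.
- by move=> y _; rewrite lee_fin normc_ge0.
- by rewrite lee_fin normc_ge0.
Qed.

Lemma cintegral_tensor (u : T1 -> R[i]) (v : T2 -> R[i]) :
  cintegrable m1 u -> cintegrable m2 v ->
  cintegral (prodm m1 m2) setT (fun z => u z.1 * v z.2) =
  cintegral m1 setT u * cintegral m2 setT v.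
Proof.
move=> ui vi; rewrite -cintegral_prodm1/=; last exact: cintegrable_tensor.
rewrite [RHS]mulrC -cintegralZ//; congr cintegral; apply/funext => x.
by rewrite cintegralZ// mulrC.
Qed.

End ParametricIntegral.

(** * Plancherel on the line *)

Section GramKernel.
Context d1 d2 (S : measurableType d1) (L : measurableType d2) (R : realType).
Variables (nu : {sigma_finite_measure set S -> \bar R})
          (mu : {sigma_finite_measure set L -> \bar R}).
Variables (e : S * L -> R[i]) (q : S -> R) (C : R) (G : L -> R[i]).
Hypothesis me : cmeasurable e.
Hypothesis e1 : forall z, normc (e z) <= 1.
Hypothesis mq : measurable_fun setT q.
Hypothesis q0 : forall s, 0 <= q s.
Hypothesis eC : forall l, (\int[nu]_s (normc (e (s, l)) * q s)%:E <= C%:E)%E.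
Hypothesis iG : cintegrable mu G.

(** The Gram matrix of the family [e (., l)] in the L2 space of the measure [q nu]. *)
Definition gram_kernel (l l' : L) : R[i] :=
  cintegral nu setT (fun s => (q s)%:C%C * (e (s, l) * conjc (e (s, l')))).

Let mG : cmeasurable G. Proof. exact: cintegrable_cmeasurable iG. Qed.

Let Phi (z : S * (L * L)) : R[i] := (q z.1)%:C%C *
  ((G z.2.1 * e (z.1, z.2.1)) * conjc (G z.2.2 * e (z.1, z.2.2))).

Let me1 : cmeasurable (fun z : S * (L * L) => e (z.1, z.2.1)).
Proof.
apply: (cmeasurable_comp (h := fun z : S * (L * L) => (z.1, z.2.1))) => //.
by apply: measurable_fun_pair => //; exact: measurableT_comp.
Qed.

Let me2 : cmeasurable (fun z : S * (L * L) => e (z.1, z.2.2)).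
Proof.
apply: (cmeasurable_comp (h := fun z : S * (L * L) => (z.1, z.2.2))) => //.
by apply: measurable_fun_pair => //; exact: measurableT_comp.
Qed.

Let mG1 : cmeasurable (fun z : S * (L * L) => G z.2.1).
Proof. by apply: (cmeasurable_comp mG); exact: measurableT_comp. Qed.

Let mG2 : cmeasurable (fun z : S * (L * L) => G z.2.2).
Proof. by apply: (cmeasurable_comp mG); exact: measurableT_comp. Qed.

Let mPhi : cmeasurable Phi.
Proof.
apply: cmeasurableM; first exact/cmeasurable_real/measurableT_comp.
apply: cmeasurableM; first exact: cmeasurableM.
by apply: cmeasurable_conjc; exact: cmeasurableM.
Qed.

(** Of the two factors [e] only one is estimated by 1. The other has to stay: for the box system [q]
    is constant on the whole line, and it is [e] times [q] that is integrable in [s], as [eC]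
    provides. *)
Let normPhi z : normc (Phi z) <=
  (normc (G z.2.1) * normc (G z.2.2)) * (normc (e (z.1, z.2.1)) * q z.1).
Proof.
rewrite /Phi !normcM normc_conjc normcM normc_real ger0_norm//.
set a := normc (G _); set b := normc (G _); set c := normc (e _); set f := normc (e _).
rewrite [leLHS](_ : _ = (a * b * (c * q z.1)) * f); last by ring.
by rewrite ler_piMr ?e1// !mulr_ge0 ?normc_ge0.
Qed.

Let iGG : cintegrable (prodm mu mu) (fun p => G p.1 * conjc (G p.2)).
Proof.
apply: (@cintegrable_tensor _ _ _ _ _ mu mu G (fun x => conjc (G x))) => //.
exact: cintegrable_conjc.
Qed.

Let mne l : measurable_fun setT (fun s => normc (e (s, l)) * q s).
Proof.
apply: measurable_funM => //; apply: measurable_normc.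
by apply: (cmeasurable_comp me); exact: measurable_fun_pair.
Qed.

Let C0 (l : L) : 0 <= C.
Proof.
rewrite -lee_fin; apply: le_trans (eC l); apply: integral_ge0 => s _.
by rewrite lee_fin mulr_ge0 ?normc_ge0.
Qed.

Let iPhi : cintegrable (prodm nu (prodm mu mu)) Phi.
Proof.
apply/(cintegrable_prodm2P _ _ mPhi).
have GGoo := (cintegrableP (prodm mu mu) (cintegrable_cmeasurable iGG)).1 iGG.
have mGG : measurable_fun setT
    (fun p : L * L => (normc (G p.1 * conjc (G p.2)))%:E).
  exact/measurable_EFinP/measurable_normc/(cintegrable_cmeasurable iGG).
apply: (@le_lt_trans _ _
    (\int[prodm mu mu]_p ((normc (G p.1 * conjc (G p.2)))%:E * `|C|%:E))%E).
  apply: ge0_le_integral => //.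
  - by move=> p _; exact: integral_normc_ge0.
  - apply: (measurable_fun_fubini_tonelli_G (fun z => (normc (Phi z))%:E)).
      exact/measurable_EFinP/measurable_normc.
    by move=> z; rewrite lee_fin normc_ge0.
  - exact: emeasurable_funM.
  - move=> p _.
    apply: (@le_trans _ _ (\int[nu]_s ((normc (G p.1) * normc (G p.2))%:E *
        (normc (e (s, p.1)) * q s)%:E))%E).
      apply: ge0_le_integral => //.
      + by move=> s _; rewrite lee_fin normc_ge0.
      + apply/measurable_EFinP/measurable_normc.
        by apply: (cmeasurable_comp mPhi); exact: measurable_fun_pair.
      + by apply: emeasurable_funM => //; exact/measurable_EFinP.
      + by move=> s _; rewrite -EFinM lee_fin; exact: (normPhi (s, p)).
    rewrite ge0_integralZl//.
    + rewrite normcM normc_conjc lee_wpmul2l ?lee_fin ?mulr_ge0 ?normc_ge0//.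
      by apply: (le_trans (eC p.1)); rewrite lee_fin ler_norm.
    + exact/measurable_EFinP.
    + by move=> s _; rewrite lee_fin mulr_ge0 ?normc_ge0.
    + by rewrite lee_fin mulr_ge0 ?normc_ge0.
rewrite ge0_integralZr//.
- rewrite lte_mul_pinfty ?integral_normc_ge0 ?ltry//.
  by rewrite ge0_fin_numE// integral_normc_ge0.
- by move=> p _; rewrite lee_fin normc_ge0.
Qed.

Let ie s : cintegrable mu (fun l => G l * e (s, l)).
Proof.
apply: cintegrable_mulb => //.
by apply: (cmeasurable_comp me); exact: measurable_fun_pair.
Qed.

Let iq l l' : cintegrable nu (fun s => (q s)%:C%C * (e (s, l) * conjc (e (s, l')))).
Proof.
have mel k : cmeasurable (fun s => e (s, k)).
  by apply: (cmeasurable_comp me); exact: measurable_fun_pair.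
apply: (@le_cintegrable _ _ _ _ _ (fun s => normc (e (s, l)) * q s)).
- by apply: cmeasurableM; [exact: cmeasurable_real|apply: cmeasurableM => //;
    exact: cmeasurable_conjc].
- apply/integrableP; split; first exact/measurable_EFinP.
  apply: (@le_lt_trans _ _ C%:E); last exact: ltry.
  rewrite (eq_integral (fun s => (normc (e (s, l)) * q s)%:E))//= => s _.
  by rewrite /= ger0_norm// mulr_ge0 ?normc_ge0.
- move=> s; rewrite !normcM normc_conjc normc_real ger0_norm// mulrA mulrC.
  by rewrite mulrC [leRHS]mulrC ler_piMr// mulr_ge0 ?normc_ge0.
Qed.

(** The squared modulus of the inner integral is a double integral over [(l, l')], and Fubini moves
    the integral over [s] inside, onto the two factors [e]. The real part merely casts a real
    quantity back to [R]. *)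
Lemma integral_gram_kernel :
  (\int[nu]_s (q s * normc (cintegral mu setT (fun l => G l * e (s, l))) ^+ 2)%:E =
   (Re (cintegral (prodm mu mu) setT
     (fun p => G p.1 * conjc (G p.2) * gram_kernel p.1 p.2)))%:E)%E.
Proof.
have sE s : cintegral (prodm mu mu) setT (fun p => Phi (s, p)) =
    (q s * normc (cintegral mu setT (fun l => G l * e (s, l))) ^+ 2)%:C%C.
  have ti : cintegrable (prodm mu mu)
      (fun p => G p.1 * e (s, p.1) * conjc (G p.2 * e (s, p.2))).
    apply: (@cintegrable_tensor _ _ _ _ _ mu mu (fun l => G l * e (s, l))
      (fun l => conjc (G l * e (s, l)))) => //.
    exact: cintegrable_conjc.
  apply: etrans (cintegralZ (q s)%:C%C ti) _.
  rewrite (@cintegral_tensor _ _ _ _ _ mu mu (fun l => G l * e (s, l))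
    (fun l => conjc (G l * e (s, l))))//; last exact: cintegrable_conjc.
  by rewrite cintegral_conjc// mulc_conj -rmorphM.
have [iA eA] := (cintegrable_prodm1 iPhi, cintegral_prodm1 iPhi).
have eB := cintegral_prodm2 iPhi.
transitivity (\int[nu]_s (Re (cintegral (prodm mu mu) setT (fun p => Phi (s, p))))%:E)%E.
  by apply: eq_integral => s _; rewrite sE.
have -> : cintegral (prodm mu mu) setT
     (fun p => G p.1 * conjc (G p.2) * gram_kernel p.1 p.2) =
  cintegral (prodm nu (prodm mu mu)) setT Phi.
  rewrite -eB; congr cintegral; apply/funext => p.
  rewrite /gram_kernel -cintegralZ//; congr cintegral; apply/funext => s.
  by rewrite /Phi/= conjcM; ring.
rewrite -eA /=/Rintegral fineK//.
by apply: integrable_fin_num => //; exact: iA.1.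
Qed.

End GramKernel.

(* The left side depends on the system [(e, q)] only through its Gram kernel. *)
Lemma eq_integral_gram_kernel d1 d1' d2 (S : measurableType d1)
    (S' : measurableType d1') (L : measurableType d2) (R : realType)
    (nu : {sigma_finite_measure set S -> \bar R})
    (nu' : {sigma_finite_measure set S' -> \bar R})
    (mu : {sigma_finite_measure set L -> \bar R})
    (e : S * L -> R[i]) (q : S -> R) (C : R)
    (e' : S' * L -> R[i]) (q' : S' -> R) (C' : R) (G : L -> R[i]) :
  cmeasurable e -> (forall z, normc (e z) <= 1) ->
  measurable_fun setT q -> (forall s, 0 <= q s) ->
  (forall l, (\int[nu]_s (normc (e (s, l)) * q s)%:E <= C%:E)%E) ->
  cmeasurable e' -> (forall z, normc (e' z) <= 1) ->
  measurable_fun setT q' -> (forall s, 0 <= q' s) ->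
  (forall l, (\int[nu']_s (normc (e' (s, l)) * q' s)%:E <= C'%:E)%E) ->
  cintegrable mu G ->
  (forall l l', gram_kernel nu e q l l' = gram_kernel nu' e' q' l l') ->
  (\int[nu]_s (q s * normc (cintegral mu setT (fun l => G l * e (s, l))) ^+ 2)%:E =
   \int[nu']_s (q' s * normc (cintegral mu setT (fun l => G l * e' (s, l))) ^+ 2)%:E)%E.
Proof.
move=> me e1 mq q0 eC me' e1' mq' q0' eC' iG ee'.
rewrite (integral_gram_kernel me e1 mq q0 eC iG).
rewrite (integral_gram_kernel me' e1' mq' q0' eC' iG).
by do 3 congr (_ _); apply/funext => p; rewrite ee'.
Qed.

(** * Affine changes of variable on the line *)

Section LebesgueAffine.
Context (R : realType).
Local Notation leb := (@lebesgue_measure R).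

Lemma measurable_affine (a b : R) :
  measurable_fun setT ((fun x => a * x + b) : measurableTypeR R -> measurableTypeR R).
Proof. by apply: measurable_funD => //; exact: measurable_funM. Qed.

Lemma affine_measure (a b : R) :
  exists m : {measure set (measurableTypeR R) -> \bar R},
    forall A, m A = (`|a|%:E * leb ((fun x : R => a * x + b)%R @^-1` A))%E.
Proof.
have mm := measurable_affine a b.
have [p pE] : exists p : {measure set (measurableTypeR R) -> \bar R},
    forall A, p A = leb ((fun x : R => a * x + b)%R @^-1` A).
  by unshelve eexists (pushforward leb
    ((fun x => a * x + b) : measurableTypeR R -> measurableTypeR R)); first exact: mm.
by exists (mscale `|a|%:nng p) => A; rewrite -pE.
Qed.

(** By uniqueness of Lebesgue measure it is enough to compare on left-open intervals. For [a < 0]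
    their preimages are right-open, which leaves the length unchanged. *)
Lemma lebesgue_measure_affine (a b : R) (A : set R) : a != 0 -> measurable A ->
  leb A = (`|a|%:E * leb ((fun x : R => a * x + b)%R @^-1` A))%E.
Proof.
move=> a0 mA.
have [m mE] := affine_measure a b.
rewrite -mE; apply: (@lebesgue_measure_unique _ m) => // _ [[x y]] _ <-.
rewrite mE.
have [a_lt0|a_gt0|/eqP] := ltrgtP a 0; last by rewrite (negbTE a0).
- rewrite [X in (_ = _ * leb X)%E](_ : _ = `[(y - b) / a, (x - b) / a[%classic); last first.
    have E z : (x < a * z + b <= y) = ((y - b) / a <= z < (x - b) / a).
      by rewrite ler_ndivrMr// ltr_ndivlMr// ltrBlDr lerBrDr [z * a]mulrC andbC.
    by apply/seteqP; split => z /=; rewrite !in_itv/=; rewrite E.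
  rewrite !lebesgue_measure_itv/= !lte_fin ltr_nM2r ?invr_lt0// ltrD2r.
  case: ifPn => // _; last by rewrite mule0.
  by rewrite ltr0_norm// -!EFinD -EFinM; congr EFin; field; rewrite lt_eqF.
- rewrite [X in (_ = _ * leb X)%E](_ : _ = `](x - b) / a, (y - b) / a]%classic); last first.
    have E z : (x < a * z + b <= y) = ((x - b) / a < z <= (y - b) / a).
      by rewrite ler_pdivlMr// ltr_pdivrMr// ltrBlDr lerBrDr [z * a]mulrC.
    by apply/seteqP; split => z /=; rewrite !in_itv/= E.
  rewrite !lebesgue_measure_itv/= !lte_fin ltr_pM2r ?invr_gt0// ltrD2r.
  case: ifPn => // _; last by rewrite mule0.
  by rewrite gtr0_norm// -!EFinD -EFinM; congr EFin; field; rewrite gt_eqF.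
Qed.

Lemma ge0_integral_affine (a b : R) (h : R -> \bar R) : a != 0 ->
  measurable_fun setT h -> (forall x, 0 <= h x)%E ->
  (\int[leb]_x h x = `|a|%:E * \int[leb]_x h (a * x + b)%R)%E.
Proof.
move=> a0 mh h0.
have mm := measurable_affine a b.
have [p pE] : exists p : {measure set (measurableTypeR R) -> \bar R},
    p = pushforward leb ((fun x => a * x + b) :
      measurableTypeR R -> measurableTypeR R) :> (set _ -> _).
  by unshelve eexists (pushforward leb
    ((fun x => a * x + b) : measurableTypeR R -> measurableTypeR R)); first exact: mm.
rewrite (@eq_measure_integral _ _ _ setT (mscale `|a|%:nng p)); last first.
  move=> A mA _; apply: etrans (lebesgue_measure_affine b a0 mA) _.
  by congr (_ * _)%E; exact: (congr1 (fun f => f A) (esym pE)).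
rewrite ge0_integral_mscale//=; congr (_ * _)%E.
by rewrite pE ge0_integral_pushforward//= preimage_setT.
Qed.

Lemma Rintegral_odd (f : R -> R) : measurable_fun setT f ->
  (forall x, f (- x) = - f x) -> \int[leb]_x f x = 0.
Proof.
move=> mf fN; rewrite /Rintegral integralE.
have mEf : measurable_fun setT (EFin \o f) by exact/measurable_EFinP.
have -> : (\int[leb]_x (EFin \o f)^\- x = \int[leb]_x (EFin \o f)^\+ x)%E.
  rewrite (@ge0_integral_affine (-1)%R 0%R ((EFin \o f)^\-)%E)//.
  - rewrite normrN normr1 mul1e; apply: eq_integral => x _.
    by rewrite funenegE funeposE /= addr0 mulN1r fN opprK.
  - exact: measurable_funeneg.
(* This covers divergent integrals too: the difference of two infinite parts is an infinite value,
   which [fine] sends to 0. *)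
have : (0 <= \int[leb]_x (EFin \o f)^\+ x)%E by exact: integral_ge0.
by case: (\int[leb]_x _)%E => //= r _; rewrite subrr.
Qed.

End LebesgueAffine.

(** * The integral of [(1 - cos (a s)) / s ^ 2] *)

Section SincKernel.
Context (R : realType).
Local Notation leb := (@lebesgue_measure R).

Lemma norm_sin_le (x : R) : `|sin x| <= `|x|.
Proof.
wlog x0 : x / 0 <= x.
  move=> H; have [x0|x0] := leP 0 x; first exact: H.
  by rewrite -normrN -sinN -[leRHS]normrN; apply: H; rewrite oppr_ge0 ltW.
have [c _] := @MVT_segment R sin cos 0 x x0 (fun y _ => is_derive_sin y)
  (continuous_subspaceT (@continuous_sin R)).
by rewrite sin0 !subr0 => ->; rewrite normrM ler_piMl// cos_max.
Qed.

Lemma one_sub_cos (x : R) : 1 - cos x = 2 * sin (x / 2) ^+ 2.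
Proof.
rewrite {1}(_ : x = (x / 2) *+ 2); last by rewrite -mulr_natr divfK.
by rewrite cos_mulr2n cos2sin2; ring.
Qed.

Lemma integrable_oneDsqrV :
  leb.-integrable setT (EFin \o (fun s : R => (1 + s ^+ 2)^-1)).
Proof.
have c : continuous (fun s : R => (1 + s ^+ 2)^-1) := @continuous_oneDsqrV R.
have p (s : R) : 0 <= (1 + s ^+ 2)^-1 by rewrite invr_ge0 addr_ge0// sqr_ge0.
have mc : measurable_fun setT (EFin \o (fun s : R => (1 + s ^+ 2)^-1)).
  by apply/measurable_EFinP; exact: continuous_measurable_fun.
apply/integrableP; split => //.
under eq_integral do rewrite /= ger0_norm//.
rewrite ge0_symfun_integralT//=; last by move=> s /=; rewrite sqrrN.
rewrite (_ : [set x | _] = `[0, +oo[%classic); last first.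
  by apply/seteqP; split => x/=; rewrite in_itv/= andbT.
have -> := integral0y_oneDsqr R.
by rewrite -EFinM ltry.
Qed.

(** The integral over [s] is a multiple of [|a|], so finite differences in [a] produce piecewise
    linear functions. At [s = 0] division by zero gives 0 instead of the limit [a ^ 2 / 2], which
    affects a null set. *)
Definition vers (a s : R) : R := (1 - cos (a * s)) / s ^+ 2.

Lemma measurable_cosM (a : R) : measurable_fun setT (fun s : R => cos (a * s)).
Proof.
apply: (@measurableT_comp _ _ _ _ _ _ (@cos R)) => //.
by apply: continuous_measurable_fun; exact: continuous_cos.
Qed.

Lemma measurable_inv : measurable_fun setT (fun s : R => s^-1).
Proof.
have m0 : measurable [set x : R | x != 0] by apply: open_measurable; exact: open_neq.
rewrite (_ : setT = [set 0] `|` [set x | x != 0]); last first.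
  by apply/seteqP; split => x //= _; case: (eqVneq x 0); [left|right].
apply/measurable_funU => //.
split; first exact: measurable_fun_set1.
apply: open_continuous_measurable_fun; first exact: open_neq.
by move=> x /[!inE]/= x0; exact: inv_continuous.
Qed.

Lemma measurable_vers a : measurable_fun setT (vers a).
Proof.
apply: measurable_funM.
  by apply: measurable_funB => //; exact: measurable_cosM.
apply: (@measurableT_comp _ _ _ _ _ _ (fun s : R => s^-1)); first exact: measurable_inv.
exact: measurable_funX.
Qed.

Lemma vers_ge0 a s : 0 <= vers a s.
Proof. by rewrite /vers divr_ge0 ?sqr_ge0// subr_ge0 cos_le1. Qed.

Lemma vers1_le s : vers 1 s <= 4 / (1 + s ^+ 2).
Proof.
have p0 : 0 < 1 + s ^+ 2 by rewrite ltr_pwDl// sqr_ge0.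
rewrite /vers mul1r; have [->|s0] := eqVneq s 0.
  by rewrite cos0 subrr mul0r divr_ge0// addr_ge0.
have s2 : 0 < s ^+ 2 by rewrite exprn_even_gt0.
rewrite ler_pdivrMr// mulrAC ler_pdivlMr//.
have h1 : 1 - cos s <= 2 by rewrite lerBlDr -lerBlDl (le_trans _ (cos_geN1 s))//; lra.
have h2 : 1 - cos s <= s ^+ 2 / 2.
  rewrite one_sub_cos (_ : s ^+ 2 / 2 = 2 * (s / 2) ^+ 2); last by field.
  by rewrite ler_pM2l// -real_normK ?num_real// -[leRHS]real_normK ?num_real//
    lerXn2r ?nnegrE// norm_sin_le.
have h3 : 0 <= 1 - cos s by rewrite subr_ge0 cos_le1.
(* Near the origin [h2] is the sharp bound, away from it [h1]. *)
have := sqr_ge0 s; have [?|?] := leP (s ^+ 2) 1; nra.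
Qed.

Lemma integrable_vers1 : leb.-integrable setT (EFin \o vers 1).
Proof.
have i4 := integrableZl measurableT 4 integrable_oneDsqrV.
apply: le_integrable i4 => //; first by apply/measurable_EFinP; exact: measurable_vers.
move=> s _; rewrite /= -?EFinM lee_fin ger0_norm ?vers_ge0//.
by rewrite (le_trans (vers1_le s))// ler_norm.
Qed.

(* The value is [pi], but only its positivity is used. *)
Definition kappa : R := \int[leb]_s vers 1 s.

(** On [[pi / 2, pi]] the cosine is nonpositive, hence the integrand is at least [pi ^- 2] there. *)
Lemma kappa_gt0 : 0 < kappa.
Proof.
have pi0 := pi_gt0 R.
apply: fine_gt0; apply/andP; split; last first.
  by apply: integrable_lty => //; exact: integrable_vers1.
pose D : set R := `[pi / 2, pi]%classic.
have m1 : measurable D by exact: measurable_itv.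
have L0 : (0 < \int[leb]_(s in D) (pi ^- 2 : R)%:E)%E.
  rewrite integral_cst//= lebesgue_measure_itv/= lte_fin ltr_pdivrMr// ltr_pMr//.
  rewrite ltr1n -EFinD -EFinM lte_fin mulr_gt0 ?invr_gt0 ?exprn_gt0//.
  by rewrite subr_gt0 ltr_pdivrMr// ltr_pMr// ltr1n.
have L1 : (\int[leb]_(s in D) (pi ^- 2 : R)%:E <=
    \int[leb]_(s in D) (vers 1 s)%:E)%E.
  apply: ge0_le_integral => //.
  - by move=> s _; rewrite lee_fin invr_ge0 exprn_ge0// ltW.
  - by apply: measurable_funTS; apply/measurable_EFinP; exact: measurable_vers.
  - move=> s; rewrite /D/= in_itv/= => /andP[s1 s2]; rewrite lee_fin /vers mul1r.
    have s0 : 0 < s by rewrite (lt_le_trans _ s1)// divr_gt0.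
    have c0 : cos s <= 0.
      rewrite -(@cos_pihalf R) leNgt ltr_cos ?in_itv/= -?leNgt//.
        by rewrite s2 ltW.
      by rewrite divr_ge0 ?ltW//= ltr_pdivrMr// ltr_pMr// ltr1n.
    rewrite -[leLHS]mul1r; apply: ler_pM => //.
    - by rewrite invr_ge0 exprn_ge0// ltW.
    - by rewrite lerBrDr gerDl.
    by rewrite lef_pV2 ?posrE ?exprn_gt0// ler_pXn2r// nnegrE ltW.
apply: lt_le_trans (lt_le_trans L0 L1) _.
apply: ge0_subset_integral => //.
  by apply/measurable_EFinP; exact: measurable_vers.
by move=> s _; rewrite lee_fin vers_ge0.
Qed.

(** The scaling [vers a s = a ^ 2 * vers 1 (a * s)] brings out [a ^ 2], and the Jacobian takes back
    one factor [|a|]. *)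
Lemma integral_vers a : (\int[leb]_s (vers a s)%:E = (kappa * `|a|)%:E)%E.
Proof.
have [->|a0] := eqVneq a 0.
  rewrite normr0 mulr0 integral0_eq// => s _.
  by rewrite /vers mul0r cos0 subrr mul0r.
have na : 0 < `|a| by rewrite normr_gt0.
have E1 : (\int[leb]_s (vers 1 s)%:E = kappa%:E)%E.
  by rewrite /kappa/Rintegral fineK//; apply: integrable_fin_num => //; exact: integrable_vers1.
have mv : measurable_fun setT (EFin \o vers 1).
  by apply/measurable_EFinP; exact: measurable_vers.
have := ge0_integral_affine 0 a0 mv (fun s => vers_ge0 1 s).
rewrite E1 => /= E2.
have -> : (kappa * `|a|)%:E = ((`|a| ^+ 2)%:E * (`|a|^-1 * kappa)%:E)%E.
  by rewrite -EFinM; congr EFin; field; rewrite gt_eqF.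
rewrite (EFinM `|a|^-1) E2 [X in (_ * X)%E]muleA -EFinM mulVf ?gt_eqF// mul1e -ge0_integralZl//.
- apply: eq_integral => s _; rewrite -EFinM; congr EFin.
  rewrite /vers addr0 mul1r; have [->|s0] := eqVneq s 0.
    by rewrite !mulr0 cos0 subrr !mul0r mulr0.
  by rewrite real_normK ?num_real//; field; rewrite a0 s0.
- apply/measurable_EFinP; apply: (@measurableT_comp _ _ _ _ _ _ (vers 1)) => //.
    exact: measurable_vers.
  exact: measurable_affine.
- by move=> s _; rewrite lee_fin vers_ge0.
Qed.

Lemma integrable_vers a : leb.-integrable setT (EFin \o vers a).
Proof.
apply/integrableP; split; first by apply/measurable_EFinP; exact: measurable_vers.
under eq_integral do rewrite /= ger0_norm ?vers_ge0//.
by rewrite integral_vers ltry.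
Qed.

Lemma Rintegral_vers a : \int[leb]_s vers a s = kappa * `|a|.
Proof. by rewrite /Rintegral integral_vers. Qed.

End SincKernel.

(** * Cauchy-Schwarz and Fatou *)

Section CauchySchwarz.
Context d (T : measurableType d) (R : realType) (mu : {measure set T -> \bar R}).
Implicit Types f g : T -> R.

Lemma integrable_sqr f : measurable_fun setT f ->
  (\int[mu]_x (f x ^+ 2)%:E < +oo)%E ->
  mu.-integrable setT (EFin \o (fun x => f x ^+ 2)).
Proof.
move=> mf foo; apply/integrableP; split.
  by apply/measurable_EFinP; exact: measurable_funX.
by under eq_integral do rewrite /= ger0_norm ?sqr_ge0//.
Qed.

Lemma integrable_mul_sqr f g : measurable_fun setT f -> measurable_fun setT g ->
  (\int[mu]_x (f x ^+ 2)%:E < +oo)%E -> (\int[mu]_x (g x ^+ 2)%:E < +oo)%E ->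
  mu.-integrable setT (EFin \o (fun x => f x * g x)).
Proof.
move=> mf mg foo goo.
have if2 := integrable_sqr mf foo; have ig2 := integrable_sqr mg goo.
apply: (le_integrable measurableT _ _ (integrableD measurableT if2 ig2)).
  by apply/measurable_EFinP; exact: measurable_funM.
move=> x _; rewrite /= lee_fin normrM.
rewrite [leRHS]ger0_norm ?addr_ge0 ?sqr_ge0//.
rewrite -(real_normK (num_real (f x))) -(real_normK (num_real (g x))).
have := sqr_ge0 (`|f x| - `|g x|); rewrite sqrrB.
have := normr_ge0 (f x); have := normr_ge0 (g x).
set a := `|f x|; set b := `|g x|; nra.
Qed.

(** The integral of [(f - t g) ^ 2] is a nonnegative polynomial in [t], evaluated at its minimum
    [t = B / C] when [C] is nonzero. *)
Lemma cauchy_schwarz_Rintegral f g :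
  measurable_fun setT f -> measurable_fun setT g ->
  (\int[mu]_x (f x ^+ 2)%:E < +oo)%E -> (\int[mu]_x (g x ^+ 2)%:E < +oo)%E ->
  (\int[mu]_x (f x * g x)) ^+ 2 <=
  (\int[mu]_x (f x ^+ 2)) * (\int[mu]_x (g x ^+ 2)).
Proof.
move=> mf mg foo goo.
have if2 := integrable_sqr mf foo; have ig2 := integrable_sqr mg goo.
have ifg := integrable_mul_sqr mf mg foo goo.
set A := \int[mu]_x (f x ^+ 2); set B := \int[mu]_x (f x * g x).
set C := \int[mu]_x (g x ^+ 2).
have C0 : 0 <= C by apply: Rintegral_ge0 => x _; exact: sqr_ge0.
have H t : 0 <= A - 2 * t * B + t ^+ 2 * C.
  have i1 : mu.-integrable setT (EFin \o (fun x => 2 * t * (f x * g x))).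
    by rewrite /comp; under eq_fun do rewrite EFinM; exact: integrableZl.
  have i2 : mu.-integrable setT (EFin \o (fun x => t ^+ 2 * g x ^+ 2)).
    by rewrite /comp; under eq_fun do rewrite EFinM; exact: integrableZl.
  have i3 : mu.-integrable setT (EFin \o (fun x => f x ^+ 2 - 2 * t * (f x * g x))).
    by rewrite /comp; under eq_fun do rewrite EFinB; exact: integrableB.
  rewrite (_ : _ + _ = \int[mu]_x (f x - t * g x) ^+ 2).
    by apply: Rintegral_ge0 => x _; exact: sqr_ge0.
  rewrite [RHS](@eq_Rintegral _ _ _ mu setT
    (fun x => f x ^+ 2 - 2 * t * (f x * g x) + t ^+ 2 * g x ^+ 2)); last first.
    by move=> x _; ring.
  by rewrite RintegralD// RintegralB// !RintegralZl.
have [C_eq0|C_neq0] := eqVneq C 0.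
  rewrite C_eq0 mulr0; have [->|B0] := eqVneq B 0; first by rewrite expr0n.
  (* With [C = 0] the polynomial is affine in [t]; this [t] gives it the value [-1]. *)
  have := H ((A + 1) / (2 * B)); rewrite C_eq0 mulr0 addr0.
  rewrite (_ : _ - _ = -1); last by field.
  by rewrite lerNr oppr0 ler10.
have Cp : 0 < C by rewrite lt_neqAle eq_sym C_neq0.
have := H (B / C).
rewrite (_ : _ + _ = A - B ^+ 2 / C); last by field.
by rewrite subr_ge0 ler_pdivrMr.
Qed.

End CauchySchwarz.

Section FatouBound.
Context d (T : measurableType d) (R : realType) (mu : {measure set T -> \bar R}).

(** Fatou's lemma in the only form used below: a uniform bound, possibly infinite, survives an
    almost everywhere limit. It serves both inequalities of Plancherel on the line and the
    completeness of L2. *)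
Lemma fatou_bound (f : (T -> R)^nat) (g : T -> R) (B : \bar R) :
  (forall n, measurable_fun setT (f n)) -> measurable_fun setT g ->
  (forall n x, 0 <= f n x) -> (forall x, 0 <= g x) ->
  {ae mu, forall x, f n x @[n --> \oo] --> g x} ->
  (forall n, \int[mu]_x (f n x)%:E <= B)%E -> (\int[mu]_x (g x)%:E <= B)%E.
Proof.
move=> mf mg f0 g0 fg fB.
have mEf n : measurable_fun setT (EFin \o f n) by exact/measurable_EFinP.
have -> : (\int[mu]_x (g x)%:E = \int[mu]_x limn_einf (fun n => (f n x)%:E))%E.
  apply: ge0_ae_eq_integral => //.
  - exact/measurable_EFinP.
  - under eq_fun do rewrite /limn_einf.
    apply: measurableT_comp => //; apply: measurable_fun_limn_esup => n.
    by apply: (@measurableT_comp _ _ _ _ _ _ (-%E : \bar R -> \bar R)) => //; exact: mEf.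
  - by move=> x _; rewrite lee_fin.
  - move=> x _; rewrite limn_einf_lim; apply: lime_ge; first exact: is_cvg_einfs.
    by apply: nearW => n; apply: le_ereal_inf_tmp => _ [m _ <-]; rewrite lee_fin.
  - apply: filterS fg => x fx _.
    have {}fx : (f n x)%:E @[n --> \oo] --> (g x)%:E by apply: cvg_EFin => //; exact: nearW.
    have /is_cvg_limn_einfE -> : cvgn (fun n => (f n x)%:E) by apply/cvg_ex; exists (g x)%:E.
    by apply: esym; apply: (cvg_lim _ fx).
apply: (le_trans (fatou mu measurableT (f := fun n => EFin \o f n) mEf _)).
  by move=> n x _; rewrite /= lee_fin.
rewrite limn_einf_lim; apply: lime_le; first exact: is_cvg_einfs.
apply: nearW => n; apply: (le_trans _ (fB n)).
by apply: ereal_inf_lbound; exists n => /=.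
Qed.

End FatouBound.

(** * Fejer weights and boxes *)

Section Average.
Context (R : realType).
Local Notation leb := (@lebesgue_measure R).
Local Notation mR := (measurableTypeR R).
Implicit Types (eps s u l m : R) (G : mR -> R[i]).

Lemma vers_le a s : vers a s <= a ^+ 2 / 2.
Proof.
rewrite /vers; have [->|s0] := eqVneq s 0.
  by rewrite mulr0 cos0 subrr mul0r divr_ge0// sqr_ge0.
have s2 : 0 < s ^+ 2 by rewrite exprn_even_gt0.
rewrite ler_pdivrMr// one_sub_cos.
rewrite (_ : a ^+ 2 / 2 * s ^+ 2 = 2 * (a * s / 2) ^+ 2); last by field.
by rewrite ler_pM2l// -real_normK ?num_real// -[leRHS]real_normK ?num_real//
    lerXn2r ?nnegrE// norm_sin_le.
Qed.

(** For nonzero [eps] and [s] this is the square of [sin h / h] with [h = eps * s / 2]. *)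
Definition sinc2 eps s : R := 2 / eps ^+ 2 * vers eps s.

Lemma measurable_sinc2 eps : measurable_fun setT (sinc2 eps).
Proof. by apply: measurable_funM => //; exact: measurable_vers. Qed.

Lemma sinc2_ge0 eps s : 0 <= sinc2 eps s.
Proof. by rewrite mulr_ge0 ?vers_ge0// divr_ge0// sqr_ge0. Qed.

Lemma sinc2_le1 eps s : eps != 0 -> sinc2 eps s <= 1.
Proof.
move=> e0; have e2 : 0 < eps ^+ 2 by rewrite exprn_even_gt0.
rewrite /sinc2 mulrAC ler_pdivrMr// mul1r; have := vers_le eps s; lra.
Qed.

Lemma cvg_sinc2 s : s != 0 -> sinc2 (n.+1%:R^-1) s @[n --> \oo] --> (1 : R).
Proof.
move=> s0.
have D : (fun h : R => h^-1 * sin h) @ 0^' --> (1 : R).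
  have [dv dE] := is_derive_sin (0 : R).
  move: dv dE; rewrite /derivable /derive cos0 => cv lE.
  rewrite -lE; apply: cvg_trans cv; apply: near_eq_cvg.
  by near=> h; rewrite /= addr0 sin0 subr0 /GRing.scale/= mulr1.
have x0 n : n.+1%:R^-1 * s / 2 != 0 :> R.
  by rewrite !mulf_neq0 ?invr_neq0 ?pnatr_eq0.
have xc : n.+1%:R^-1 * s / 2 @[n --> \oo] --> (0 : R).
  rewrite -[X in _ --> X](mul0r (s / 2)).
  under eq_fun do rewrite -mulrA.
  exact: (cvgM cvg_harmonic (cvg_cst (s / 2))).
have sc := (cvgr_dnbhsP _ _ _).1 D _ (conj x0 xc).
rewrite -[X in _ --> X](mulr1 1).
apply: cvg_trans (cvgM sc sc); apply: near_eq_cvg.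
near=> n; rewrite /= /sinc2 /vers one_sub_cos; field.
by rewrite s0 nat1r pnatr_eq0.
Unshelve. all: by end_near. Qed.

Definition box eps : set (mR * mR) := [set z | z.1 <= z.2 <= z.1 + eps].

Lemma measurable_box eps : measurable (box eps).
Proof.
rewrite (_ : box eps = [set z | z.1 <= z.2] `&` [set z | z.2 <= z.1 + eps]); last first.
  by apply/seteqP; split => z /=; rewrite /box/= => /andP.
have m1 : measurable_fun setT (fun z : mR * mR => z.1 : R) by exact: measurable_fst.
have m2 : measurable_fun setT (fun z : mR * mR => z.2 : R) by exact: measurable_snd.
have m1e : measurable_fun setT (fun z : mR * mR => z.1 + eps : R).
  exact: measurable_funD.
apply: measurableI; rewrite -[X in measurable X]setTI.
  exact: (measurable_fun_ler m1 m2 measurableT (Y := [set true])).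
exact: (measurable_fun_ler m2 m1e measurableT (Y := [set true])).
Qed.

Lemma indic_box eps m l : \1_(box eps) (m, l) = \1_`[m, m + eps] l :> R.
Proof. by rewrite !indicE; congr ((nat_of_bool _)%:R); apply/idP/idP; rewrite !inE /box/= in_itv. Qed.

(** The strip is read in two ways: as an interval of [l] it yields averages of [G], and as an
    interval of [m] it is what gets integrated in the Gram kernel and in the uniform bound. *)
Lemma indic_box' eps m l : \1_(box eps) (m, l) = \1_`[l - eps, l] m :> R.
Proof.
rewrite !indicE; congr ((nat_of_bool _)%:R); apply/idP/idP; rewrite !inE /box/= in_itv/=.
  by rewrite lerBlDr andbC.
by rewrite lerBlDr andbC.
Qed.

Lemma integral_indic_itv (a b : R) : a <= b ->
  (\int[leb]_x (\1_`[a, b] x)%:E = (b - a)%:E)%E.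
Proof.
move=> ab; rewrite integral_indic//= setIT lebesgue_measure_itv/= lte_fin.
by case: ltP => // ba; rewrite (le_anti (introT andP (conj ab ba))) subrr.
Qed.

End Average.

Section PlancherelLine.
Context (R : realType).
Local Notation leb := (@lebesgue_measure R).
Local Notation mR := (measurableTypeR R).
Variable sg : R.
Hypothesis sg1 : sg = 1 \/ sg = -1.
Implicit Types (eps s u l m : R) (G : mR -> R[i]).

Definition fourier_kernel (z : mR * mR) : R[i] := cis (sg * z.1 * z.2).

Definition box_kernel eps (z : mR * mR) : R[i] := (\1_(box eps) z)%:C%C.

Lemma cmeasurable_fourier_kernel : cmeasurable fourier_kernel.
Proof.
have m1 : measurable_fun setT (fun z : mR * mR => z.1 : R) by exact: measurable_fst.
have m2 : measurable_fun setT (fun z : mR * mR => z.2 : R) by exact: measurable_snd.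
by apply: cmeasurable_cis; apply: measurable_funM => //; exact: measurable_funM.
Qed.

Lemma cmeasurable_box_kernel eps : cmeasurable (box_kernel eps).
Proof. by apply: cmeasurable_real; apply: measurable_indic; exact: measurable_box. Qed.

Lemma normc_box_kernel eps z : normc (box_kernel eps z) = \1_(box eps) z.
Proof. by rewrite normc_real ger0_norm// indicE. Qed.

(** The imaginary part is odd in [s]. In the real part, [cos (u s) (1 - cos (eps s))] is a second
    difference with step [eps] of [1 - cos (u s)] in [u], so the integral is the same second
    difference of [kappa |u|]. For [eps > 0] it is [kappa] times the positive part of [eps - |u|],
    but keeping the absolute values makes it directly comparable with the box system. *)
Lemma gram_fourier_kernel eps l l' : eps != 0 ->
  gram_kernel leb fourier_kernel (sinc2 eps) l l' =
  (2 * kappa R / eps ^+ 2 *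
    ((`|l - l' + eps| + `|l - l' - eps|) / 2 - `|l - l'|))%:C%C.
Proof.
move=> e0; set u := l - l'.
have E s : (sinc2 eps s)%:C%C *
    (fourier_kernel (s, l) * conjc (fourier_kernel (s, l'))) =
    Complex (sinc2 eps s * cos (u * s)) (sinc2 eps s * sin (sg * u * s)).
  rewrite /fourier_kernel -cisN -cisD /=.
  rewrite (_ : _ - _ = sg * u * s); last by rewrite /u; ring.
  apply: complex_ext; rewrite complexE /= ?mul0r ?subr0 ?addr0//.
  by congr (_ * _); case: sg1 => ->; rewrite ?mul1r// mulN1r mulNr cosN.
have mu_ : measurable_fun setT (fun s => sinc2 eps s * sin (sg * u * s)).
  apply: measurable_funM; first exact: measurable_sinc2.
  apply: (@measurableT_comp _ _ _ _ _ _ (@sin R)) => //.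
  by apply: continuous_measurable_fun; exact: continuous_sin.
rewrite /gram_kernel (_ : (fun s => _) = (fun s : mR => Complex (sinc2 eps s * cos (u * s))
  (sinc2 eps s * sin (sg * u * s)))); last by apply/funext.
apply: complex_ext => /=; last first.
  apply: Rintegral_odd => // s.
  by rewrite /sinc2 /vers !mulrN cosN sinN sqrrN mulrN.
have F s : sinc2 eps s * cos (u * s) =
    2 / eps ^+ 2 * (2^-1 * vers (u + eps) s + 2^-1 * vers (u - eps) s - vers u s).
  rewrite /sinc2 /vers [(u + eps) * s]mulrDl [(u - eps) * s]mulrBl cosD cosB.
  have [->|s0] := eqVneq s 0; first by rewrite !mulr0 cos0 sin0; ring.
  by field; rewrite e0 s0.
under eq_Rintegral do rewrite F.
have i1 a : leb.-integrable setT (EFin \o (fun s => 2^-1 * vers a s)).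
  by rewrite /comp; under eq_fun do rewrite EFinM;
    apply: integrableZl => //; exact: integrable_vers.
have i2 : leb.-integrable setT
    (EFin \o (fun s => 2^-1 * vers (u + eps) s + 2^-1 * vers (u - eps) s)).
  by rewrite /comp; under eq_fun do rewrite EFinD; apply: integrableD => //; exact: i1.
rewrite RintegralZl//; last first.
  rewrite /comp; under eq_fun do rewrite EFinB.
  by apply: integrableB => //; exact: integrable_vers.
rewrite RintegralB//; last exact: integrable_vers.
rewrite RintegralD//; [|exact: i1..].
rewrite !RintegralZl//; [|exact: integrable_vers..].
by rewrite !Rintegral_vers; field.
Qed.

(** A product of two interval indicators is the indicator of the intersection [A], whose length is
    the positive part of [eps - |l - l'|]; the case analysis matches this with the second difference
    of the absolute value. *)
Lemma gram_box_kernel eps c l l' : 0 < eps ->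
  gram_kernel leb (box_kernel eps) (fun=> c) l l' =
  (c * ((`|l - l' + eps| + `|l - l' - eps|) / 2 - `|l - l'|))%:C%C.
Proof.
move=> e0; rewrite /gram_kernel.
pose A : set mR := `[Num.max l l' - eps, Num.min l l']%classic.
have E m : c%:C%C * (box_kernel eps (m, l) * conjc (box_kernel eps (m, l'))) =
    (c * \1_A m)%:C%C.
  have CE (x y : R) : c%:C%C * (x%:C%C * conjc y%:C%C) = (c * (x * y))%:C%C.
    by apply: complex_ext; rewrite !complexE /=; ring.
  rewrite /box_kernel !indic_box' CE; congr (_ * _)%:C%C; rewrite !indicE -natrM mulnb.
  congr ((nat_of_bool _)%:R); apply/idP/idP.
    move=> /andP[]; rewrite !inE /A/= !in_itv/= => /andP[a b] /andP[c' d].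
    rewrite le_min b d lerBlDr ge_max -!lerBlDr a c'//.
  rewrite !inE /A/= !in_itv/= le_min lerBlDr ge_max => /andP[/andP[a b] /andP[c' d]].
  by apply/andP; split; rewrite !inE/= in_itv/= lerBlDr ?a ?b ?c' ?d.
rewrite (_ : (fun s => _) = (fun s : mR => (c * \1_A s)%:C%C)); last by apply/funext.
have mA : measurable A by exact: measurable_itv.
apply: complex_ext => /=; last by rewrite Rintegral_cst ?mul0r.
have Afin : (leb A < +oo)%E.
  by rewrite /A lebesgue_measure_itv; case: ifP => _; rewrite ?ltry// -EFinD ltry.
have iA : leb.-integrable setT (EFin \o \1_A).
  exact: integrable_indic_itv.
rewrite RintegralZl//; congr (_ * _).
rewrite /Rintegral integral_indic//= setIT /A lebesgue_measure_itv/= lte_fin.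
rewrite ltrBlDr.
have [ll'|ll'] := leP l l'.
  rewrite [`|l - l'|]ler0_norm ?subr_le0//.
  rewrite [`|_ - eps|]ler0_norm ?subr_le0//; last by lra.
  have [h|h] := ltP; first by rewrite /= gtr0_norm; lra.
  by rewrite ler0_norm/=; lra.
have ll'' := ltW ll'.
rewrite [`|l - l'|]ger0_norm ?subr_ge0//.
rewrite [`|_ + eps|]ger0_norm; last by lra.
have [h|h] := ltP; first by rewrite /= ltr0_norm; lra.
by rewrite ger0_norm/=; lra.
Qed.

(** The weight [2 * kappa R / eps ^+ 2] on the box side is the factor found in
    [gram_fourier_kernel]; it makes the two Gram kernels equal. The bounds required by the
    comparison are the total mass of [sinc2] and [eps] times this weight. *)
Lemma fourier_box eps G : 0 < eps -> cintegrable leb G ->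
  (\int[leb]_s (sinc2 eps s *
     normc (cintegral leb setT (fun l => G l * fourier_kernel (s, l))) ^+ 2)%:E =
   \int[leb]_m (2 * kappa R / eps ^+ 2 *
     normc (cintegral leb setT (fun l => G l * box_kernel eps (m, l))) ^+ 2)%:E)%E.
Proof.
move=> e0 iG; have en0 : eps != 0 by rewrite gt_eqF.
have c0 : 0 <= 2 * kappa R / eps ^+ 2.
  by rewrite divr_ge0 ?sqr_ge0// mulr_ge0// ltW// kappa_gt0.
apply: (@eq_integral_gram_kernel _ _ _ _ _ _ _ leb leb leb fourier_kernel (sinc2 eps)
  (2 / eps ^+ 2 * (kappa R * `|eps|)) (box_kernel eps) (fun=> 2 * kappa R / eps ^+ 2)
  (2 * kappa R / eps ^+ 2 * eps) G) => //.
- exact: cmeasurable_fourier_kernel.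
- by move=> z; rewrite normc_cis.
- exact: measurable_sinc2.
- by move=> s; exact: sinc2_ge0.
- move=> l; under eq_integral do rewrite normc_cis mul1r /sinc2 EFinM.
  rewrite ge0_integralZl//.
  + by rewrite integral_vers EFinM.
  + by apply/measurable_EFinP; exact: measurable_vers.
  + by move=> s _; rewrite lee_fin vers_ge0.
  + by rewrite lee_fin divr_ge0// sqr_ge0.
- exact: cmeasurable_box_kernel.
- by move=> z; rewrite normc_box_kernel indicE; case: (_ \in _).
- move=> l; under eq_integral do rewrite normc_box_kernel indic_box' mulrC EFinM.
  rewrite ge0_integralZl//.
  + have le : l - eps <= l by rewrite lerBlDr lerDl ltW.
    by rewrite (integral_indic_itv le) opprB addrCA subrr addr0 -EFinM.
  + by apply/measurable_EFinP; exact/measurable_indic.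
- by move=> l l'; rewrite gram_fourier_kernel// gram_box_kernel.
Qed.

End PlancherelLine.

(** * The limit [eps -> 0] *)

Section PlancherelLineLimit.
Context (R : realType).
Local Notation leb := (@lebesgue_measure R).
Local Notation mR := (measurableTypeR R).
Implicit Types (eps s u l m : R) (G : mR -> R[i]).

(** Cauchy-Schwarz against an indicator of mass [eps]. Real and imaginary parts are treated
    separately and then added, so that no constant is lost: the limit needs the sharp one. *)
Lemma normc_sqr_box_le eps m G : 0 < eps -> cmeasurable G ->
  (\int[leb]_l (normc (G l) ^+ 2)%:E < +oo)%E ->
  ((normc (cintegral leb setT (fun l => G l * box_kernel eps (m, l))) ^+ 2)%:E <=
   eps%:E * \int[leb]_l (normc (G l) ^+ 2 * \1_(box eps) (m, l))%:E)%E.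
Proof.
move=> e0 mG Goo; have [mr mi] := mG.
pose k l : R := \1_(box eps) (m, l).
have mk : measurable_fun setT (k : mR -> R).
  apply: (measurableT_comp (f := \1_(box eps) : mR * mR -> R)
    (g := fun l : mR => (m, l) : mR * mR)).
    by apply: measurable_indic; exact: measurable_box.
  exact: measurable_fun_pair.
have k2 l : k l ^+ 2 = k l by rewrite /k indicE; case: (_ \in _); rewrite ?expr1n ?expr0n.
have k0 l : 0 <= k l by rewrite /k indicE.
have k1 l : k l <= 1 by rewrite /k indicE; case: (_ \in _).
have ik : (\int[leb]_l (k l ^+ 2)%:E = eps%:E)%E.
  under eq_integral do rewrite k2 /k indic_box.
  by rewrite integral_indic_itv ?lerDl ?ltW// addrAC subrr add0r.
have Goor : (\int[leb]_l (Re (G l) ^+ 2)%:E < +oo)%E.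
  apply: le_lt_trans Goo; apply: ge0_le_integral => //.
  - by move=> l _; rewrite lee_fin sqr_ge0.
  - by apply/measurable_EFinP; exact: measurable_funX.
  - by apply/measurable_EFinP; exact: measurable_normc_sqr.
  - by move=> l _; rewrite lee_fin normc_sqr lerDl sqr_ge0.
have Gooi : (\int[leb]_l (Im (G l) ^+ 2)%:E < +oo)%E.
  apply: le_lt_trans Goo; apply: ge0_le_integral => //.
  - by move=> l _; rewrite lee_fin sqr_ge0.
  - by apply/measurable_EFinP; exact: measurable_funX.
  - by apply/measurable_EFinP; exact: measurable_normc_sqr.
  - by move=> l _; rewrite lee_fin normc_sqr lerDr sqr_ge0.
have CS (p : mR -> R) : measurable_fun setT p ->
    (\int[leb]_l (p l ^+ 2)%:E < +oo)%E ->
    leb.-integrable setT (EFin \o (fun l => p l ^+ 2 * k l)) /\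
    (\int[leb]_l (p l * k l)) ^+ 2 <= eps * \int[leb]_l (p l ^+ 2 * k l).
  move=> mp poo.
  have ipk : leb.-integrable setT (EFin \o (fun l => p l ^+ 2 * k l)).
    apply: (le_integrable measurableT _ _ (integrable_sqr mp poo)).
      by apply/measurable_EFinP; apply: measurable_funM => //; exact: measurable_funX.
    move=> l _; rewrite /= lee_fin normrM (ger0_norm (k0 l)) ger0_norm ?sqr_ge0//.
    by rewrite ler_piMr// sqr_ge0.
  split => //.
  have e2 l : (p l * k l) ^+ 2 = p l ^+ 2 * k l by rewrite exprMn k2.
  have poo' : (\int[leb]_l ((p l * k l) ^+ 2)%:E < +oo)%E.
    under eq_integral do rewrite e2.
    by have := integrable_lty measurableT ipk.
  have koo : (\int[leb]_l (k l ^+ 2)%:E < +oo)%E by rewrite ik ltry.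
  have E1 : \int[leb]_l (p l * k l * k l) = \int[leb]_l (p l * k l).
    by apply: eq_Rintegral => l _; rewrite -mulrA -expr2 k2.
  have E2 : \int[leb]_l ((p l * k l) ^+ 2) = \int[leb]_l (p l ^+ 2 * k l).
    by apply: eq_Rintegral => l _; exact: e2.
  have E3 : \int[leb]_l (k l ^+ 2) = eps by rewrite /Rintegral ik.
  have := cauchy_schwarz_Rintegral (measurable_funM mp mk) mk poo' koo.
  by rewrite E1 E2 E3 mulrC.
have [ir cr] := CS _ mr Goor.
have [ii ci] := CS _ mi Gooi.
rewrite normc_sqr /=.
rewrite (_ : \int[leb]_l (normc (G l) ^+ 2 * \1_(box eps) (m, l))%:E =
  (\int[leb]_l (Re (G l) ^+ 2 * k l) + \int[leb]_l (Im (G l) ^+ 2 * k l))%:E)%E.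
  rewrite -EFinM lee_fin mulrDr lerD//.
    apply: le_trans cr; rewrite le_eqVlt; apply/orP; left; apply/eqP; congr (_ ^+ 2).
    by apply: eq_Rintegral => l _; rewrite ReM /= mulr0 subr0.
  apply: le_trans ci; rewrite le_eqVlt; apply/orP; left; apply/eqP; congr (_ ^+ 2).
  by apply: eq_Rintegral => l _; rewrite ImM /= mulr0 add0r.
rewrite -RintegralD// /Rintegral fineK.
  by apply: eq_integral => l _; rewrite normc_sqr mulrDl.
apply: integrable_fin_num => //; rewrite /comp.
by under eq_fun do rewrite EFinD; exact: integrableD.
Qed.

(** Cauchy-Schwarz yields one factor [eps], and integrating the indicator over [m] by Tonelli yields
    another; together they cancel [eps ^+ 2]. If the right side is infinite, [kappa > 0] settles the
    claim. *)
Lemma integral_box_le eps G : 0 < eps -> cmeasurable G ->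
  (\int[leb]_m (2 * kappa R / eps ^+ 2 *
     normc (cintegral leb setT (fun l => G l * box_kernel eps (m, l))) ^+ 2)%:E <=
   (2 * kappa R)%:E * \int[leb]_l (normc (G l) ^+ 2)%:E)%E.
Proof.
move=> e0 mG; have k0 := kappa_gt0 R.
have k2 : 0 < 2 * kappa R by rewrite mulr_gt0.
have I0 : (0 <= \int[leb]_l (normc (G l) ^+ 2)%:E)%E.
  by apply: integral_ge0 => l _; rewrite lee_fin sqr_ge0.
have [Goo|] := ltP (\int[leb]_l (normc (G l) ^+ 2)%:E)%E +oo%E; last first.
  by rewrite leye_eq => /eqP ->; rewrite gt0_muley ?lte_fin// leey.
have c0 : 0 <= 2 * kappa R / eps ^+ 2 by rewrite divr_ge0 ?sqr_ge0// ltW.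
have mG2 : measurable_fun setT (fun z : mR * mR =>
    (normc (G z.2) ^+ 2 * \1_(box eps) (z.1, z.2))%:E).
  apply/measurable_EFinP; apply: measurable_funM.
    apply: measurable_normc_sqr; apply: (cmeasurable_comp mG); exact: measurable_snd.
  under eq_fun do rewrite -surjective_pairing.
  by apply: measurable_indic; exact: measurable_box.
have G20 (z : mR * mR) : (0 <= (normc (G z.2) ^+ 2 * \1_(box eps) (z.1, z.2))%:E)%E.
  by rewrite lee_fin mulr_ge0 ?sqr_ge0// indicE.
apply: (@le_trans _ _ (\int[leb]_m ((2 * kappa R / eps)%:E *
    \int[leb]_l (normc (G l) ^+ 2 * \1_(box eps) (m, l))%:E))%E).
  apply: ge0_le_integral => //.
  - by move=> m _; rewrite lee_fin mulr_ge0 ?sqr_ge0.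
  - apply/measurable_EFinP; apply: measurable_funM => //.
    apply: measurable_normc_sqr.
    apply: (cmeasurable_cintegral1 leb (f := fun z : mR * mR => G z.2 * box_kernel eps (z.1, z.2))).
    apply: cmeasurableM.
      by apply: (cmeasurable_comp mG); exact: measurable_snd.
    apply: (cmeasurable_comp (cmeasurable_box_kernel eps)).
    by apply: measurable_fun_pair; [exact: measurable_fst|exact: measurable_snd].
  - apply: emeasurable_funM => //.
    exact: (measurable_fun_fubini_tonelli_F _ mG2 G20).
  - move=> m _; rewrite EFinM.
    apply: le_trans (lee_wpmul2l _ (normc_sqr_box_le m e0 mG Goo)) _.
      by rewrite lee_fin.
    rewrite muleA -EFinM (_ : _ * eps = 2 * kappa R / eps)//.
    by field; rewrite gt_eqF.
rewrite ge0_integralZl//; last 3 first.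
- exact: (measurable_fun_fubini_tonelli_F _ mG2 G20).
- by move=> m _; apply: integral_ge0 => l _; exact: (G20 (m, l)).
- by rewrite lee_fin divr_ge0// ltW.
rewrite (fubini_tonelli (m1 := leb) (m2 := leb) _ mG2 G20).
rewrite (eq_integral (fun l : mR => (normc (G l) ^+ 2)%:E * eps%:E)%E); last first.
  move=> l _; under eq_integral do rewrite /= indic_box' EFinM.
  rewrite ge0_integralZl//.
  - have le : l - eps <= l by rewrite lerBlDr lerDl ltW.
    by rewrite (integral_indic_itv le) opprB addrCA subrr addr0.
  - by apply/measurable_EFinP; exact/measurable_indic.
  - by rewrite lee_fin sqr_ge0.
rewrite ge0_integralZr//; last 3 first.
- by apply/measurable_EFinP; exact: measurable_normc_sqr.
- by move=> l _; rewrite lee_fin sqr_ge0.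
- by rewrite lee_fin ltW.
rewrite [X in (_ * X)%E]muleC muleA -EFinM divfK ?gt_eqF//.
Qed.

End PlancherelLineLimit.

Section AlmostEverywhere.
Context d (T : measurableType d) (R : realType) (mu : {measure set T -> \bar R}).

Lemma aeS (P Q : T -> Prop) : (forall x, P x -> Q x) ->
  {ae mu, forall x, P x} -> {ae mu, forall x, Q x}.
Proof. by move=> PQ; apply: filterS. Qed.

Lemma aeS2 (P Q S : T -> Prop) : (forall x, P x -> Q x -> S x) ->
  {ae mu, forall x, P x} -> {ae mu, forall x, Q x} -> {ae mu, forall x, S x}.
Proof. by move=> PQ; apply: filterS2. Qed.

End AlmostEverywhere.

Section PlancherelLineTheorem.
Context (R : realType).
Local Notation leb := (@lebesgue_measure R).
Local Notation mR := (measurableTypeR R).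
Implicit Types (eps s u l m : R) (G : mR -> R[i]).

Lemma nicely_shrinking_right m :
  nicely_shrinking m (fun n => `[m, m + n.+1%:R^-1]%classic).
Proof.
split; first by move=> n; exact: measurable_itv.
have p n : 0 < 2 * n.+1%:R^-1 :> R by rewrite mulr_gt0// invr_gt0.
(* Balls are open and centred, so radius [2 / n.+1] makes the ball contain the closed interval; its
   length [4 / n.+1] is four times that of the interval. *)
exists (4, fun n => PosNum (p n)); split => //=.
- rewrite -[X in _ --> X](mulr0 2).
  by apply: cvgM; [exact: cvg_cst|exact: cvg_harmonic].
- move=> n x; rewrite /= in_itv/= ball_itv/= in_itv/= => /andP[h1 h2].
  have := p n; set d : R := n.+1%:R^-1 in h2 *; move=> d0.
  by apply/andP; split; lra.
- move=> n; rewrite lebesgue_measure_ball; last exact: ltW.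
  rewrite lebesgue_measure_itv/= lte_fin.
  have := p n; set d : R := n.+1%:R^-1 => d0.
  rewrite ifT; last by lra.
  by rewrite -EFinD -EFinM lee_fin -mulr_natr; lra.
Qed.

Lemma cvg_right_average (f : mR -> R) : leb.-integrable setT (EFin \o f) ->
  {ae leb, forall m,
    n.+1%:R * \int[leb]_l (f l * \1_(box n.+1%:R^-1) (m, l)) @[n --> \oo] --> f m}.
Proof.
move=> fi; have loc : locally_integrable setT f by apply: open_integrable_locally => //; exact: openT.
have := lebesgue_differentiation loc; apply: (aeS (mu := leb)) => m fm.
have := nice_lebesgue_differentiation nicely_shrinking_right loc fm.
pose D n : set R := `[m, m + n.+1%:R^-1]%classic.
have E n : ((leb (D n))^-1 * \int[leb]_(y in D n) (f y)%:E)%E =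
    (n.+1%:R * \int[leb]_l (f l * \1_(box n.+1%:R^-1) (m, l)))%:E.
  rewrite lebesgue_measure_itv/= lte_fin ifT; last by rewrite ltrDl invr_gt0.
  rewrite -EFinD addrAC subrr add0r inver invr_eq0 pnatr_eq0/= invrK EFinM.
  congr (_ * _)%E; rewrite integral_mkcond /Rintegral fineK.
    apply: eq_integral => l _; rewrite patchE indic_box indicE.
    by case: ifP => _; rewrite ?mulr1 ?mulr0.
  apply: integrable_fin_num => //; apply: (le_integrable _ _ _ fi) => //.
    apply/measurable_EFinP; apply: measurable_funM; first exact/measurable_EFinP/measurable_int/fi.
    apply: (measurableT_comp (f := \1_(box _) : mR * mR -> R)
      (g := fun l : mR => (m, l) : mR * mR)).
      by apply: measurable_indic; exact: measurable_box.
    exact: measurable_fun_pair.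
  move=> l _; rewrite /= lee_fin normrM ler_piMr// indicE.
  by case: (_ \in _); rewrite ?normr1 ?normr0.
by rewrite -/D; under eq_fun do rewrite E; move=> /fine_cvgP[].
Qed.

(** Dividing by [eps ^+ 2] inside the square turns the box integral into the average of [G] over
    [[m, m + eps]]. *)
Lemma cvg_box_average G : cintegrable leb G ->
  {ae leb, forall m,
    2 * kappa R / n.+1%:R^-1 ^+ 2 *
      normc (cintegral leb setT (fun l => G l * box_kernel n.+1%:R^-1 (m, l))) ^+ 2
    @[n --> \oo] --> 2 * kappa R * normc (G m) ^+ 2}.
Proof.
move=> [ir ii].
have := cvg_right_average ir; have := cvg_right_average ii.
apply: (aeS2 (mu := leb)) => m ci cr.
rewrite normc_sqr.
rewrite [Re _ ^+ 2]expr2 [Im _ ^+ 2]expr2.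
apply: cvg_trans (cvgM (cvg_cst (2 * kappa R)) (cvgD (cvgM cr cr) (cvgM ci ci))).
apply: near_eq_cvg; apply: nearW => n.
rewrite normc_sqr /=.
rewrite (@eq_Rintegral _ _ _ leb setT (fun l => Re (G l) * \1_(box n.+1%:R^-1) (m, l))); last first.
  by move=> l _; rewrite ReM /= mulr0 subr0.
rewrite [X in _ + X ^+ 2](@eq_Rintegral _ _ _ leb setT (fun l => Im (G l) * \1_(box n.+1%:R^-1) (m, l))); last first.
  by move=> l _; rewrite ImM /= mulr0 add0r.
by rewrite exprVn invrK addrfctE /=; ring.
Qed.

(* Plancherel holds in [0, oo] for every integrable function, square integrable
   or not; this makes the product argument below free of any side condition. *)
Lemma plancherel_line (sg : R) G : sg = 1 \/ sg = -1 -> cintegrable leb G ->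
  (\int[leb]_s (normc (cintegral leb setT (fun l => G l * cis (sg * s * l))) ^+ 2)%:E =
   (2 * kappa R)%:E * \int[leb]_l (normc (G l) ^+ 2)%:E)%E.
Proof.
move=> sg1 iG; have mG := cintegrable_cmeasurable iG.
have k0 := kappa_gt0 R.
have k2 : 0 < 2 * kappa R by rewrite mulr_gt0.
have mF : measurable_fun setT (fun s : mR =>
    normc (cintegral leb setT (fun l => G l * cis (sg * s * l))) ^+ 2).
  apply: measurable_normc_sqr.
  apply: (cmeasurable_cintegral1 leb (f := fun z : mR * mR => G z.2 * fourier_kernel sg z)).
  apply: cmeasurableM; last exact: cmeasurable_fourier_kernel.
  by apply: (cmeasurable_comp mG); exact: measurable_snd.
have mA n : measurable_fun setT (fun m : mR => 2 * kappa R / n.+1%:R^-1 ^+ 2 *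
      normc (cintegral leb setT (fun l => G l * box_kernel n.+1%:R^-1 (m, l))) ^+ 2).
  apply: measurable_funM => //; apply: measurable_normc_sqr.
  apply: (cmeasurable_cintegral1 leb
    (f := fun z : mR * mR => G z.2 * box_kernel n.+1%:R^-1 z)).
  apply: cmeasurableM; last exact: cmeasurable_box_kernel.
  by apply: (cmeasurable_comp mG); exact: measurable_snd.
have e0 n : 0 < n.+1%:R^-1 :> R by rewrite invr_gt0.
apply/eqP; rewrite eq_le; apply/andP; split.
(* Upper bound: Fatou on the Fourier side, where the weights tend to 1 off [s = 0] and the weighted
   integrals are box integrals, bounded uniformly in [eps]. *)
- apply: (@fatou_bound _ _ _ leb (fun n s => sinc2 n.+1%:R^-1 s *
    normc (cintegral leb setT (fun l => G l * cis (sg * s * l))) ^+ 2)) => //.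
  + by move=> n; apply: measurable_funM => //; exact: measurable_sinc2.
  + by move=> n s; rewrite mulr_ge0 ?sinc2_ge0 ?sqr_ge0.
  + by move=> s; rewrite sqr_ge0.
  + have : {ae leb, forall s : R, s != 0}.
      exists [set 0]; split; [exact: measurable_set1|exact: lebesgue_measure_set1|].
      by move=> s /= /negP; rewrite negbK => /eqP.
    apply: (aeS (mu := leb)) => s s0; rewrite -[X in _ --> X]mul1r.
    by apply: cvgM; [exact: cvg_sinc2|exact: cvg_cst].
  + move=> n; have := fourier_box sg1 (e0 n) iG; rewrite /fourier_kernel/= => ->.
    exact: integral_box_le.
(* Lower bound: Fatou on the box side, where the averages converge, combined with [sinc2 <= 1] on
   the Fourier side. *)
- have -> : ((2 * kappa R)%:E * \int[leb]_l (normc (G l) ^+ 2)%:E =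
      \int[leb]_l (2 * kappa R * normc (G l) ^+ 2)%:E)%E.
    under [RHS]eq_integral do rewrite EFinM.
    rewrite ge0_integralZl//.
    + by apply/measurable_EFinP; exact: measurable_normc_sqr.
    + by move=> l _; rewrite lee_fin sqr_ge0.
    + by rewrite lee_fin ltW.
  apply: (@fatou_bound _ _ _ leb (fun n m => 2 * kappa R / n.+1%:R^-1 ^+ 2 *
      normc (cintegral leb setT (fun l => G l * box_kernel n.+1%:R^-1 (m, l))) ^+ 2)) => //.
  + by apply: measurable_funM => //; exact: measurable_normc_sqr.
  + by move=> n m; rewrite mulr_ge0 ?sqr_ge0// divr_ge0 ?sqr_ge0// ltW.
  + by move=> m; rewrite mulr_ge0 ?sqr_ge0// ltW.
  + exact: cvg_box_average.
  + move=> n; rewrite -(fourier_box sg1 (e0 n) iG).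
    apply: ge0_le_integral => //.
    * by move=> s _; rewrite lee_fin mulr_ge0 ?sinc2_ge0 ?sqr_ge0.
    * by apply/measurable_EFinP; apply: measurable_funM => //; exact: measurable_sinc2.
    * exact/measurable_EFinP.
    * by move=> s _; rewrite lee_fin ler_piMl ?sqr_ge0// sinc2_le1// gt_eqF.
Qed.

End PlancherelLineTheorem.

(** * Plancherel on products *)

Section PlancherelProduct.
Context (R : realType).

Definition plancherel d (T : measurableType d) (mu : {measure set T -> \bar R})
    (ph : T -> T -> R) (C : R) :=
  forall G : T -> R[i], cintegrable mu G ->
  (\int[mu]_w (normc (cintegral mu setT (fun x => (G x * cis (ph w x))%R)) ^+ 2)%:E =
   C%:E * \int[mu]_x (normc (G x) ^+ 2)%:E)%E.

Lemma cintegrable_cis d (T : measurableType d) (mu : {measure set T -> \bar R})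
    (G : T -> R[i]) (u : T -> R) : cintegrable mu G -> measurable_fun setT u ->
  cintegrable mu (fun x => G x * cis (u x)).
Proof.
move=> iG mu_; apply: cintegrable_mulb => //; first exact: cmeasurable_cis.
by move=> x; rewrite normc_cis.
Qed.

Context d1 d2 (T1 : measurableType d1) (T2 : measurableType d2).
Variables (m1 : {sigma_finite_measure set T1 -> \bar R})
          (m2 : {sigma_finite_measure set T2 -> \bar R}).
Variables (ph1 : T1 -> T1 -> R) (ph2 : T2 -> T2 -> R) (C1 C2 : R).
Hypothesis mph1 : measurable_fun setT (fun z => ph1 z.1 z.2).
Hypothesis mph2 : measurable_fun setT (fun z => ph2 z.1 z.2).
Hypotheses (C1_ge0 : 0 <= C1) (C2_ge0 : 0 <= C2).

Let m1w w : measurable_fun setT (ph1 w).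
Proof.
by apply: (measurableT_comp (g := fun x => (w, x)) mph1); exact: measurable_fun_pair.
Qed.

Let m2w w : measurable_fun setT (ph2 w).
Proof.
by apply: (measurableT_comp (g := fun x => (w, x)) mph2); exact: measurable_fun_pair.
Qed.

(** The transform is taken one variable at a time. By Fubini the partial transform [H] is again
    integrable in the remaining variable, for every [w1], so [P2] applies to it directly; [P1] is
    then used on almost every slice of [G]. Square integrability of [H] would not be available at
    this point. *)
Lemma plancherel_prodm : plancherel m1 ph1 C1 -> plancherel m2 ph2 C2 ->
  plancherel (prodm m1 m2) (fun w x => ph1 w.1 x.1 + ph2 w.2 x.2) (C1 * C2).
Proof.
move=> P1 P2 G iG; have mG := cintegrable_cmeasurable iG.
have i1 w1 : cintegrable (prodm m1 m2) (fun x => G x * cis (ph1 w1 x.1)).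
  by apply: cintegrable_cis => //; exact: (measurableT_comp (m1w w1)).
pose H (z : T1 * T2) := cintegral m1 setT (fun x1 => G (x1, z.2) * cis (ph1 z.1 x1)).
have mH : cmeasurable H.
  apply: (cmeasurable_cintegral1 m1
    (f := fun z : (T1 * T2) * T1 => G (z.2, z.1.2) * cis (ph1 z.1.1 z.2))).
  apply: cmeasurableM.
    apply: (cmeasurable_comp (h := fun z : (T1 * T2) * T1 => (z.2, z.1.2)) mG).
    by apply: measurable_fun_pair => //; exact: measurableT_comp.
  apply: cmeasurable_cis.
  apply: (measurableT_comp (g := fun z : (T1 * T2) * T1 => (z.1.1, z.2)) mph1).
  by apply: measurable_fun_pair => //; exact: measurableT_comp.
have iH w1 : cintegrable m2 (fun x2 => H (w1, x2)) := cintegrable_prodm2 (i1 w1).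
have HE (w : T1 * T2) : cintegral (prodm m1 m2) setT
    (fun x => G x * cis (ph1 w.1 x.1 + ph2 w.2 x.2)) =
    cintegral m2 setT (fun x2 => H (w.1, x2) * cis (ph2 w.2 x2)).
  have i12 : cintegrable (prodm m1 m2)
      (fun x => G x * cis (ph1 w.1 x.1) * cis (ph2 w.2 x.2)).
    by apply: cintegrable_cis => //; exact: (measurableT_comp (m2w w.2)).
  rewrite (_ : (fun x => _) =
    (fun x => G x * cis (ph1 w.1 x.1) * cis (ph2 w.2 x.2))); last first.
    by apply/funext => x; rewrite cisD mulrA.
  rewrite -(cintegral_prodm2 i12); apply: ae_eq_cintegral.
  - exact: (cintegrable_cmeasurable (cintegrable_prodm2 i12)).
  - exact: (cintegrable_cmeasurable (cintegrable_cis (iH w.1) (m2w w.2))).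
  - apply: (aeS _ (ae_cintegrable_prodm2 (i1 w.1))) => x2 ix _ /=.
    rewrite mulrC -cintegralZ//; congr cintegral; apply/funext => x1.
    by rewrite mulrC.
have mN : measurable_fun setT (fun w : T1 * T2 =>
    (normc (cintegral (prodm m1 m2) setT
      (fun x => G x * cis (ph1 w.1 x.1 + ph2 w.2 x.2))) ^+ 2)%:E).
  apply/measurable_EFinP; apply: measurable_normc_sqr.
  apply: (cmeasurable_cintegral1 (prodm m1 m2) (f := fun z : (T1 * T2) * (T1 * T2) =>
    G z.2 * cis (ph1 z.1.1 z.2.1 + ph2 z.1.2 z.2.2))).
  apply: cmeasurableM; first by apply: (cmeasurable_comp mG); exact: measurable_snd.
  apply: cmeasurable_cis; apply: measurable_funD.
    apply: (measurableT_comp (g := fun z : (T1 * T2) * (T1 * T2) => (z.1.1, z.2.1)) mph1).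
    by apply: measurable_fun_pair; exact: measurableT_comp.
  apply: (measurableT_comp (g := fun z : (T1 * T2) * (T1 * T2) => (z.1.2, z.2.2)) mph2).
  by apply: measurable_fun_pair; exact: measurableT_comp.
have mH2 : measurable_fun setT (fun z : T1 * T2 => (normc (H z) ^+ 2)%:E).
  by apply/measurable_EFinP; exact: measurable_normc_sqr.
have H20 (z : T1 * T2) : (0 <= (normc (H z) ^+ 2)%:E)%E by rewrite lee_fin sqr_ge0.
have mG2 : measurable_fun setT (fun z : T1 * T2 => (normc (G z) ^+ 2)%:E).
  by apply/measurable_EFinP; exact: measurable_normc_sqr.
have G20 (z : T1 * T2) : (0 <= (normc (G z) ^+ 2)%:E)%E by rewrite lee_fin sqr_ge0.
rewrite [LHS](fubini_tonelli1 (m1 := m1) (m2 := m2) _ mN); last first.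
  by move=> w; rewrite lee_fin sqr_ge0.
transitivity (\int[m1]_w1 (C2%:E * \int[m2]_x2 (normc (H (w1, x2)) ^+ 2)%:E))%E.
  apply: eq_integral => w1 _; rewrite -P2//.
  by apply: eq_integral => w2 _; rewrite HE.
rewrite ge0_integralZl//; last 2 first.
- exact: (measurable_fun_fubini_tonelli_F _ mH2 H20).
- by move=> w1 _; apply: integral_ge0 => x2 _; exact: H20.
rewrite (fubini_tonelli (m1 := m1) (m2 := m2) _ mH2 H20).
transitivity (C2%:E * \int[m2]_x2 (C1%:E * \int[m1]_x1 (normc (G (x1, x2)) ^+ 2)%:E))%E.
  congr (_ * _)%E; apply: ge0_ae_eq_integral => //.
  - exact: (measurable_fun_fubini_tonelli_G _ mH2 H20).
  - apply: emeasurable_funM => //.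
    exact: (measurable_fun_fubini_tonelli_G _ mG2 G20).
  - by move=> x2 _; apply: integral_ge0 => w1 _; exact: H20.
  - move=> x2 _; apply: mule_ge0 => //.
    by apply: integral_ge0 => x1 _; exact: G20.
  - by apply: (aeS _ (ae_cintegrable_prodm2 iG)) => x2 ix _; rewrite -P1.
rewrite ge0_integralZl//; last 2 first.
- exact: (measurable_fun_fubini_tonelli_G _ mG2 G20).
- by move=> x2 _; apply: integral_ge0 => x1 _; exact: G20.
rewrite muleA -EFinM [C2 * C1]mulrC; congr (_ * _)%E.
by rewrite [RHS](fubini_tonelli2 (m1 := m1) (m2 := m2) _ mG2 G20).
Qed.

End PlancherelProduct.

(** * Plancherel on tuples, by induction on the dimension *)

Section LebesgueTuple.
Context (R : realType).
Local Notation leb := (@lebesgue_measure R).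
Local Notation mR := (measurableTypeR R).

Lemma ge0_integral_lebesgue_nS n (f : Rn R n.+1 -> \bar R) :
  measurable_fun setT f -> (forall x, 0 <= f x)%E ->
  (\int[lebesgue_n R n.+1]_x f x =
   \int[prodm leb (lebesgue_n R n)]_z f (consn z))%E.
Proof.
move=> mf f0.
have := @ge0_integral_pushforward _ _ _ _ R (@consn R n) (@measurable_consn R n)
  (prodm leb (lebesgue_n R n)) setT f measurableT mf (fun x _ => f0 x).
by rewrite preimage_setT.
Qed.

Lemma integral_lebesgue_nS n (f : Rn R n.+1 -> \bar R) :
  (lebesgue_n R n.+1).-integrable setT f ->
  (prodm leb (lebesgue_n R n)).-integrable setT (f \o @consn R n) /\
  (\int[lebesgue_n R n.+1]_x f x =
   \int[prodm leb (lebesgue_n R n)]_z f (consn z))%E.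
Proof.
move=> fi; have mf := measurable_int _ fi.
have fci : (prodm leb (lebesgue_n R n)).-integrable setT (f \o @consn R n).
  apply/integrableP; split; first by apply: measurableT_comp => //; exact: measurable_consn.
  have /integrableP[_] := fi; rewrite ge0_integral_lebesgue_nS//.
  exact: measurableT_comp.
split => //.
rewrite integralE [RHS]integralE; congr (_ - _)%E.
  rewrite ge0_integral_lebesgue_nS//; last exact: measurable_funepos.
  by apply: eq_integral => x _; rewrite !funeposE.
rewrite ge0_integral_lebesgue_nS//; last exact: measurable_funeneg.
by apply: eq_integral => x _; rewrite !funenegE.
Qed.

Lemma cintegral_lebesgue_nS n (f : Rn R n.+1 -> R[i]) :
  cintegrable (lebesgue_n R n.+1) f ->
  cintegrable (prodm leb (lebesgue_n R n)) (f \o @consn R n) /\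
  cintegral (lebesgue_n R n.+1) setT f =
  cintegral (prodm leb (lebesgue_n R n)) setT (f \o @consn R n).
Proof.
move=> [/integral_lebesgue_nS[r1 r2] /integral_lebesgue_nS[i1 i2]]; split; first by split.
by apply: complex_ext => /=; rewrite /Rintegral ?r2 ?i2.
Qed.

Lemma measurable_dotv n :
  measurable_fun setT (fun z : Rn R n * Rn R n => dotv z.1 z.2).
Proof.
apply: measurable_sum => i; apply: measurable_funM.
  by apply: (measurableT_comp (f := fun x : Rn R n => tnth x i)) => //; exact: measurable_tnth.
by apply: (measurableT_comp (f := fun x : Rn R n => tnth x i)) => //; exact: measurable_tnth.
Qed.

Lemma dotv_consn n (w x : mR * Rn R n) :
  dotv (consn w) (consn x) = w.1 * x.1 + dotv w.2 x.2.
Proof.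
rewrite /dotv big_ord_recl; congr (_ + _); apply: eq_bigr => i _.
by rewrite /consn !tnthS.
Qed.

Lemma plancherel_lebesgue_n n :
  plancherel (lebesgue_n R n) (@dotv R n) ((2 * kappa R) ^+ n).
Proof.
have k0 := kappa_gt0 R.
have k2 : 0 <= 2 * kappa R by rewrite mulr_ge0// ltW.
elim: n => [|n IH] G iG.
  rewrite expr0 mul1e; apply: eq_integral => w _; congr (normc _ ^+ 2)%:E.
  have d0 (u : Rn R 0 -> R) : \int[lebesgue_n R 0]_x u x = u [tuple].
    rewrite (_ : u = cst (u [tuple])); last by apply/funext => x; rewrite (tuple0 x).
    by rewrite /Rintegral /= integral_dirac//= indicE mem_set// mul1r.
  have c0 (f : Rn R 0 -> R[i]) : cintegral (lebesgue_n R 0) setT f = f [tuple].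
    by apply: complex_ext; rewrite /= d0.
  by rewrite c0 (tuple0 w) /dotv big_ord0 cis0 mulr1.
have mG := cintegrable_cmeasurable iG.
have mph (w : Rn R n.+1) : measurable_fun setT (dotv w).
  apply: (measurableT_comp (g := fun x => (w, x)) (@measurable_dotv n.+1)).
  exact: measurable_fun_pair.
rewrite ge0_integral_lebesgue_nS; last 2 first.
- apply/measurable_EFinP; apply: measurable_normc_sqr.
  apply: (cmeasurable_cintegral1 (lebesgue_n R n.+1)
    (f := fun z : Rn R n.+1 * Rn R n.+1 => G z.2 * cis (dotv z.1 z.2))).
  apply: cmeasurableM; first by apply: (cmeasurable_comp mG); exact: measurable_snd.
  by apply: cmeasurable_cis; exact: measurable_dotv.
- by move=> x; rewrite lee_fin sqr_ge0.
rewrite ge0_integral_lebesgue_nS; last 2 first.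
- by apply/measurable_EFinP; exact: measurable_normc_sqr.
- by move=> x; rewrite lee_fin sqr_ge0.
have P : plancherel (prodm leb (lebesgue_n R n))
    (fun w x => w.1 * x.1 + dotv w.2 x.2) ((2 * kappa R) * (2 * kappa R) ^+ n).
  apply: (@plancherel_prodm R _ _ _ _ leb (lebesgue_n R n) (fun s l => s * l) (@dotv R n)) => //.
  - apply: measurable_funM; [exact: measurable_fst|exact: measurable_snd].
  - exact: measurable_dotv.
  - exact: exprn_ge0.
  - move=> H iH.
    apply: etrans (@plancherel_line R 1 H (or_introl erefl) iH).
    by apply: eq_integral => s _; rewrite mul1r.
rewrite exprS -P; last exact: (cintegral_lebesgue_nS iG).1.
apply: eq_integral => w _; congr (normc _ ^+ 2)%:E.
rewrite (cintegral_lebesgue_nS (cintegrable_cis iG (mph _))).2.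
by congr cintegral; apply/funext => x /=; rewrite dotv_consn.
Qed.

Lemma plancherel_leb2n n :
  plancherel (leb2n R n) (@dot2 R n) ((2 * kappa R) ^+ n * (2 * kappa R) ^+ n).
Proof.
have k0 := kappa_gt0 R.
have k2 : 0 <= 2 * kappa R by rewrite mulr_ge0// ltW.
have m := @measurable_dotv n.
apply: (@plancherel_prodm R _ _ _ _ (lebesgue_n R n) (lebesgue_n R n)) => //.
- exact: exprn_ge0.
- exact: exprn_ge0.
- exact: plancherel_lebesgue_n.
- exact: plancherel_lebesgue_n.
Qed.

End LebesgueTuple.

(** * The space L2 *)

Section RieszFischer.
Context d (T : measurableType d) (R : realType) (mu : {measure set T -> \bar R}).
Local Open Scope ring_scope.

(** Even weighted by [4 ^ k], the squared increments have integrals at most [2 ^- k.+1], so their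
    sum [S] is finite almost everywhere. Where it is, each increment is at most
    [sqrt (S x) / 2 ^ k], and the increments form an absolutely convergent series. *)
Lemma cvg_ae_of_summable (w : (T -> R)^nat) : (forall k, measurable_fun setT (w k)) ->
  (forall k, (\int[mu]_x ((w k.+1 x - w k x) ^+ 2)%:E <= ((8 ^ k.+1)%N%:R^-1)%:E)%E) ->
  {ae mu, forall x, cvgn (w ^~ x)}.
Proof.
move=> mw wb.
pose t k x : \bar R := ((4 ^ k)%N%:R * (w k.+1 x - w k x) ^+ 2)%:E.
have mt k : measurable_fun setT (t k).
  apply/measurable_EFinP; apply: measurable_funM => //; apply: measurable_funX.
  exact: measurable_funB.
have t0 k x : (0 <= t k x)%E by rewrite lee_fin mulr_ge0 ?sqr_ge0.
pose S x := (\sum_(k <oo) t k x)%E.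
have mS : measurable_fun setT S by apply: ge0_emeasurable_sum.
have S0 x : (0 <= S x)%E by apply: nneseries_ge0.
have iS : (\int[mu]_x S x <= 1%:E)%E.
  rewrite integral_nneseries//.
  apply: le_trans (epsilon_trick0 xpredT (@ler01 R)).
  apply: lee_nneseries => [k _ _|k _]; first exact: integral_ge0.
  under eq_integral do rewrite /t EFinM.
  rewrite ge0_integralZl//; last 2 first.
  - by apply/measurable_EFinP; apply: measurable_funX; exact: measurable_funB.
  - by move=> x _; rewrite lee_fin sqr_ge0.
  apply: le_trans (lee_wpmul2l _ (wb k)) _; first by rewrite lee_fin.
  rewrite -EFinM lee_fin mul1r ler_pdivrMr ?ltr0n ?expn_gt0//.
  rewrite ler_pdivlMl ?ltr0n ?expn_gt0// -!natrM ler_nat.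
  by rewrite !expnS (_ : 8 = 4 * 2)%N// expnMn; nia.
have : {ae mu, forall x, S x \is a fin_num}.
  have iSS : mu.-integrable setT S.
    apply/integrableP; split => //; under eq_integral do rewrite gee0_abs//.
    by apply: le_lt_trans iS _; rewrite ltry.
  by apply: (aeS _ (integrable_ae measurableT iSS)) => x; exact.
apply: aeS => x Sx.
have tS k : (4 ^ k)%N%:R * (w k.+1 x - w k x) ^+ 2 <= fine (S x).
  rewrite -lee_fin fineK//.
  apply: le_trans (nneseries_lim_ge k.+1 _); last by move=> *; exact: t0.
  rewrite big_nat_recr//=; apply: leeDr; apply: sume_ge0 => i _; exact: t0.
have dS k : `|w k.+1 x - w k x| <= geometric (Num.sqrt (fine (S x))) 2^-1 k.
  have g0 : 0 <= Num.sqrt (fine (S x)) * 2^-1 ^+ k.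
    by apply: mulr_ge0; [exact: sqrtr_ge0|apply: exprn_ge0; rewrite invr_ge0].
  rewrite /geometric/= -(@ler_pXn2r _ 2) ?nnegrE//.
  rewrite real_normK ?num_real// exprMn sqr_sqrtr ?fine_ge0//.
  rewrite (_ : (2^-1 ^+ k) ^+ 2 = (4 ^ k)%N%:R^-1 :> R); last first.
    by rewrite natrX -exprVn -exprM mulnC exprM; congr (_ ^+ k); field.
  by rewrite ler_pdivlMr ?ltr0n ?expn_gt0// mulrC.
have cs : cvgn (series (fun k => w k.+1 x - w k x)).
  apply: (@normed_cvg R R^o).
  apply: (series_le_cvg _ _ dS).
  - by move=> k /=.
  - by move=> k; apply: le_trans (dS k).
  - by apply: is_cvg_geometric_series; rewrite ger0_norm ?invr_ge0// invf_lt1// ltr1n.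
have wE : w ^~ x = (fun k => w 0%N x + series (fun k => w k.+1 x - w k x) k).
  apply/funext; elim => [|k IH]; first by rewrite seriesEnat/= big_geq// addr0.
  by rewrite seriesSr addrA -IH addrC subrK.
by rewrite wE; apply: is_cvgD => //; exact: is_cvg_cst.
Qed.

Lemma L2_complete (u : (T -> R)^nat) : (forall k, measurable_fun setT (u k)) ->
  (forall e : R, 0 < e -> exists N, forall i j, (N <= i)%N -> (N <= j)%N ->
    (\int[mu]_x ((u i x - u j x) ^+ 2)%:E <= e%:E)%E) ->
  exists2 v : T -> R, measurable_fun setT v &
    forall e : R, 0 < e -> exists N, forall i, (N <= i)%N ->
      (\int[mu]_x ((u i x - v x) ^+ 2)%:E <= e%:E)%E.
Proof.
move=> mu_ uC.
have e0 k : 0 < (8 ^ k.+1)%N%:R^-1 :> R by rewrite invr_gt0 ltr0n expn_gt0.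
have [N HN] := choice (fun k => uC _ (e0 k)).
(* Adding up the thresholds gives indices that are nondecreasing and dominate both [N k] and [k]. *)
pose p k := (\sum_(i < k.+1) (N i).+1)%N.
have pN k : (N k <= p k)%N by rewrite /p big_ord_recr/= addnS ltnW// ltnS leq_addl.
have pS k : (p k <= p k.+1)%N by rewrite /p [leqRHS]big_ord_recr/= leq_addr.
have pk k : (k <= p k)%N.
  elim: k => [//|k IH]; rewrite /p big_ord_recr/= addnS ltnS.
  by rewrite (leq_trans IH)// leq_addr.
have cw := @cvg_ae_of_summable (fun k => u (p k)) (fun k => mu_ (p k)) _.
have {}cw : {ae mu, forall x, cvgn (fun k => u (p k) x)}.
  by apply: cw => k; apply: HN; [exact: leq_trans (pS k)|exact: pN].
(* A lower limit is measurable everywhere, including on the null set where the subsequence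
   diverges. *)
pose v x := fine (limn_einf (fun k => (u (p k) x)%:E)).
have mv : measurable_fun setT v.
  apply: (measurableT_comp (f := fine)); first exact: fine_measurable.
  under eq_fun do rewrite /limn_einf.
  apply: measurableT_comp => //; apply: measurable_fun_limn_esup => n.
  by apply: (measurableT_comp (f := (-%E : \bar R -> \bar R))) => //; exact/measurable_EFinP.
have {}cw : {ae mu, forall x, u (p k) x @[k --> \oo] --> v x}.
  apply: (aeS _ cw) => x /cvg_ex[l ul].
  have El : (u (p k) x)%:E @[k --> \oo] --> l%:E by apply: cvg_EFin => //; exact: nearW.
  rewrite /v is_cvg_limn_einfE; last by apply/cvg_ex; exists l%:E.
  by rewrite (cvg_lim _ El).
exists v => // e e_gt0; have [M HM] := uC e e_gt0; exists M => i Mi.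
(* Shifting by [M] keeps every index of the subsequence beyond the Cauchy threshold. *)
apply: (@fatou_bound _ _ _ mu (fun k x => (u i x - u (p (k + M)%N) x) ^+ 2)).
- by move=> k; apply: measurable_funX; exact: measurable_funB.
- by apply: measurable_funX; exact: measurable_funB.
- by move=> k x; exact: sqr_ge0.
- by move=> x; exact: sqr_ge0.
- apply: (aeS _ cw) => x ux.
  have ux' : u (p (k + M)%N) x @[k --> \oo] --> v x.
    by move: ux; rewrite -(cvg_shiftn M).
  rewrite expr2; apply: cvgM; apply: cvgB => //; exact: cvg_cst.
- by move=> k; apply: HM => //; apply: leq_trans (pk _); rewrite leq_addl.
Qed.

End RieszFischer.

(** * Norm, inner product and limits in L2 *)

Section L2Space.
Context d (T : measurableType d) (R : realType) (mu : {measure set T -> \bar R}).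
Implicit Types f g h : T -> R[i].
Local Notation sq := (sqL2norm mu).

Lemma sqL2norm_ge0 f : (0 <= sq f)%E.
Proof. by apply: integral_ge0 => x _; rewrite lee_fin sqr_ge0. Qed.

Lemma L2_fin_num f : L2 mu f -> sq f \is a fin_num.
Proof. by move=> [_ ?]; rewrite ge0_fin_numE// sqL2norm_ge0. Qed.

Lemma measurable_sq f : cmeasurable f ->
  measurable_fun setT (fun x => (normc (f x) ^+ 2)%:E).
Proof. by move=> mf; apply/measurable_EFinP; exact: measurable_normc_sqr. Qed.

Lemma eq_sqL2norm f g : (forall x, normc (f x) = normc (g x)) -> sq f = sq g.
Proof. by move=> fg; apply: eq_integral => x _; rewrite fg. Qed.

Lemma le_sqL2norm f g : cmeasurable f -> cmeasurable g ->
  (forall x, normc (f x) <= normc (g x)) -> (sq f <= sq g)%E.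
Proof.
move=> mf mg fg; apply: ge0_le_integral => //.
- by move=> x _; rewrite lee_fin sqr_ge0.
- exact: measurable_sq.
- exact: measurable_sq.
- by move=> x _; rewrite lee_fin ler_pXn2r// nnegrE normc_ge0.
Qed.

Lemma sqL2normE f : cmeasurable f ->
  (sq f = \int[mu]_x (Re (f x) ^+ 2)%:E + \int[mu]_x (Im (f x) ^+ 2)%:E)%E.
Proof.
move=> [mr mi]; rewrite -ge0_integralD//.
- by apply: eq_integral => x _; rewrite normc_sqr.
- by move=> x _; rewrite lee_fin sqr_ge0.
- by apply/measurable_EFinP; exact: measurable_funX.
- by move=> x _; rewrite lee_fin sqr_ge0.
- by apply/measurable_EFinP; exact: measurable_funX.
Qed.

(** Stands in for the triangle inequality, so that square roots of integrals never appear. The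
    factor 2 is harmless in questions of finiteness and of convergence to 0. *)
Lemma normc_sqrD_le (z w : R[i]) :
  normc (z + w) ^+ 2 <= 2 * normc z ^+ 2 + 2 * normc w ^+ 2.
Proof.
rewrite !normc_sqr ReD ImD.
have := sqr_ge0 (Re z - Re w); have := sqr_ge0 (Im z - Im w).
by rewrite !sqrrB !sqrrD; lra.
Qed.

Lemma sqL2normD_le f g : cmeasurable f -> cmeasurable g ->
  (sq (fun x => f x + g x)%R <= 2%:E * sq f + 2%:E * sq g)%E.
Proof.
move=> mf mg; rewrite /sqL2norm -!ge0_integralZl//;
  try (by move=> x _; rewrite lee_fin sqr_ge0); try exact: measurable_sq.
have m2 h : cmeasurable h -> measurable_fun setT (fun x => 2%:E * (normc (h x) ^+ 2)%:E)%E.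
  by move=> mh; apply: emeasurable_funM => //; exact: measurable_sq.
have g2 h x : (0 <= 2%:E * (normc (h x) ^+ 2)%:E :> \bar R)%E.
  by rewrite -EFinM lee_fin mulr_ge0// sqr_ge0.
rewrite -ge0_integralD//; [|exact: m2..].
apply: ge0_le_integral => //.
- by move=> x _; rewrite lee_fin sqr_ge0.
- exact/measurable_sq/cmeasurableD.
- by apply: emeasurable_funD; exact: m2.
- by move=> x _; rewrite -!EFinM -EFinD lee_fin normc_sqrD_le.
Qed.

Lemma sqL2normN f : sq (fun x => - f x) = sq f.
Proof. by apply: eq_sqL2norm => x; rewrite normcN. Qed.

Lemma sqL2normB_le f g : cmeasurable f -> cmeasurable g ->
  (sq (fun x => f x - g x)%R <= 2%:E * sq f + 2%:E * sq g)%E.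
Proof.
by move=> mf mg; rewrite -(sqL2normN g); apply: sqL2normD_le => //; exact: cmeasurableN.
Qed.

Lemma sqL2normBC f g : sq (fun x => f x - g x) = sq (fun x => g x - f x).
Proof. by apply: eq_sqL2norm => x; rewrite -normcN opprB. Qed.

Lemma L2N f : L2 mu f -> L2 mu (fun x => - f x).
Proof. by move=> [mf foo]; split; [exact: cmeasurableN|rewrite sqL2normN]. Qed.

Lemma L2D f g : L2 mu f -> L2 mu g -> L2 mu (fun x => f x + g x).
Proof.
move=> [mf foo] [mg goo]; split; first exact: cmeasurableD.
apply: le_lt_trans (sqL2normD_le mf mg) _.
by rewrite lte_add_pinfty// lte_mul_pinfty.
Qed.

Lemma L2B f g : L2 mu f -> L2 mu g -> L2 mu (fun x => f x - g x).
Proof. by move=> ? ?; apply: L2D => //; exact: L2N. Qed.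

Lemma L2_bound f g : cmeasurable f -> L2 mu g ->
  (forall x, normc (f x) <= normc (g x)) -> L2 mu f.
Proof.
by move=> mf [mg goo] fg; split => //; apply: le_lt_trans goo; exact: le_sqL2norm.
Qed.

Lemma sqL2normZ (c : R) f : cmeasurable f ->
  (sq (fun x => c%:C%C * f x)%R = (c ^+ 2)%:E * sq f)%E.
Proof.
move=> mf; rewrite /sqL2norm -ge0_integralZl//.
- apply: eq_integral => x _; rewrite normcM normc_real exprMn real_normK ?num_real//.
- exact: measurable_sq.
- by move=> x _; rewrite lee_fin sqr_ge0.
- by rewrite lee_fin sqr_ge0.
Qed.

Lemma L2Z (c : R) f : L2 mu f -> L2 mu (fun x => c%:C%C * f x).
Proof.
move=> [mf foo]; split; first by apply: cmeasurableM => //; exact: cmeasurable_cst.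
by rewrite sqL2normZ// lte_mul_pinfty// lee_fin sqr_ge0.
Qed.

Lemma L2_mulb f (g : T -> R[i]) (C : R) : L2 mu f -> cmeasurable g ->
  (forall x, normc (g x) <= C) -> L2 mu (fun x => g x * f x).
Proof.
move=> Lf mg gC; have [mf foo] := Lf.
apply: (L2_bound _ (L2Z C Lf)); first exact: cmeasurableM.
move=> x; rewrite !normcM normc_real ler_wpM2r ?normc_ge0//.
by apply: le_trans (gC x) _; exact: ler_norm.
Qed.

Lemma sqL2norm_ae f g : cmeasurable f -> cmeasurable g -> ae_eq mu setT f g ->
  sq f = sq g.
Proof.
move=> mf mg fg; apply: ge0_ae_eq_integral => //.
- exact: measurable_sq.
- exact: measurable_sq.
- by move=> x _; rewrite lee_fin sqr_ge0.
- by move=> x _; rewrite lee_fin sqr_ge0.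
- by apply: aeS fg => x /= /[apply] ->.
Qed.

Lemma sqL2norm_eq0 f : cmeasurable f -> sq f = 0%E -> ae_eq mu setT f (fun=> 0).
Proof.
move=> mf f0.
have := (ae_eq_integral_abs mu measurableT (measurable_sq mf)).1.
under eq_integral do rewrite gee0_abs ?lee_fin ?sqr_ge0//.
move=> /(_ f0); apply: aeS => x /= /[apply] -[/eqP].
by rewrite sqrf_eq0 => /eqP /eq0_normc.
Qed.

Lemma ae_eq_sub0 f g : ae_eq mu setT (fun x => f x - g x) (fun=> 0) -> ae_eq mu setT f g.
Proof. by apply: aeS => x /= /[apply]/eqP; rewrite subr_eq0 => /eqP. Qed.

Lemma cintegrable_inner f g : L2 mu f -> L2 mu g ->
  cintegrable mu (fun x => f x * conjc (g x)).
Proof.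
move=> [mf foo] [mg goo].
apply: (le_cintegrable (g := fun x => normc (f x) * normc (g x))).
- by apply: cmeasurableM => //; exact: cmeasurable_conjc.
- by apply: integrable_mul_sqr => //; exact: measurable_normc.
- by move=> x; rewrite normcM normc_conjc.
Qed.

(** Cauchy-Schwarz on the moduli bounds the real and the imaginary part separately; adding them
    costs the factor 2. Only continuity of the inner product is drawn from it. *)
Lemma L2inner_le f g : L2 mu f -> L2 mu g ->
  normc (L2inner mu f g) ^+ 2 <= 2 * (fine (sq f) * fine (sq g)).
Proof.
move=> Lf Lg; have [ir ii] := cintegrable_inner Lf Lg.
have [mf foo] := Lf; have [mg goo] := Lg.
have mnf := measurable_normc mf; have mng := measurable_normc mg.
have i2 := integrable_mul_sqr mnf mng foo goo.
have CS := cauchy_schwarz_Rintegral mnf mng foo goo.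
have I0 : 0 <= \int[mu]_x (normc (f x) * normc (g x)).
  by apply: Rintegral_ge0 => x _; rewrite mulr_ge0 ?normc_ge0.
have H (p : R[i] -> R) : (forall z, `|p z| <= normc z) ->
    mu.-integrable setT (EFin \o (fun x => p (f x * conjc (g x)))) ->
    (\int[mu]_x p (f x * conjc (g x))) ^+ 2 <= fine (sq f) * fine (sq g).
  move=> pn ip; apply: le_trans CS.
  rewrite -real_normK ?num_real// ler_pXn2r ?nnegrE//.
  apply: le_trans (le_normr_Rintegral measurableT ip) _.
  apply: le_Rintegral => //; first exact: integrable_norm.
  by move=> x _; apply: le_trans (pn _) _; rewrite normcM normc_conjc.
rewrite normc_sqr mulr_natl mulr2n lerD//.
- exact: (H _ (@normr_Re_le R)).
- exact: (H _ (@normr_Im_le R)).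
Qed.

Lemma L2innerBl f g h : L2 mu f -> L2 mu g -> L2 mu h ->
  L2inner mu (fun x => f x - g x) h = L2inner mu f h - L2inner mu g h.
Proof.
move=> Lf Lg Lh; rewrite /L2inner -cintegralB; [|exact: cintegrable_inner..].
by congr cintegral; apply/funext => x; rewrite mulrBl.
Qed.

Lemma L2innerC f g : L2 mu f -> L2 mu g -> L2inner mu g f = conjc (L2inner mu f g).
Proof.
move=> Lf Lg; rewrite /L2inner -cintegral_conjc; last exact: cintegrable_inner.
congr cintegral; apply/funext => x; apply: complex_ext; rewrite !complexE; ring.
Qed.

Lemma L2innerBr f g h : L2 mu f -> L2 mu g -> L2 mu h ->
  L2inner mu h (fun x => f x - g x) = L2inner mu h f - L2inner mu h g.
Proof.
move=> Lf Lg Lh; rewrite (L2innerC (L2B Lf Lg) Lh) L2innerBl// (L2innerC Lf Lh) (L2innerC Lg Lh).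
by apply: complex_ext; rewrite !complexE; ring.
Qed.

Lemma L2innerZr (c : R) f h : L2 mu f -> L2 mu h ->
  L2inner mu h (fun x => c%:C%C * f x) = c%:C%C * L2inner mu h f.
Proof.
move=> Lf Lh; rewrite /L2inner -cintegralZ; last exact: cintegrable_inner.
congr cintegral; apply/funext => x; apply: complex_ext; rewrite !complexE/=; ring.
Qed.

Lemma L2inner_self f : L2inner mu f f = (fine (sq f))%:C%C.
Proof.
rewrite /L2inner /cintegral /sqL2norm; apply: complex_ext => /=.
  by apply: eq_Rintegral => x _; rewrite mulc_conj.
rewrite (@eq_Rintegral _ _ _ mu setT (cst 0)) ?Rintegral_cst ?mul0r// => x _.
by rewrite mulc_conj.
Qed.

Lemma L2inner_ae f f' g g' : cmeasurable f -> cmeasurable f' -> cmeasurable g ->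
  cmeasurable g' -> ae_eq mu setT f f' -> ae_eq mu setT g g' ->
  L2inner mu f g = L2inner mu f' g'.
Proof.
move=> mf mf' mg mg' ff' gg'; apply: ae_eq_cintegral.
- by apply: cmeasurableM => //; exact: cmeasurable_conjc.
- by apply: cmeasurableM => //; exact: cmeasurable_conjc.
- by apply: (aeS2 _ ff' gg') => x /= fx gx xT; rewrite fx// gx.
Qed.

Lemma cvg_sqL2norm_fine (F : nat -> T -> R[i]) :
  sq (F n) @[n --> \oo] --> 0%E -> fine (sq (F n)) @[n --> \oo] --> (0 : R).
Proof. by move=> /fine_cvgP[]. Qed.

Lemma cvgc_unique (a_ : nat -> R[i]) (a b : R[i]) (x_ y_ : nat -> R) :
  (forall n, normc (a_ n - a) ^+ 2 <= x_ n) -> (forall n, normc (a_ n - b) ^+ 2 <= y_ n) ->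
  x_ n @[n --> \oo] --> (0 : R) -> y_ n @[n --> \oo] --> (0 : R) -> a = b.
Proof.
move=> ax ay x0 y0.
have H n : normc (a - b) ^+ 2 <= 2 * x_ n + 2 * y_ n.
  rewrite (_ : a - b = - (a_ n - a) + (a_ n - b)); last by rewrite opprB addrA subrK.
  apply: le_trans (normc_sqrD_le _ _) _; rewrite normcN.
  by rewrite lerD// ler_pM2l.
have L : 2 * x_ n + 2 * y_ n @[n --> \oo] --> (2 * 0 + 2 * 0 : R).
  by apply: cvgD; apply: cvgM => //; exact: cvg_cst.
have : normc (a - b) ^+ 2 <= 2 * 0 + 2 * 0.
  rewrite -(cvg_lim (@Rhausdorff R) L); apply: limr_ge; first by apply/cvg_ex; eexists; exact: L.
  by apply: nearW => n; exact: H.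
rewrite !mulr0 addr0 => h; apply/eqP; rewrite -subr_eq0; apply/eqP/eq0_normc/eqP.
by rewrite -sqrf_eq0 eq_le h sqr_ge0.
Qed.

Lemma fine_sqL2normD_le f g : L2 mu f -> L2 mu g ->
  fine (sq (fun x => f x + g x)) <= 2 * fine (sq f) + 2 * fine (sq g).
Proof.
move=> Lf Lg; have := sqL2normD_le Lf.1 Lg.1.
rewrite -(fineK (L2_fin_num Lf)) -(fineK (L2_fin_num Lg)).
by rewrite -(fineK (L2_fin_num (L2D Lf Lg))) -!EFinM -EFinD lee_fin.
Qed.

(** The norm of [g'] is expressed through [g] and [g - g'], so the bound tends to 0 as soon as the
    two distances do. *)
Lemma L2inner_dist f g f' g' : L2 mu f -> L2 mu g -> L2 mu f' -> L2 mu g' ->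
  normc (L2inner mu f' g' - L2inner mu f g) ^+ 2 <=
  4 * (fine (sq (fun x => f x - f' x)) *
      (2 * fine (sq g) + 2 * fine (sq (fun x => g x - g' x)))) +
  4 * (fine (sq f) * fine (sq (fun x => g x - g' x))).
Proof.
move=> Lf Lg Lf' Lg'.
rewrite (_ : _ - _ = L2inner mu (fun x => f' x - f x) g' +
   L2inner mu f (fun x => g' x - g x)); last by rewrite L2innerBl// L2innerBr//; ring.
apply: le_trans (normc_sqrD_le _ _) _.
have h1 := L2inner_le (L2B Lf' Lf) Lg'; have h2 := L2inner_le Lf (L2B Lg' Lg).
rewrite sqL2normBC in h1; rewrite [X in _ * fine X]sqL2normBC in h2.
have h3 : fine (sq g') <= 2 * fine (sq g) + 2 * fine (sq (fun x => g x - g' x)).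
  rewrite [X in fine X](_ : _ = sq (fun x => g x + (g' x - g x))); last first.
    by congr sqL2norm; apply/funext => x; rewrite addrC subrK.
  by rewrite [X in _ <= _ + _ * fine X]sqL2normBC; apply: fine_sqL2normD_le => //; exact: L2B.
have d0 : 0 <= fine (sq (fun x => f x - f' x)) by rewrite fine_ge0// sqL2norm_ge0.
have h4 := ler_wpM2l d0 h3.
by apply: lerD; [apply: le_trans (_ : 2 * (2 * (fine (sq (fun x => f x - f' x)) * fine (sq g'))) <= _)|];
  lra.
Qed.

(** Carries identities that hold for truncations over to the L2 limits. The isometry is the case of
    equal arguments in each inner product, the duality the case [c = 1]. *)
Lemma L2inner_lim (c : R) f g h k (F G H K : nat -> T -> R[i]) :
  L2 mu f -> L2 mu g -> L2 mu h -> L2 mu k ->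
  (forall n, L2 mu (F n)) -> (forall n, L2 mu (G n)) ->
  (forall n, L2 mu (H n)) -> (forall n, L2 mu (K n)) ->
  sq (fun x => f x - F n x) @[n --> \oo] --> 0%E ->
  sq (fun x => g x - G n x) @[n --> \oo] --> 0%E ->
  sq (fun x => h x - H n x) @[n --> \oo] --> 0%E ->
  sq (fun x => k x - K n x) @[n --> \oo] --> 0%E ->
  (forall n, L2inner mu (F n) (G n) = c%:C%C * L2inner mu (H n) (K n)) ->
  L2inner mu f g = c%:C%C * L2inner mu h k.
Proof.
move=> Lf Lg Lh Lk LF LG LH LK fF gG hH kK FGHK.
have D (u v : T -> R[i]) (U V : nat -> T -> R[i]) :
    sq (fun x => u x - U n x) @[n --> \oo] --> 0%E ->
    sq (fun x => v x - V n x) @[n --> \oo] --> 0%E ->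
    4 * (fine (sq (fun x => u x - U n x)) *
      (2 * fine (sq v) + 2 * fine (sq (fun x => v x - V n x)))) +
    4 * (fine (sq u) * fine (sq (fun x => v x - V n x))) @[n --> \oo] --> (0 : R).
  move=> /cvg_sqL2norm_fine uU /cvg_sqL2norm_fine vV.
  have c2 a : (a : R) @[n --> \oo] --> a by exact: cvg_cst.
  rewrite (_ : 0 = 4 * (0 * (2 * fine (sq v) + 2 * 0)) + 4 * (fine (sq u) * 0)); last by ring.
  by apply: cvgD; apply: cvgM => //; apply: cvgM => //; apply: cvgD => //; apply: cvgM.
apply: (cvgc_unique (a_ := fun n => L2inner mu (F n) (G n))) (D _ _ _ _ fF gG) _.
- by move=> n; exact: L2inner_dist.
- move=> n; rewrite FGHK -mulrBr normcM exprMn normc_real real_normK ?num_real//.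
  by apply: ler_wpM2l (L2inner_dist Lh Lk (LH n) (LK n)); rewrite sqr_ge0.
- rewrite -[X in _ --> X](mulr0 (c ^+ 2)); apply: cvgM; first exact: cvg_cst.
  exact: D.
Qed.

Lemma sqL2norm_lim_unique f g (F : nat -> T -> R[i]) :
  cmeasurable f -> cmeasurable g -> (forall n, cmeasurable (F n)) ->
  sq (fun x => f x - F n x) @[n --> \oo] --> 0%E ->
  sq (fun x => g x - F n x) @[n --> \oo] --> 0%E -> ae_eq mu setT f g.
Proof.
move=> mf mg mF fF gF; apply: ae_eq_sub0; apply: sqL2norm_eq0; first exact: cmeasurableB.
apply/eqP; rewrite eq_le sqL2norm_ge0 andbT.
have L : (2%:E * sq (fun x => f x - F n x)%R + 2%:E * sq (fun x => g x - F n x)%R)%E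
    @[n --> \oo] --> (2%:E * 0 + 2%:E * 0 : \bar R)%E.
  by apply: cvgeD; [rewrite !mule0| |]; rewrite ?mule0//;
     rewrite -[X in _ --> X](mule0 2%:E); apply: cvgeZl.
rewrite !mule0 adde0 in L.
rewrite -(cvg_lim (@ereal_hausdorff R) L); apply: lime_ge; first by apply/cvg_ex; eexists; exact: L.
apply: nearW => n.
rewrite (_ : (fun x => f x - g x) = (fun x => (f x - F n x) - (g x - F n x))); last first.
  by apply/funext => x; rewrite opprB addrA subrK.
by apply: sqL2normB_le; exact: cmeasurableB.
Qed.

Lemma L2c_complete (F : nat -> T -> R[i]) : (forall k, cmeasurable (F k)) ->
  (forall e : R, 0 < e -> exists N, forall i j, (N <= i)%N -> (N <= j)%N ->
    (sq (fun x => F i x - F j x)%R <= e%:E)%E) ->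
  exists2 G, cmeasurable G & sq (fun x => G x - F n x) @[n --> \oo] --> 0%E.
Proof.
move=> mF FC.
have leR i j : (\int[mu]_x ((Re (F i x) - Re (F j x)) ^+ 2)%:E <=
    sq (fun x => F i x - F j x)%R)%E.
  rewrite sqL2normE; last exact: cmeasurableB.
  under [X in (_ <= X + _)%E]eq_integral do rewrite ReB.
  by rewrite leeDl// integral_ge0// => x _; rewrite lee_fin sqr_ge0.
have leI i j : (\int[mu]_x ((Im (F i x) - Im (F j x)) ^+ 2)%:E <=
    sq (fun x => F i x - F j x)%R)%E.
  rewrite sqL2normE; last exact: cmeasurableB.
  under [X in (_ <= _ + X)%E]eq_integral do rewrite ImB.
  by rewrite leeDr// integral_ge0// => x _; rewrite lee_fin sqr_ge0.
have [a ma Ha] : exists2 v : T -> R, measurable_fun setT v &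
    forall e : R, 0 < e -> exists N, forall i, (N <= i)%N ->
      (\int[mu]_x ((Re (F i x) - v x) ^+ 2)%:E <= e%:E)%E.
  apply: (L2_complete (u := fun k x => Re (F k x))); first by move=> k; exact: (mF k).1.
  move=> e /FC[N HN]; exists N => i j Ni Nj.
  by apply: le_trans (HN _ _ Ni Nj); exact: leR.
have [b mb Hb] : exists2 v : T -> R, measurable_fun setT v &
    forall e : R, 0 < e -> exists N, forall i, (N <= i)%N ->
      (\int[mu]_x ((Im (F i x) - v x) ^+ 2)%:E <= e%:E)%E.
  apply: (L2_complete (u := fun k x => Im (F k x))); first by move=> k; exact: (mF k).2.
  move=> e /FC[N HN]; exists N => i j Ni Nj.
  by apply: le_trans (HN _ _ Ni Nj); exact: leI.
have mG : cmeasurable (fun x => Complex (a x) (b x)) by split.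
exists (fun x => Complex (a x) (b x)) => //.
have E n : sq (fun x => Complex (a x) (b x) - F n x)%R =
   (\int[mu]_x ((Re (F n x) - a x) ^+ 2)%:E + \int[mu]_x ((Im (F n x) - b x) ^+ 2)%:E)%E.
  rewrite sqL2normBC sqL2normE; last exact: cmeasurableB.
  by congr (_ + _)%E; apply: eq_integral => x _; rewrite ?ReB ?ImB.
have H e : 0 < e -> \forall n \near \oo,
    (sq (fun x => Complex (a x) (b x) - F n x)%R <= e%:E)%E.
  move=> e0; have e2 : 0 < e / 2 by rewrite divr_gt0.
  have [N HN] := Ha _ e2; have [M HM] := Hb _ e2.
  near=> n; rewrite E (_ : e%:E = (e / 2)%:E + (e / 2)%:E)%E; last first.
    by rewrite -EFinD; congr EFin; lra.
  apply: leeD; [apply: HN|apply: HM]; near: n; exact: nbhs_infty_ge.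
apply/fine_cvgP; split.
  have := H 1 ltr01; apply: filterS => n Hn.
  by rewrite ge0_fin_numE ?sqL2norm_ge0// (le_lt_trans Hn)// ltry.
apply/cvgrPdist_le => e e0; have := H e e0; apply: filterS => n Hn.
rewrite sub0r normrN ger0_norm ?fine_ge0 ?sqL2norm_ge0//.
rewrite -lee_fin fineK// ge0_fin_numE ?sqL2norm_ge0//.
by rewrite (le_lt_trans Hn)// ltry.
Unshelve. all: by end_near. Qed.

End L2Space.

(** * The central Fourier transform *)

Section CentralTransform.
Context (R : realType) (n : nat).
Local Notation leb := (@lebesgue_measure R).
Local Notation mR := (measurableTypeR R).
Local Notation X := (R2n R n).
Local Notation mX := (leb2n R n).
Local Notation H := (Heis R n).
Local Notation mH := (haar R n).
Local Notation sq := (sqL2norm mH).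
Implicit Types (f g h F G : H -> R[i]) (sg : R).

Definition sym_itv (N : nat) : set R := `[- N%:R, N%:R]%classic.

Definition cut (N : nat) f : H -> R[i] :=
  fun k => (\1_(sym_itv N) k.2)%:C%C * f k.

Definition partial_fourier sg f : H -> R[i] := fun k =>
  cintegral leb setT (fun t => f (k.1, t) * cis (sg * k.2 * t)).

(** Moving the truncation from the domain to the function makes the results on the whole line
    applicable. *)
Lemma central_truncE sg N f : central_trunc sg N f = partial_fourier sg (cut N f).
Proof.
apply/funext => k; rewrite /central_trunc cintegral_mkcond /partial_fourier.
by congr cintegral; apply/funext => t; rewrite /cut mulrA.
Qed.

Lemma normc_cut_le N f k : normc (cut N f k) <= normc (f k).
Proof.
rewrite /cut normcM normc_real ler_piMl ?normc_ge0// indicE.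
by case: (_ \in _); rewrite ?normr1 ?normr0.
Qed.

Lemma cmeasurable_cut N f : cmeasurable f -> cmeasurable (cut N f).
Proof.
move=> mf; apply: cmeasurableM => //; apply: cmeasurable_real.
apply: (measurableT_comp (f := \1_(sym_itv N) : mR -> R)).
  by apply: measurable_indic; exact: measurable_itv.
exact: measurable_snd.
Qed.

Lemma L2_cut N f : L2 mH f -> L2 mH (cut N f).
Proof.
move=> Lf; apply: (L2_bound _ Lf); first exact: cmeasurable_cut Lf.1.
by move=> k; exact: normc_cut_le.
Qed.

Lemma cmeasurable_partial_fourier sg f : cmeasurable f ->
  cmeasurable (partial_fourier sg f).
Proof.
move=> mf.
apply: (cmeasurable_cintegral1 leb
  (f := fun z : H * mR => f (z.1.1, z.2) * cis (sg * z.1.2 * z.2))).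
apply: cmeasurableM.
  apply: (cmeasurable_comp (h := fun z : H * mR => (z.1.1, z.2)) mf).
  by apply: measurable_fun_pair => //; exact: measurableT_comp.
apply: cmeasurable_cis.
have m2 : measurable_fun setT (fun z : H * mR => z.2 : R) by exact: measurable_snd.
have m1 : measurable_fun setT (fun z : H * mR => z.1.2 : R).
  by apply: (measurableT_comp (f := snd)) => //; exact: measurable_snd.
by apply: measurable_funM => //; exact: measurable_funM.
Qed.

Lemma partial_fourier_isometry sg h : sg = 1 \/ sg = -1 -> cmeasurable h ->
  {ae mX, forall x, cintegrable leb (fun t => h (x, t))} ->
  (sq (partial_fourier sg h) = (2 * kappa R)%:E * sq h)%E.
Proof.
move=> sg1 mh ih; have k0 : 0 <= 2 * kappa R by rewrite mulr_ge0// ltW// kappa_gt0.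
have m1 := measurable_sq (cmeasurable_partial_fourier sg mh).
have m2 := measurable_sq mh.
have p1 (k : H) : (0 <= (normc (partial_fourier sg h k) ^+ 2)%:E)%E by rewrite lee_fin sqr_ge0.
have p2 (k : H) : (0 <= (normc (h k) ^+ 2)%:E)%E by rewrite lee_fin sqr_ge0.
rewrite [LHS](fubini_tonelli1 (m1 := mX) (m2 := leb) _ m1 p1).
rewrite [X in (_ * X)%E](fubini_tonelli1 (m1 := mX) (m2 := leb) _ m2 p2).
rewrite -ge0_integralZl//; last 2 first.
- exact: (measurable_fun_fubini_tonelli_F _ m2 p2).
- by move=> x _; apply: integral_ge0 => t _; exact: p2.
apply: ge0_ae_eq_integral => //.
- exact: (measurable_fun_fubini_tonelli_F _ m1 p1).
- apply: emeasurable_funM => //; exact: (measurable_fun_fubini_tonelli_F _ m2 p2).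
- by move=> x _; apply: integral_ge0 => t _; exact: p1.
- by move=> x _; apply: mule_ge0 => //; apply: integral_ge0 => t _; exact: p2.
- by apply: (aeS _ ih) => x ix _; exact: (plancherel_line sg1 ix).
Qed.

Lemma ae_L2_fiber f : L2 mH f -> {ae mX, forall x, L2 leb (fun t => f (x, t))}.
Proof.
move=> [mf foo].
have m2 := measurable_sq mf.
have p2 (k : H) : (0 <= (normc (f k) ^+ 2)%:E)%E by rewrite lee_fin sqr_ge0.
have mF : measurable_fun setT (fun x : X => \int[leb]_t (normc (f (x, t)) ^+ 2)%:E)%E.
  exact: (measurable_fun_fubini_tonelli_F _ m2 p2).
have iF : mX.-integrable setT (fun x : X => \int[leb]_t (normc (f (x, t)) ^+ 2)%:E)%E.
  apply/integrableP; split => //.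
  under eq_integral do rewrite gee0_abs ?integral_ge0//.
  by rewrite -(fubini_tonelli1 (m1 := mX) (m2 := leb) _ m2 p2).
apply: (aeS _ (integrable_ae measurableT iF)) => x /(_ I) fx; split.
  by apply: (cmeasurable_comp mf); exact: measurable_fun_pair.
by rewrite -ge0_fin_numE// integral_ge0.
Qed.

(** Almost every fiber is square integrable, hence integrable against the indicator of a bounded
    interval. *)
Lemma ae_cut_cintegrable N f : L2 mH f ->
  {ae mX, forall x, cintegrable leb (fun t => cut N f (x, t))}.
Proof.
move=> Lf; apply: (aeS _ (ae_L2_fiber Lf)) => x [mfx fxoo].
have mN : cmeasurable (fun t : mR => (\1_(sym_itv N) t)%:C%C : R[i]).
  by apply: cmeasurable_real; apply: measurable_indic; exact: measurable_itv.
have i2 : (\int[leb]_t (normc ((\1_(sym_itv N) t)%:C%C : R[i]) ^+ 2)%:E < +oo)%E.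
  rewrite (eq_integral (fun t : mR => (\1_(sym_itv N) t)%:E)); last first.
    move=> t _; rewrite normc_real indicE.
    by case: (_ \in _); rewrite ?normr1 ?normr0 ?expr1n ?expr0n.
  by rewrite integral_indic_itv ?ltry// (@le_trans _ _ 0)// oppr_le0.
apply: (le_cintegrable (g := fun t : mR =>
  normc ((\1_(sym_itv N) t)%:C%C : R[i]) * normc (f (x, t)))).
- exact: cmeasurableM.
- by apply: integrable_mul_sqr => //; exact: measurable_normc.
- by move=> t; rewrite /cut normcM.
Qed.

Lemma cvg_cut f : L2 mH f -> sq (fun k => f k - cut N f k) @[N --> \oo] --> 0%E.
Proof.
move=> [mf foo].
have mN N : measurable_fun setT (fun k => (normc (f k - cut N f k) ^+ 2)%:E).
  by apply: measurable_sq; apply: cmeasurableB => //; exact: cmeasurable_cut.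
have h1 : {ae mH, forall k, setT k ->
    (normc (f k - cut N f k) ^+ 2)%:E @[N --> \oo] --> 0%E}.
  apply: aeW => k _; apply: cvg_near_cst.
  near=> N; rewrite /cut indicE mem_set ?mul1r ?subrr ?normcE /= ?expr0n/= ?addr0 ?sqrtr0 ?expr0n//.
  by rewrite /sym_itv/= in_itv/= -ler_norml; near: N; exact: nbhs_infty_ger.
have h2 : mH.-integrable setT (fun k => (normc (f k) ^+ 2)%:E).
  apply/integrableP; split; first exact: measurable_sq.
  by under eq_integral do rewrite gee0_abs ?lee_fin ?sqr_ge0//.
have h3 : {ae mH, forall k N, setT k ->
    (`|(normc (f k - cut N f k) ^+ 2)%:E| <= (normc (f k) ^+ 2)%:E)%E}.
  apply: aeW => k N _; rewrite gee0_abs ?lee_fin ?sqr_ge0//.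
  rewrite ler_pXn2r ?nnegrE ?normc_ge0// /cut -{1}[f k]mul1r -mulrBl normcM.
  rewrite ler_piMl ?normc_ge0// indicE; case: (_ \in _).
    by rewrite subrr normcE /= expr0n/= addr0 sqrtr0.
  by rewrite subr0 normc1.
have [_ _] := dominated_convergence measurableT mN (measurable_cst _) h1 h2 h3.
by rewrite integral0.
Unshelve. all: by end_near. Qed.

End CentralTransform.

(** * Existence, isometry, duality and surjectivity of the transform *)

Section CentralPlancherel.
Context (R : realType) (n : nat).
Local Notation leb := (@lebesgue_measure R).
Local Notation mR := (measurableTypeR R).
Local Notation mX := (leb2n R n).
Local Notation H := (Heis R n).
Local Notation mH := (haar R n).
Local Notation sq := (sqL2norm mH).
Implicit Types (f g h F G : H -> R[i]) (sg : R).

Let kappa2_ge0 : 0 <= 2 * kappa R.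
Proof. by rewrite mulr_ge0// ltW// kappa_gt0. Qed.

Lemma sq_central_trunc sg N f : sg = 1 \/ sg = -1 -> L2 mH f ->
  (sq (central_trunc sg N f) = (2 * kappa R)%:E * sq (cut N f))%E.
Proof.
move=> sg1 Lf; rewrite central_truncE; apply: partial_fourier_isometry => //.
  exact: cmeasurable_cut Lf.1.
exact: ae_cut_cintegrable.
Qed.

Lemma L2_central_trunc sg N f : sg = 1 \/ sg = -1 -> L2 mH f ->
  L2 mH (central_trunc sg N f).
Proof.
move=> sg1 Lf; split.
  by rewrite central_truncE; apply: cmeasurable_partial_fourier; exact: cmeasurable_cut Lf.1.
by rewrite sq_central_trunc// lte_mul_pinfty//; exact: (L2_cut N Lf).2.
Qed.

(** The transform is linear only on fibers where both cuts are integrable, that is almost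
    everywhere, so the isometry is applied to the difference of the cuts and transferred. *)
Lemma sq_central_truncB sg N M f : sg = 1 \/ sg = -1 -> L2 mH f ->
  (sq (fun k => central_trunc sg N f k - central_trunc sg M f k)%R =
   (2 * kappa R)%:E * sq (fun k => cut N f k - cut M f k)%R)%E.
Proof.
move=> sg1 Lf; rewrite !central_truncE.
have mc N' := cmeasurable_cut N' Lf.1.
have mp N' := cmeasurable_partial_fourier sg (mc N').
have ic N' := ae_cut_cintegrable N' Lf.
rewrite -(partial_fourier_isometry sg1); last 2 first.
- exact: cmeasurableB.
- by apply: (aeS2 _ (ic N) (ic M)) => x iN iM; exact: cintegrableB.
apply: sqL2norm_ae.
- exact: cmeasurableB.
- by apply: cmeasurable_partial_fourier; exact: cmeasurableB.
- have : {ae mX, forall x, cintegrable leb (fun t => cut N f (x, t)) /\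
      cintegrable leb (fun t => cut M f (x, t))}.
    by apply: (aeS2 _ (ic N) (ic M)).
  move=> /(ae_prodm1 leb); apply: aeS => k [iN iM] _.
  have mk : measurable_fun setT (fun t : mR => sg * k.2 * t) by exact: measurable_funM.
  rewrite /partial_fourier -cintegralB; [|exact: cintegrable_cis..].
  by congr cintegral; apply/funext => t; rewrite mulrBl.
Qed.

Lemma central_transform_ex sg f : sg = 1 \/ sg = -1 -> L2 mH f ->
  exists F, is_central_transform sg f F.
Proof.
move=> sg1 Lf; have LT N := L2_central_trunc N sg1 Lf.
have LC N := L2_cut N Lf.
have [F mF FT] : exists2 F, cmeasurable F &
    sq (fun k => F k - central_trunc sg N f k) @[N --> \oo] --> 0%E.
  apply: L2c_complete; first by move=> N; exact: (LT N).1.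
  (* Chosen so that [2 * kappa R * (2 * c + 2 * c) <= e]. *)
  move=> e e0; pose c := e / (4 * (2 * kappa R) + 1).
  have d0 : 0 < 4 * (2 * kappa R) + 1 by rewrite ltr_wpDl// mulr_ge0.
  have c0 : 0 < c by rewrite divr_gt0.
  have /fine_cvgP[_ /cvgrPdist_le/(_ c c0)[N _ HN]] := cvg_cut Lf.
  exists N => i j Ni Nj; rewrite sq_central_truncB//.
  have LB k := L2B Lf (LC k).
  have bnd k : (N <= k)%N -> (sq (fun x => f x - cut k f x)%R <= c%:E)%E.
    move=> Nk; have := HN k Nk; rewrite /= sub0r normrN => h.
    rewrite -(fineK (L2_fin_num (LB k))) lee_fin.
    by apply: le_trans h; exact: ler_norm.
  rewrite (_ : (fun k => cut i f k - cut j f k) =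
    (fun k => (f k - cut j f k) - (f k - cut i f k))); last first.
    by apply/funext => k; ring.
  apply: (@le_trans _ _ ((2 * kappa R)%:E * (2%:E * c%:E + 2%:E * c%:E))%E).
    apply: lee_wpmul2l; first by rewrite lee_fin.
    apply: le_trans (sqL2normB_le mH (LB j).1 (LB i).1) _.
    by apply: leeD; apply: lee_wpmul2l => //; exact: bnd.
  rewrite [leLHS](_ : _ = (2 * kappa R * (2 * c + 2 * c))%:E)// lee_fin.
  rewrite (_ : _ * (_ + _) = e * ((4 * (2 * kappa R)) / (4 * (2 * kappa R) + 1))).
    by rewrite ler_piMr ?(ltW e0)// ler_pdivrMr// mul1r lerDl.
  by rewrite /c; field; rewrite gt_eqF.
exists F; split => //.
(* Convergence to 0 includes finiteness of some distance, and [F] is that difference plus a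
   truncation, both in L2. *)
have /fine_cvgP[[N _ HN] _] := FT; have := HN N (leqnn N); rewrite /= => fN.
have FE : F = (fun k => (F k - central_trunc sg N f k) + central_trunc sg N f k).
  by apply/funext => k; rewrite subrK.
rewrite FE; apply: L2D => //; split; first exact: cmeasurableB mF (LT N).1.
by move: fN; rewrite ge0_fin_numE// sqL2norm_ge0.
Qed.

Lemma central_transformP sg f : sg = 1 \/ sg = -1 -> L2 mH f ->
  is_central_transform sg f (central_transform sg f).
Proof. by move=> sg1 Lf; exact: xgetPex (central_transform_ex sg1 Lf). Qed.

Lemma central_transform_unique sg f F G : sg = 1 \/ sg = -1 -> L2 mH f ->
  is_central_transform sg f F -> is_central_transform sg f G ->
  ae_eq mH setT F G.
Proof.
move=> sg1 Lf [LF cF] [LG cG].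
apply: (sqL2norm_lim_unique LF.1 LG.1 _ cF cG) => N.
exact: (L2_central_trunc N sg1 Lf).1.
Qed.

Lemma central_transform_ae sg f F G : sg = 1 \/ sg = -1 -> L2 mH f ->
  is_central_transform sg f F -> L2 mH G -> ae_eq mH setT F G ->
  is_central_transform sg f G.
Proof.
move=> sg1 Lf [LF cF] LG FG; split => //.
apply: cvg_trans cF; apply: near_eq_cvg; apply: nearW => N.
have mT := (L2_central_trunc N sg1 Lf).1.
apply: sqL2norm_ae.
- exact: cmeasurableB LF.1 mT.
- exact: cmeasurableB LG.1 mT.
- by apply: (aeS _ FG) => k /= h kT; rewrite h.
Qed.

Lemma sq_central_transform sg f F : sg = 1 \/ sg = -1 -> L2 mH f ->
  is_central_transform sg f F -> fine (sq F) = 2 * kappa R * fine (sq f).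
Proof.
move=> sg1 Lf [LF cF].
have LT N := L2_central_trunc N sg1 Lf; have LC N := L2_cut N Lf.
have e N : L2inner mH (central_trunc sg N f) (central_trunc sg N f) =
    (2 * kappa R)%:C%C * L2inner mH (cut N f) (cut N f).
  by rewrite !L2inner_self -rmorphM sq_central_trunc// fineM//; exact: L2_fin_num.
have := L2inner_lim LF LF Lf Lf LT LT LC LC cF cF (cvg_cut Lf) (cvg_cut Lf) e.
by rewrite !L2inner_self -rmorphM => -[].
Qed.

(** The kernel is symmetric in [l] and [t], and conjugation reverses its sign; the rest is Fubini
    for [u] times the conjugate of [v]. *)
Lemma line_duality sg (u v : mR -> R[i]) : cintegrable leb u -> cintegrable leb v ->
  cintegral leb setT (fun l =>
    cintegral leb setT (fun t => u t * cis (sg * l * t)) * conjc (v l)) =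
  cintegral leb setT (fun t =>
    u t * conjc (cintegral leb setT (fun l => v l * cis (- sg * t * l)))).
Proof.
move=> iu iv; have icv := cintegrable_conjc iv.
have mk a : measurable_fun setT (fun t : mR => a * t : R) by exact: measurable_funM.
have iP : cintegrable (prodm leb leb)
    (fun z => u z.1 * conjc (v z.2) * cis (sg * z.2 * z.1)).
  apply: cintegrable_cis.
    exact: (@cintegrable_tensor _ _ _ _ _ leb leb u (fun x => conjc (v x))).
  have m1 : measurable_fun setT (fun z : mR * mR => z.1 : R) by exact: measurable_fst.
  have m2 : measurable_fun setT (fun z : mR * mR => z.2 : R) by exact: measurable_snd.
  by apply: measurable_funM => //; exact: measurable_funM.
transitivity (cintegral (prodm leb leb) setT
    (fun z => u z.1 * conjc (v z.2) * cis (sg * z.2 * z.1))).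
  rewrite -(cintegral_prodm2 iP); congr cintegral; apply/funext => l.
  rewrite mulrC -cintegralZ; last exact: cintegrable_cis.
  by congr cintegral; apply/funext => t /=; ring.
rewrite -(cintegral_prodm1 iP); congr cintegral; apply/funext => t.
have ic : cintegrable leb (fun l => v l * cis (- sg * t * l)) by exact: cintegrable_cis.
rewrite -cintegral_conjc// -cintegralZ; last exact: cintegrable_conjc.
congr cintegral; apply/funext => l /=.
rewrite conjcM -cisN (_ : - (- sg * t * l) = sg * l * t); last by ring.
by ring.
Qed.

Lemma central_trunc_duality sg N M f g : sg = 1 \/ sg = -1 -> L2 mH f -> L2 mH g ->
  L2inner mH (central_trunc sg N f) (cut M g) =
  L2inner mH (cut N f) (central_trunc (- sg) M g).
Proof.
move=> sg1 Lf Lg.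
have sg1' : - sg = 1 \/ - sg = -1 by case: sg1 => ->; [right|left; rewrite opprK].
have i1 := cintegrable_inner (L2_central_trunc N sg1 Lf) (L2_cut M Lg).
have i2 := cintegrable_inner (L2_cut N Lf) (L2_central_trunc M sg1' Lg).
have j1 := cintegrable_prodm1 (m1 := mX) (m2 := leb) i1.
have j2 := cintegrable_prodm1 (m1 := mX) (m2 := leb) i2.
apply: etrans (esym (cintegral_prodm1 (m1 := mX) (m2 := leb) i1)) _.
apply: etrans _ (cintegral_prodm1 (m1 := mX) (m2 := leb) i2).
apply: ae_eq_cintegral.
- exact: cintegrable_cmeasurable j1.
- exact: cintegrable_cmeasurable j2.
- apply: (aeS2 _ (ae_cut_cintegrable N Lf) (ae_cut_cintegrable M Lg)) => x ix iy _.
  rewrite !central_truncE /partial_fourier /=.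
  exact: (line_duality sg ix iy).
Qed.

Lemma central_duality sg f g F G : sg = 1 \/ sg = -1 -> L2 mH f -> L2 mH g ->
  is_central_transform sg f F -> is_central_transform (- sg) g G ->
  L2inner mH F g = L2inner mH f G.
Proof.
move=> sg1 Lf Lg [LF cF] [LG cG].
have sg1' : - sg = 1 \/ - sg = -1 by case: sg1 => ->; [right|left; rewrite opprK].
have e N : L2inner mH (central_trunc sg N f) (cut N g) =
    (1 : R)%:C%C * L2inner mH (cut N f) (central_trunc (- sg) N g).
  by rewrite (rmorph1 (real_complex R)) mul1r central_trunc_duality.
have := L2inner_lim LF Lg Lf LG (fun N => L2_central_trunc N sg1 Lf)
  (fun N => L2_cut N Lg) (fun N => L2_cut N Lf)
  (fun N => L2_central_trunc N sg1' Lg) cF (cvg_cut Lg) (cvg_cut Lf) cG e.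
by rewrite (rmorph1 (real_complex R)) mul1r.
Qed.

(* With the isometry and the duality at hand, inversion is the vanishing of the
   expansion of [|F - 2 kappa g'|^2], where [g' = g / (2 kappa)]. *)
Lemma central_transform_surj sg g : sg = 1 \/ sg = -1 -> L2 mH g ->
  exists2 f, L2 mH f & is_central_transform sg f g.
Proof.
move=> sg1 Lg.
have sg1' : - sg = 1 \/ - sg = -1 by case: sg1 => ->; [right|left; rewrite opprK].
have k0 := kappa_gt0 R; set k2 := 2 * kappa R; have k20 : 0 < k2 by rewrite mulr_gt0.
pose g' := fun k : H => (k2^-1)%:C%C * g k.
have Lg' : L2 mH g' := L2Z k2^-1 Lg.
have [f cf] := central_transform_ex sg1' Lg'.
have Lf : L2 mH f := cf.1.
have [F cF] := central_transform_ex sg1 Lf.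
have LF : L2 mH F := cF.1.
exists f; first exact: Lf.
apply: (central_transform_ae sg1 Lf cF Lg).
have n1 := sq_central_transform sg1' Lg' cf; rewrite -/k2 in n1.
have n2 := sq_central_transform sg1 Lf cF; rewrite -/k2 in n2.
have n3 := central_duality sg1 Lf Lg' cF cf.
have E1 : L2inner mH F g = (k2 * fine (sq f))%:C%C.
  transitivity (k2%:C%C * L2inner mH f f); last by rewrite L2inner_self -rmorphM.
  rewrite -n3 /g' L2innerZr// mulrA -rmorphM divff ?gt_eqF//.
  by rewrite (rmorph1 (real_complex R)) mul1r.
have E2 : fine (sq g) = k2 * fine (sq f).
  rewrite n1 /g' sqL2normZ; last exact: Lg.1.
  rewrite fineM//; last exact: L2_fin_num.
  by rewrite /=; field; rewrite gt_eqF.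
apply: ae_eq_sub0; apply: sqL2norm_eq0; first exact: cmeasurableB LF.1 Lg.1.
rewrite -(fineK (L2_fin_num (L2B LF Lg))); congr EFin.
have LB := L2B LF Lg.
have : (fine (sq (fun k => F k - g k)))%:C%C = 0 :> R[i].
  rewrite -L2inner_self L2innerBl// !L2innerBr// (L2innerC LF Lg) E1 !L2inner_self n2 E2.
  by apply: complex_ext; rewrite !complexE /=; ring.
by case.
Qed.

End CentralPlancherel.

(** * The operators Pi_lam on a fiber *)

Section AffineTuple.
Context (R : realType).
Local Notation leb := (@lebesgue_measure R).
Local Notation mR := (measurableTypeR R).

Definition affv n (a : R) (b x : Rn R n) : Rn R n := Defs.addv (scalev a x) b.

Lemma tnth_affv n a (b x : Rn R n) i : tnth (affv a b x) i = a * tnth x i + tnth b i.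
Proof. by rewrite !tnth_mktuple. Qed.

Lemma measurable_tuple_map d (T : measurableType d) n (f : T -> Rn R n) :
  (forall i, measurable_fun setT (fun x => tnth (f x) i : R)) -> measurable_fun setT f.
Proof. by move=> mf; apply/measurable_fun_tnthP => i; exact: mf. Qed.

Lemma measurable_tnthR n (i : 'I_n) : measurable_fun setT (fun x : Rn R n => tnth x i : R).
Proof. exact: measurable_tnth. Qed.

Lemma measurable_affv n a (b : Rn R n) : measurable_fun setT (affv a b).
Proof.
apply: measurable_tuple_map => i; under eq_fun do rewrite tnth_affv.
by apply: measurable_funD => //; apply: measurable_funM => //; exact: measurable_tnthR.
Qed.

Lemma affv_consn n a (b0 : R) (b : Rn R n) (z : mR * Rn R n) :
  affv a (consn (b0, b)) (consn z) = consn (a * z.1 + b0, affv a b z.2).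
Proof.
apply: eq_from_tnth => i; rewrite tnth_affv.
have [j ->|->] := unliftP ord0 i; last by [].
by rewrite /consn !tnthS tnth_affv.
Qed.

Lemma ge0_integral_affv n a (b : Rn R n) (h : Rn R n -> \bar R) : a != 0 ->
  measurable_fun setT h -> (forall x, 0 <= h x)%E ->
  (\int[lebesgue_n R n]_x h x =
   (`|a| ^+ n)%:E * \int[lebesgue_n R n]_x h (affv a b x))%E.
Proof.
move=> a0; have na : 0 <= `|a| by [].
elim: n b h => [|n IH] b h mh h0.
  rewrite expr0 mul1e; apply: eq_integral => x _; congr h.
  by rewrite (tuple0 x) (tuple0 (affv _ _ _)).
case/tupleP: b => b0 b; rewrite -/(consn (b0, b)).
have mhc : measurable_fun setT (h \o @consn R n).
  by apply: measurableT_comp => //; exact: measurable_consn.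
have mhc1 t : measurable_fun setT (fun x => h (consn (t, x))).
  by apply: (measurableT_comp (g := fun x => (t, x)) mhc); exact: measurable_fun_pair.
have mha : measurable_fun setT (fun x => h (affv a (consn (b0, b)) x)).
  by apply: (measurableT_comp mh); exact: measurable_affv.
have mI : measurable_fun setT
    (fun z : mR * Rn R n => h (consn (z.1, affv a b z.2))).
  apply: (measurableT_comp (g := fun z : mR * Rn R n => (z.1, affv a b z.2)) mhc).
  apply: measurable_fun_pair => //; apply: (measurableT_comp (f := affv a b)) => //.
  exact: measurable_affv.
rewrite !ge0_integral_lebesgue_nS//.
rewrite [LHS](fubini_tonelli1 (m1 := leb) (m2 := lebesgue_n R n) _ mhc (fun z => h0 _)).
rewrite [X in _ = (_ * X)%E](fubini_tonelli1 (m1 := leb) (m2 := lebesgue_n R n)); last 2 first.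
- by apply: (measurableT_comp (g := @consn R n) mha); exact: measurable_consn.
- by [].
transitivity (\int[leb]_t ((`|a| ^+ n)%:E *
    \int[lebesgue_n R n]_x h (consn (t, affv a b x))))%E.
  by apply: eq_integral => t _; rewrite /fubini_F (IH b (fun x => h (consn (t, x)))).
have mF : measurable_fun setT (fun t : mR => \int[lebesgue_n R n]_x h (consn (t, affv a b x)))%E.
  exact: (measurable_fun_fubini_tonelli_F _ mI).
have F0 t : (0 <= \int[lebesgue_n R n]_x h (consn (t, affv a b x)))%E.
  by apply: integral_ge0.
have an0 : (0 <= (`|a| ^+ n)%:E)%E by rewrite lee_fin exprn_ge0.
apply: etrans (ge0_integralZl leb measurableT mF (fun t _ => F0 t) an0) _.
rewrite (ge0_integral_affine b0 a0 mF F0) muleA -EFinM -exprSr; congr (_ * _)%E.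
by apply: eq_integral => t _; apply: eq_integral => x _; rewrite affv_consn.
Qed.

Definition aff2 n (a : R) (b x : R2n R n) : R2n R n := (affv a b.1 x.1, affv a b.2 x.2).

Lemma measurable_aff2 n a (b : R2n R n) : measurable_fun setT (aff2 a b).
Proof.
by apply: measurable_fun_pair; apply: (measurableT_comp (f := affv _ _)) => //;
  exact: measurable_affv.
Qed.

Lemma ge0_integral_aff2 n a (b : R2n R n) (h : R2n R n -> \bar R) : a != 0 ->
  measurable_fun setT h -> (forall x, 0 <= h x)%E ->
  (\int[leb2n R n]_x h x =
   (`|a| ^+ n * `|a| ^+ n)%:E * \int[leb2n R n]_x h (aff2 a b x))%E.
Proof.
move=> a0 mh h0.
have mh1 x : measurable_fun setT (fun y => h (x, y)).
  by apply: (measurableT_comp mh); exact: measurable_fun_pair.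
have mI : measurable_fun setT (fun z : R2n R n => h (z.1, affv a b.2 z.2)).
  apply: (measurableT_comp mh); apply: measurable_fun_pair => //.
  by apply: (measurableT_comp (f := affv _ _)) => //; exact: measurable_affv.
have mha : measurable_fun setT (fun x => h (aff2 a b x)).
  by apply: (measurableT_comp mh); exact: measurable_aff2.
rewrite [LHS](fubini_tonelli1 (m1 := lebesgue_n R n) (m2 := lebesgue_n R n) _ mh)//.
rewrite [X in _ = (_ * X)%E](fubini_tonelli1 (m1 := lebesgue_n R n) (m2 := lebesgue_n R n) _ mha)//.
transitivity (\int[lebesgue_n R n]_x ((`|a| ^+ n)%:E *
    \int[lebesgue_n R n]_y h (x, affv a b.2 y)))%E.
  by apply: eq_integral => x _; rewrite /fubini_F (ge0_integral_affv b.2 a0 (mh1 x)).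
have mF : measurable_fun setT (fun x => \int[lebesgue_n R n]_y h (x, affv a b.2 y))%E.
  exact: (measurable_fun_fubini_tonelli_F _ mI).
have F0 x : (0 <= \int[lebesgue_n R n]_y h (x, affv a b.2 y))%E by exact: integral_ge0.
have an0 : (0 <= (`|a| ^+ n)%:E)%E by rewrite lee_fin exprn_ge0.
apply: etrans (ge0_integralZl _ measurableT mF (fun x _ => F0 x) an0) _.
by rewrite (ge0_integral_affv b.1 a0 mF F0) muleA -EFinM.
Qed.

End AffineTuple.

(** * Hyperbolic functions *)

Section Hyperbolic.
Context (R : realType).
Implicit Types x : R.

Lemma expR_mulN x : expR x * expR (- x) = 1.
Proof. by rewrite -expRD subrr expR0. Qed.

Lemma cosh_gt0 x : 0 < cosh x.
Proof. by rewrite divr_gt0// addr_gt0// expR_gt0. Qed.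

Lemma cosh2Bsinh2 x : cosh x ^+ 2 - sinh x ^+ 2 = 1.
Proof. by rewrite -(expR_mulN x) /cosh /sinh; field. Qed.

Lemma sinh_double x : sinh x = 2 * sinh (x / 2) * cosh (x / 2).
Proof.
have E (y : R) : expR y = expR (y / 2) ^+ 2 by rewrite expr2 -expRD; congr expR; lra.
by rewrite /sinh /cosh (E x) (E (- x)) mulNr; field.
Qed.

Lemma sinh_gt0 x : 0 < x -> 0 < sinh x.
Proof. by move=> x0; rewrite divr_gt0// subr_gt0 ltr_expR gt0_cp. Qed.

Lemma sinhN x : sinh (- x) = - sinh x.
Proof. by rewrite /sinh opprK -mulNr opprB. Qed.

Lemma sinh_eq0 x : (sinh x == 0) = (x == 0).
Proof.
have [x0|x0|->] := ltrgtP x 0.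
- by rewrite -oppr_eq0 -sinhN gt_eqF// sinh_gt0// oppr_gt0.
- by rewrite gt_eqF// sinh_gt0.
- by rewrite /sinh oppr0 subrr mul0r eqxx.
Qed.

Lemma divr_sinh_gt0 x : x != 0 -> 0 < x / sinh x.
Proof.
move=> x0; have [x_lt0|x_gt0|/eqP] := ltrgtP x 0; last by rewrite (negbTE x0).
- by rewrite -[x / _]mulrNN -invrN -sinhN divr_gt0 ?sinh_gt0// oppr_gt0.
- by rewrite divr_gt0// sinh_gt0.
Qed.

Lemma divr_sinh_ge0 x : 0 <= x / sinh x.
Proof.
have [->|x0] := eqVneq x 0; first by rewrite mul0r.
by rewrite ltW// divr_sinh_gt0.
Qed.

(** This is the coefficient of [eta] left in the frequency after the shear that normalizes the
    shift; its powers are the Jacobian of [Pi_lam_isometry]. *)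
Lemma half_cothBtanh x : x != 0 ->
  x / 2 * coth (x / 2) - x / 2 * tanh (x / 2) = x / sinh x.
Proof.
move=> x0; rewrite sinh_double /coth /tanh.
have c0 : cosh (x / 2) != 0 by rewrite gt_eqF// cosh_gt0.
have s0 : sinh (x / 2) != 0 by rewrite sinh_eq0 mulf_neq0.
have := cosh2Bsinh2 (x / 2); set c := cosh _ in c0 *; set s := sinh _ in s0 * => cs.
rewrite -mulrBr (_ : c / s - s / c = (c ^+ 2 - s ^+ 2) / (s * c)); last first.
  by field; rewrite s0 c0.
by rewrite cs; field; rewrite s0 c0.
Qed.

Lemma measurable_sinh : measurable_fun setT (@sinh R).
Proof.
apply: measurable_funM => //; apply: measurable_funB; first exact: measurable_expR.
by apply: (measurableT_comp (f := expR)); [exact: measurable_expR|exact: oppr_measurable].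
Qed.

Lemma measurable_cosh : measurable_fun setT (@cosh R).
Proof.
apply: measurable_funM => //; apply: measurable_funD; first exact: measurable_expR.
by apply: (measurableT_comp (f := expR)); [exact: measurable_expR|exact: oppr_measurable].
Qed.

Lemma measurable_tanh : measurable_fun setT (@tanh R).
Proof.
apply: measurable_funM; first exact: measurable_sinh.
exact: measurableT_comp (@measurable_inv R) measurable_cosh.
Qed.

Lemma measurable_coth : measurable_fun setT (@coth R).
Proof.
apply: measurable_funM; first exact: measurable_cosh.
exact: measurableT_comp (@measurable_inv R) measurable_sinh.
Qed.

(* The bound only has to be integrable and finite at [0]. *)
Lemma divr_sinh_le x : x / sinh x <= 64 / (1 + x ^+ 2).
Proof.
wlog x0 : x / 0 < x.
  move=> W; have [x_lt0|x_gt0|->] := ltrgtP x 0.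
  - rewrite -[x / _]mulrNN -invrN -sinhN -sqrrN; apply: W; rewrite oppr_gt0//.
  - exact: W.
  - by rewrite mul0r expr0n addr0 divr_ge0.
have p0 : 0 < 1 + x ^+ 2 by rewrite ltr_pwDl// sqr_ge0.
rewrite ler_pdivrMr ?sinh_gt0// mulrAC ler_pdivlMr//.
have x2 : 0 < x / 2 by rewrite divr_gt0.
(* The two half-angle factors give [sinh x >= x (1 + x / 4) ^ 2 / 4], and [16 (1 + x / 4) ^ 2 = (4 +
   x) ^ 2 >= 1 + x ^ 2]; hence the 64. *)
have hs : x / 4 <= sinh (x / 2).
  have e1 := expR_ge1Dx (x / 2).
  have e2 : expR (- (x / 2)) <= (1 + x / 2)^-1.
    by rewrite expRN lef_pV2 ?posrE ?expR_gt0// addr_gt0.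
  have e3 : (1 + x / 2)^-1 <= 1 + x / 2 - x / 2.
    by rewrite addrK invf_le1 ?lerDl ?ltW// addr_gt0.
  by rewrite /sinh; lra.
have hc : (1 + x / 4) ^+ 2 / 2 <= cosh (x / 2).
  have e1 : (1 + x / 4) ^+ 2 <= expR (x / 2).
    rewrite (_ : expR (x / 2) = expR (x / 4) ^+ 2); last by rewrite expr2 -expRD; congr expR; lra.
    by rewrite ler_pXn2r ?nnegrE ?expR_ge0 ?expR_ge1Dx// addr_ge0// ltW// divr_gt0.
  by rewrite /cosh; have := expR_gt0 (- (x / 2)); lra.
rewrite sinh_double.
have h0 : 0 <= (1 + x / 4) ^+ 2 / 2 by rewrite divr_ge0// sqr_ge0.
have h1 : (x / 4) * ((1 + x / 4) ^+ 2 / 2) <= sinh (x / 2) * cosh (x / 2).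
  by rewrite ler_pM// ltW// divr_gt0.
rewrite -mulrA; have : x * (1 + x ^+ 2) <= 16 * (x * (1 + x / 4) ^+ 2).
  rewrite mulrCA ler_pM2l//.
  by rewrite (_ : 16 * _ = 1 + x ^+ 2 + (15 + 8 * x)); [rewrite lerDl addr_ge0// mulr_ge0// ltW|field].
lra.
Qed.

End Hyperbolic.

(** * Translation and modulation form, and the isometry in [zeta] *)

Section Fiber.
Context (R : realType) (n : nat).
Local Notation X := (R2n R n).
Local Notation mX := (leb2n R n).
Local Notation sqX := (sqL2norm mX).
Implicit Types (lam : R) (zeta : C2n R n) (g p : X -> R[i]) (x y m w xi eta : X).

Lemma dotvC (x y : Rn R n) : dotv x y = dotv y x.
Proof. by apply: eq_bigr => i _; rewrite mulrC. Qed.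

Lemma dotv_affl a (b x y : Rn R n) : dotv (affv a b x) y = a * dotv x y + dotv b y.
Proof.
rewrite /dotv mulr_sumr -big_split; apply: eq_bigr => i _ /=.
by rewrite tnth_affv; ring.
Qed.

Lemma dotv_scalel a (x y : Rn R n) : dotv (scalev a x) y = a * dotv x y.
Proof.
by rewrite /dotv mulr_sumr; apply: eq_bigr => i _; rewrite tnth_mktuple mulrA.
Qed.

Lemma dotv_addl (x y z : Rn R n) : dotv (Defs.addv x y) z = dotv x z + dotv y z.
Proof.
by rewrite /dotv -big_split; apply: eq_bigr => i _; rewrite tnth_mktuple mulrDl.
Qed.

Lemma dotv_subl (x y z : Rn R n) : dotv (subv x y) z = dotv x z - dotv y z.
Proof.
by rewrite /dotv -sumrB; apply: eq_bigr => i _; rewrite tnth_mktuple mulrBl.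
Qed.

(** With [J (x, u) = (u, - x)] and [zeta = (xi, eta)], the shift is [xi + tanh (lam / 2) J eta] and
    the frequency is [(lam / 2) coth (lam / 2) eta - (lam / 2) J xi]. *)
Definition Pi_shift lam zeta : X :=
  (affv (tanh (lam / 2)) zeta.1.1 zeta.2.2, affv (- tanh (lam / 2)) zeta.1.2 zeta.2.1).

Definition Pi_freq lam zeta : X :=
  (affv (lam / 2 * coth (lam / 2)) (scalev (- (lam / 2)) zeta.1.2) zeta.2.1,
   affv (lam / 2 * coth (lam / 2)) (scalev (lam / 2) zeta.1.1) zeta.2.2).

(** The second term comes from the symplectic phase of [tau], which [e_lam] evaluates at a
    translated point. *)
Definition Pi_phase lam zeta : R := lam / 2 * coth lam * dot2 zeta.1 zeta.2 -
  lam / 2 * tanh (lam / 2) * dot2 zeta.1 zeta.2.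

Lemma Pi_lamE lam zeta g x : Pi_lam lam zeta g x =
  cis (Pi_phase lam zeta) *
  (g (sub2 x (Pi_shift lam zeta)) * cis (- dot2 (Pi_freq lam zeta) x)).
Proof.
rewrite /Pi_lam /e_lam /tau.
set y := (X in g X); have -> : y = sub2 x (Pi_shift lam zeta).
  rewrite /y /sub2 /Pi_shift /=; congr pair; apply: eq_from_tnth => i;
    by rewrite !tnth_mktuple; ring.
(* Gathers all phases into one exponent, which leaves a bilinear identity between real numbers. *)
have cE (a b c d e : R) (z : R[i]) : a + b + c = d + e ->
    cis a * (z * cis b * cis c) = cis d * (z * cis e).
  move=> E; transitivity (z * cis (a + b + c)); first by rewrite !cisD; ring.
  by rewrite E cisD; ring.
apply: cE.
rewrite /Pi_phase /symplectic /dot2 /Pi_freq /=.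
rewrite !dotv_affl !dotv_scalel dotv_addl dotv_scalel.
rewrite (dotvC zeta.1.2 (subv _ _)) dotv_subl dotv_scalel.
rewrite (dotvC zeta.1.1 zeta.2.1) (dotvC zeta.1.2 zeta.2.2).
rewrite (dotvC x.1 zeta.2.1) (dotvC x.2 zeta.2.2) (dotvC x.2 zeta.1.1) (dotvC x.1 zeta.1.2).
by ring.
Qed.

Lemma measurable_Pi_shift :
  measurable_fun setT (fun z : C2n R n * measurableTypeR R => Pi_shift z.2 z.1).
Proof.
have m2 : measurable_fun setT (fun z : C2n R n * measurableTypeR R => z.2 : R).
  exact: measurable_snd.
have mt : measurable_fun setT (fun z : C2n R n * measurableTypeR R => tanh (z.2 / 2)).
  by apply: (measurableT_comp (@measurable_tanh R)); exact: measurable_funM.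
apply: measurable_fun_pair; apply: measurable_tuple_map => i;
  under eq_fun do rewrite tnth_affv; apply: measurable_funD;
  try apply: measurable_funM => //;
  try (by apply: measurableT_comp mt; exact: oppr_measurable);
  by apply: (measurableT_comp (measurable_tnthR i)); do !apply: measurableT_comp.
Qed.

Lemma measurable_Pi_freq :
  measurable_fun setT (fun z : C2n R n * measurableTypeR R => Pi_freq z.2 z.1).
Proof.
have ml : measurable_fun setT (fun z : C2n R n * measurableTypeR R => z.2 / 2 : R).
  have m2 : measurable_fun setT (fun z : C2n R n * measurableTypeR R => z.2 : R).
    exact: measurable_snd.
  exact: measurable_funM.
have mc : measurable_fun setT
    (fun z : C2n R n * measurableTypeR R => z.2 / 2 * coth (z.2 / 2) : R).
  by apply: measurable_funM => //; exact: (measurableT_comp (@measurable_coth R)).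
apply: measurable_fun_pair; apply: measurable_tuple_map => i;
  under eq_fun do rewrite tnth_affv tnth_mktuple; apply: measurable_funD;
  apply: measurable_funM => //;
  try (by apply: measurableT_comp ml; exact: oppr_measurable);
  by apply: (measurableT_comp (measurable_tnthR i)); do !apply: measurableT_comp.
Qed.

Lemma measurable_sub2 : measurable_fun setT (fun z : X * X => sub2 z.1 z.2).
Proof.
apply: measurable_fun_pair; apply: measurable_tuple_map => i;
  under eq_fun do rewrite tnth_mktuple; apply: measurable_funB;
  apply: (measurableT_comp (measurable_tnthR i)); apply: measurableT_comp;
  by [].
Qed.

Lemma sub2_aff2 x m : sub2 x m = aff2 1 (scalev (-1) m.1, scalev (-1) m.2) x.
Proof.
by rewrite /sub2 /aff2; congr pair; apply: eq_from_tnth => i /=;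
  rewrite !tnth_mktuple; ring.
Qed.

Lemma sub2_aff2r x m : sub2 x m = aff2 (-1) x m.
Proof.
by rewrite /sub2 /aff2; congr pair; apply: eq_from_tnth => i /=;
  rewrite !tnth_mktuple; ring.
Qed.

Lemma ge0_integral_sub2 m (h : X -> \bar R) :
  measurable_fun setT h -> (forall x, 0 <= h x)%E ->
  (\int[mX]_x h (sub2 x m) = \int[mX]_x h x)%E.
Proof.
move=> mh h0.
rewrite [RHS](ge0_integral_aff2 (scalev (-1) m.1, scalev (-1) m.2) (oner_neq0 R) mh h0).
rewrite normr1 expr1n mulr1 mul1e.
by apply: eq_integral => x _; rewrite sub2_aff2.
Qed.

Lemma ge0_integral_sub2r x (h : X -> \bar R) :
  measurable_fun setT h -> (forall x, 0 <= h x)%E ->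
  (\int[mX]_m h (sub2 x m) = \int[mX]_m h m)%E.
Proof.
move=> mh h0; have N1 : (-1 : R) != 0 by rewrite oppr_eq0 oner_neq0.
rewrite [RHS](ge0_integral_aff2 x N1 mh h0).
rewrite normrN normr1 expr1n mulr1 mul1e.
by apply: eq_integral => m _; rewrite sub2_aff2r.
Qed.

Lemma L2_sub2 p m : L2 mX p -> L2 mX (fun x => p (sub2 x m)).
Proof.
move=> [mp poo]; split.
  apply: (cmeasurable_comp (h := fun x => sub2 x m) mp).
  by apply: (measurableT_comp (g := fun x => (x, m)) measurable_sub2); exact: measurable_fun_pair.
rewrite /sqL2norm (ge0_integral_sub2 m (measurable_sq mp))// => x.
by rewrite lee_fin sqr_ge0.
Qed.

Let C : R := (2 * kappa R) ^+ n * (2 * kappa R) ^+ n.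

Let C_ge0 : 0 <= C.
Proof. by rewrite mulr_ge0// exprn_ge0// mulr_ge0// ltW// kappa_gt0. Qed.

Definition windowed_fourier g p m w : R[i] :=
  cintegral mX setT (fun x => (g x * conjc (p (sub2 x m))) * cis (dot2 w x)).

Lemma measurable_dot2 : measurable_fun setT (fun z : X * X => dot2 z.1 z.2).
Proof.
apply: measurable_funD.
  apply: (measurableT_comp (g := fun z : X * X => (z.1.1, z.2.1)) (@measurable_dotv R n)).
  by apply: measurable_fun_pair; exact: measurableT_comp.
apply: (measurableT_comp (g := fun z : X * X => (z.1.2, z.2.2)) (@measurable_dotv R n)).
by apply: measurable_fun_pair; exact: measurableT_comp.
Qed.

Lemma cmeasurable_windowed_fourier g p : cmeasurable g -> cmeasurable p ->
  cmeasurable (fun z => windowed_fourier g p z.1 z.2).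
Proof.
move=> mg mp; apply: (cmeasurable_cintegral1 mX (f := fun z : (X * X) * X =>
  (g z.2 * conjc (p (sub2 z.2 z.1.1))) * cis (dot2 z.1.2 z.2))).
apply: cmeasurableM; last first.
  apply: cmeasurable_cis.
  apply: (measurableT_comp (g := fun z : (X * X) * X => (z.1.2, z.2)) measurable_dot2).
  by apply: measurable_fun_pair => //; exact: measurableT_comp.
apply: cmeasurableM; first by apply: (cmeasurable_comp mg); exact: measurable_snd.
apply: cmeasurable_conjc; apply: (cmeasurable_comp mp).
apply: (measurableT_comp (g := fun z : (X * X) * X => (z.2, z.1.1)) measurable_sub2).
by apply: measurable_fun_pair => //; exact: measurableT_comp.
Qed.

(** Moyal's identity for the short-time Fourier transform. For fixed [m] the product of [g] with the
    translated window is integrable, which is what Plancherel in [w] requires; Tonelli and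
    translation invariance in [m] then separate the two norms. *)
Lemma windowed_fourier_isometry g p : L2 mX g -> L2 mX p ->
  (\int[mX]_m \int[mX]_w (normc (windowed_fourier g p m w) ^+ 2)%:E =
   C%:E * (sqX g * sqX p))%E.
Proof.
move=> Lg Lp; have [mg goo] := Lg; have [mp poo] := Lp.
have mI : measurable_fun setT
    (fun z : X * X => (normc (g z.2 * conjc (p (sub2 z.2 z.1))) ^+ 2)%:E).
  apply: measurable_sq; apply: cmeasurableM.
    by apply: (cmeasurable_comp mg); exact: measurable_snd.
  apply: cmeasurable_conjc; apply: (cmeasurable_comp mp).
  apply: (measurableT_comp (g := fun z : X * X => (z.2, z.1)) measurable_sub2).
  exact: measurable_fun_pair.
have I0 (z : X * X) : (0 <= (normc (g z.2 * conjc (p (sub2 z.2 z.1))) ^+ 2)%:E)%E.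
  by rewrite lee_fin sqr_ge0.
transitivity (\int[mX]_m (C%:E *
    \int[mX]_x (normc (g x * conjc (p (sub2 x m))) ^+ 2)%:E))%E.
  apply: eq_integral => m _.
  exact: (plancherel_leb2n (cintegrable_inner Lg (L2_sub2 m Lp))).
rewrite ge0_integralZl//; last 2 first.
- exact: (measurable_fun_fubini_tonelli_F _ mI I0).
- by move=> m _; apply: integral_ge0 => x _; exact: (I0 (m, x)).
congr (_ * _)%E.
rewrite (fubini_tonelli (m1 := mX) (m2 := mX) _ mI I0).
transitivity (\int[mX]_x ((normc (g x) ^+ 2)%:E * sqX p))%E.
  apply: eq_integral => x _.
  have p0 y : (0 <= (normc (p y) ^+ 2)%:E)%E by rewrite lee_fin sqr_ge0.
  rewrite /sqL2norm -(ge0_integral_sub2r x (measurable_sq mp) p0) -ge0_integralZl//.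
  - by apply: eq_integral => m _; rewrite normcM normc_conjc exprMn EFinM.
  - apply: (measurableT_comp (f := fun y => (normc (p y) ^+ 2)%:E)); first exact: measurable_sq.
    apply: (measurableT_comp (g := fun m => (x, m)) measurable_sub2).
    exact: measurable_fun_pair.
  - by rewrite lee_fin sqr_ge0.
rewrite -(fineK (L2_fin_num Lp)) ge0_integralZr//.
- exact: measurable_sq.
- by move=> x _; rewrite lee_fin sqr_ge0.
- by rewrite lee_fin fine_ge0// sqL2norm_ge0.
Qed.

(* Shearing by [xi -> xi - tanh (lam / 2) J eta] first turns the shift into [xi]
   and the frequency into [(lam / sinh lam) eta] plus a function of [xi]. *)
Lemma integral_Pi_shift_freq lam (h : X * X -> \bar R) : lam != 0 ->
  measurable_fun setT h -> (forall z, 0 <= h z)%E ->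
  (((lam / sinh lam) ^+ n * (lam / sinh lam) ^+ n)%:E *
    \int[lebC2n R n]_zeta h (Pi_shift lam zeta, Pi_freq lam zeta) =
   \int[mX]_m \int[mX]_w h (m, w))%E.
Proof.
move=> l0 mh h0; set be := lam / sinh lam.
have be0 : 0 < be := divr_sinh_gt0 l0.
have mS : measurable_fun setT (Pi_shift lam).
  by apply: (measurableT_comp (g := fun zeta => (zeta, lam)) measurable_Pi_shift).
have mF : measurable_fun setT (Pi_freq lam).
  by apply: (measurableT_comp (g := fun zeta => (zeta, lam)) measurable_Pi_freq).
have mhS : measurable_fun setT (fun zeta => h (Pi_shift lam zeta, Pi_freq lam zeta)).
  by apply: (measurableT_comp mh); exact: measurable_fun_pair.
pose rot (xi : X) : X := (scalev (- (lam / 2)) xi.2, scalev (lam / 2) xi.1).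
have mrot : measurable_fun setT (fun z : C2n R n => h (z.1, aff2 be (rot z.1) z.2)).
  apply: (measurableT_comp mh); apply: measurable_fun_pair => //.
  apply: measurable_fun_pair; apply: measurable_tuple_map => i;
    under eq_fun do rewrite tnth_affv tnth_mktuple; apply: measurable_funD;
    apply: measurable_funM => //; apply: (measurableT_comp (measurable_tnthR i));
    exact: measurableT_comp.
have E1 eta : (\int[mX]_xi h (Pi_shift lam (xi, eta), Pi_freq lam (xi, eta)) =
    \int[mX]_xi h (xi, aff2 be (rot xi) eta))%E.
  pose c : X := (scalev (- tanh (lam / 2)) eta.2, scalev (tanh (lam / 2)) eta.1).
  have m1 : measurable_fun setT (fun xi => h (Pi_shift lam (xi, eta), Pi_freq lam (xi, eta))).
    by apply: (measurableT_comp (g := fun xi => (xi, eta)) mhS); exact: measurable_fun_pair.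
  rewrite (ge0_integral_aff2 c (oner_neq0 R) m1)//.
  rewrite normr1 expr1n mulr1 mul1e; apply: eq_integral => xi _; congr (h (_, _)).
    rewrite [RHS]surjective_pairing /Pi_shift /aff2 /c /=; congr pair;
      by apply: eq_from_tnth => i; rewrite !tnth_affv !tnth_mktuple; ring.
  rewrite /Pi_freq /aff2 /c /rot /= /be -(half_cothBtanh l0); congr pair;
    by apply: eq_from_tnth => i; rewrite !(tnth_affv, tnth_mktuple); ring.
rewrite [X in (_ * X)%E](fubini_tonelli2 (m1 := mX) (m2 := mX) _ mhS)//.
rewrite [X in (_ * X)%E](eq_integral (fun eta => \int[mX]_xi h (xi, aff2 be (rot xi) eta))%E); last first.
  by move=> eta _; exact: E1.
rewrite -(fubini_tonelli (m1 := mX) (m2 := mX) _ mrot)//.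
rewrite -ge0_integralZl//; last 3 first.
- exact: (measurable_fun_fubini_tonelli_F _ mrot).
- by move=> xi _; exact: integral_ge0.
- by rewrite lee_fin mulr_ge0// exprn_ge0// ltW.
apply: eq_integral => xi _.
have mhx : measurable_fun setT (fun w => h (xi, w)).
  by apply: (measurableT_comp mh); exact: measurable_fun_pair.
rewrite [RHS](ge0_integral_aff2 (rot xi) (lt0r_neq0 be0) mhx)//.
by rewrite (gtr0_norm be0).
Qed.

Lemma L2inner_Pi_lam lam zeta g p :
  cintegrable mX (fun x => (g x * conjc (p (sub2 x (Pi_shift lam zeta)))) *
    cis (dot2 (Pi_freq lam zeta) x)) ->
  L2inner mX g (Pi_lam lam zeta p) = conjc (cis (Pi_phase lam zeta)) *
    windowed_fourier g p (Pi_shift lam zeta) (Pi_freq lam zeta).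
Proof.
move=> ic; rewrite /windowed_fourier -cintegralZ//; congr cintegral.
apply/funext => x; rewrite Pi_lamE !conjcM -(cisN (- _)) opprK; ring.
Qed.

Lemma Pi_lam_isometry lam g p : lam != 0 -> L2 mX g -> L2 mX p ->
  (((lam / sinh lam) ^+ n * (lam / sinh lam) ^+ n)%:E *
    \int[lebC2n R n]_zeta (normc (L2inner mX g (Pi_lam lam zeta p)) ^+ 2)%:E =
   C%:E * (sqX g * sqX p))%E.
Proof.
move=> l0 Lg Lp; rewrite -windowed_fourier_isometry//.
pose h (z : X * X) : \bar R := (normc (windowed_fourier g p z.1 z.2) ^+ 2)%:E.
have mh : measurable_fun setT h.
  by apply: measurable_sq; exact: cmeasurable_windowed_fourier Lg.1 Lp.1.
have h0 z : (0 <= h z)%E by rewrite lee_fin sqr_ge0.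
apply: etrans _ (integral_Pi_shift_freq l0 mh h0).
rewrite (eq_integral (fun zeta => h (Pi_shift lam zeta, Pi_freq lam zeta))) => // zeta _.
rewrite L2inner_Pi_lam.
  by rewrite normcM normc_conjc normc_cis mul1r.
apply: cintegrable_cis; first exact: cintegrable_inner Lg (L2_sub2 _ Lp).
by apply: (measurableT_comp (g := fun x => (_, x)) measurable_dot2); exact: measurable_fun_pair.
Qed.

End Fiber.

(** * The heat kernel *)

Section HeatKernel.
Context (R : realType).
Local Notation leb := (@lebesgue_measure R).
Local Notation mR := (measurableTypeR R).

Let measurable_gauss d (T : measurableType d) (u : T -> R) : measurable_fun setT u ->
  measurable_fun setT (fun x => (expR (- u x))%:E).
Proof.
move=> mu_; apply/measurable_EFinP.
apply: (measurableT_comp (f := expR)); first exact: measurable_expR.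
exact: measurableT_comp.
Qed.

Lemma integral_gauss_lebesgue_n n :
  (\int[lebesgue_n R n]_x (expR (- dotv x x))%:E = (Num.sqrt pi ^+ n)%:E)%E.
Proof.
have md k : measurable_fun setT (fun x : Rn R k => dotv x x).
  by apply: (measurableT_comp (g := fun x => (x, x)) (@measurable_dotv R k));
    exact: measurable_fun_pair.
elim: n => [|n IH].
  rewrite expr0 (eq_integral (fun=> 1%:E)); last first.
    by move=> x _; rewrite /dotv big_ord0 oppr0 expR0.
  by rewrite integral_cst//= mul1e diracE mem_set.
rewrite ge0_integral_lebesgue_nS; [|exact: measurable_gauss (md _)|by move=> x; rewrite lee_fin expR_ge0].
rewrite [LHS](fubini_tonelli1 (m1 := leb) (m2 := lebesgue_n R n)); last 2 first.
- apply: (measurableT_comp (measurable_gauss (md n.+1))).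
  exact: measurable_consn.
- by move=> z; rewrite lee_fin expR_ge0.
transitivity (\int[leb]_t ((gauss_fun t)%:E * (Num.sqrt pi ^+ n)%:E))%E.
  apply: eq_integral => t _; rewrite -IH -ge0_integralZl//.
  - apply: eq_integral => x _; rewrite dotv_consn /= -EFinM -expRD; congr (expR _)%:E.
    by rewrite opprD expr2.
  - exact: measurable_gauss (md _).
  - by rewrite lee_fin gauss_fun_ge0.
rewrite ge0_integralZr//.
- by rewrite integralT_gauss -EFinM exprS.
- by apply/measurable_EFinP; exact: measurable_gauss_fun.
- by move=> t _; rewrite lee_fin gauss_fun_ge0.
Qed.

Lemma integral_gauss_leb2n n :
  (\int[leb2n R n]_x (expR (- dot2 x x))%:E =
   (Num.sqrt pi ^+ n * Num.sqrt pi ^+ n)%:E)%E.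
Proof.
have md k : measurable_fun setT (fun x : Rn R k => dotv x x).
  by apply: (measurableT_comp (g := fun x => (x, x)) (@measurable_dotv R k));
    exact: measurable_fun_pair.
have s0 : 0 <= Num.sqrt (pi : R) ^+ n by rewrite exprn_ge0// sqrtr_ge0.
rewrite [LHS](fubini_tonelli1 (m1 := lebesgue_n R n) (m2 := lebesgue_n R n)); last 2 first.
- apply: measurable_gauss; apply: (measurableT_comp (g := fun x => (x, x)) (@measurable_dot2 R n)).
  exact: measurable_fun_pair.
- by move=> z; rewrite lee_fin expR_ge0.
transitivity (\int[lebesgue_n R n]_x ((expR (- dotv x x))%:E * (Num.sqrt pi ^+ n)%:E))%E.
  apply: eq_integral => x _; rewrite -integral_gauss_lebesgue_n -ge0_integralZl//.
  - by apply: eq_integral => y _; rewrite -EFinM -expRD -opprD.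
  - exact: measurable_gauss (md _).
rewrite ge0_integralZr//.
- by rewrite integral_gauss_lebesgue_n -EFinM.
- exact: measurable_gauss (md _).
Qed.

Variable n : nat.
Local Notation X := (R2n R n).
Local Notation mX := (leb2n R n).

(** Numerically [(4 * pi) ^- n]. The factors are the squared prefactor of the kernel, the Gaussian
    integral over [R^(2n)], and the [4 ^+ n] released when the half-angle expression is rewritten
    with [lam / sinh lam]. *)
Definition heat_const : R :=
  ((4 * pi) ^- n) ^+ 2 * (Num.sqrt pi ^+ n * Num.sqrt pi ^+ n) * 4 ^+ n.

Lemma heat_const_gt0 : 0 < heat_const.
Proof.
have p0 := pi_gt0 R; have s0 : 0 < Num.sqrt (pi : R) by rewrite sqrtr_gt0.
by rewrite /heat_const !mulr_gt0 ?exprn_gt0 ?invr_gt0 ?exprn_gt0 ?mulr_gt0.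
Qed.

Lemma measurable_heat_half_FT :
  measurable_fun setT (fun k : Heis R n => heat_half_FT k).
Proof.
have ml : measurable_fun setT (fun k : Heis R n => k.2 : R) by exact: measurable_snd.
have ml2 : measurable_fun setT (fun k : Heis R n => k.2 / 2 : R) by exact: measurable_funM.
have md : measurable_fun setT (fun k : Heis R n => dot2 k.1 k.1).
  apply: (measurableT_comp (g := fun k : Heis R n => (k.1, k.1)) (@measurable_dot2 R n)).
  exact: measurable_fun_pair.
apply: measurable_funM.
  apply: measurable_funM.
    by apply: measurable_funM => //; exact: measurable_funX.
  apply: (measurableT_comp (@measurable_inv R)); apply: measurable_funX.
  exact: (measurableT_comp (@measurable_sinh R)).
apply: (measurableT_comp (f := expR)); first exact: measurable_expR.
apply: measurable_funN; apply: measurable_funM => //.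
apply: measurable_funM => //; apply: measurable_funM => //.
exact: (measurableT_comp (@measurable_coth R)).
Qed.

Lemma cmeasurable_heat_fiber lam :
  cmeasurable (fun x : X => (heat_half_FT (x, lam))%:C%C).
Proof.
apply: cmeasurable_real.
apply: (measurableT_comp (g := fun x : X => (x, lam) : Heis R n) measurable_heat_half_FT).
exact: measurable_fun_pair.
Qed.

Lemma sq_heat_fiber lam : lam != 0 ->
  sqL2norm mX (fun x => (heat_half_FT (x, lam))%:C%C) =
  (heat_const * (lam / sinh lam) ^+ n)%:E.
Proof.
move=> l0; have s0 : sinh (lam / 2) != 0 by rewrite sinh_eq0 mulf_neq0.
have c0 := cosh_gt0 (lam / 2).
(* The squared kernel is a multiple of [exp (- a |x|^2)]. Writing [a] as [y / sinh y] times a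
   hyperbolic cosine shows that it is positive for both signs of [lam]. *)
pose a := lam / 2 / sinh (lam / 2) * cosh (lam / 2).
have a0 : 0 < a by rewrite mulr_gt0// divr_sinh_gt0// mulf_neq0.
pose A := (4 * pi) ^- n * lam ^+ n * sinh (lam / 2) ^- n.
pose r := Num.sqrt a; have r0 : 0 < r by rewrite sqrtr_gt0.
have r2 : r ^+ 2 = a by rewrite sqr_sqrtr// ltW.
have md : measurable_fun setT (fun x : X => dot2 x x).
  by apply: (measurableT_comp (g := fun x => (x, x)) (@measurable_dot2 R n)); exact: measurable_fun_pair.
have mg := measurable_gauss md.
have g0 (x : X) : (0 <= (expR (- dot2 x x))%:E)%E by rewrite lee_fin expR_ge0.
have := ge0_integral_aff2 ([tuple 0 | i < n], [tuple 0 | i < n]) (lt0r_neq0 r0) mg g0.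
rewrite integral_gauss_leb2n gtr0_norm// => E.
have E2 : sqL2norm mX (fun x => (heat_half_FT (x, lam))%:C%C) = ((A ^+ 2)%:E *
    \int[mX]_x (expR (- dot2 (aff2 r ([tuple 0 | i < n], [tuple 0 | i < n]) x)
                             (aff2 r ([tuple 0 | i < n], [tuple 0 | i < n]) x)))%:E)%E.
  rewrite -ge0_integralZl//.
  - apply: eq_integral => x _; rewrite normc_real real_normK ?num_real// -EFinM; congr EFin.
    rewrite /heat_half_FT -/A exprMn; congr (_ * _); rewrite expr2 -expRD; congr expR.
    have D : dot2 (aff2 r ([tuple 0 | i < n], [tuple 0 | i < n]) x)
                  (aff2 r ([tuple 0 | i < n], [tuple 0 | i < n]) x) = a * dot2 x x.
      have dz (y : Rn R n) : dotv [tuple 0 | i < n] y = 0.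
        by rewrite /dotv big1// => i _; rewrite tnth_mktuple mul0r.
      rewrite -r2 /dot2 /aff2 /= !dotv_affl !dz !addr0.
      by rewrite ![dotv _ (affv _ _ _)]dotvC !dotv_affl !dz; ring.
    by rewrite D /a /coth /=; field.
  - by apply: (measurableT_comp mg); exact: measurable_aff2.
  - by rewrite lee_fin sqr_ge0.
have rn0 : 0 < r ^+ n * r ^+ n by rewrite mulr_gt0// exprn_gt0.
rewrite E2 (_ : (A ^+ 2)%:E = ((A ^+ 2 / (r ^+ n * r ^+ n))%:E * (r ^+ n * r ^+ n)%:E)%E); last first.
  by rewrite -EFinM divfK// gt_eqF.
rewrite -muleA -E -EFinM; congr EFin.
rewrite -exprD addnn -mul2n exprM r2 /heat_const /A.
rewrite (_ : lam / sinh lam = lam ^+ 2 / sinh (lam / 2) ^+ 2 / (4 * a)); last first.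
  by rewrite /a sinh_double; field; rewrite l0 s0 gt_eqF.
have P (x v b : R) : (x ^+ 2 / v ^+ 2 / (4 * b)) ^+ n =
    (x ^+ n) ^+ 2 / (v ^+ n) ^+ 2 / (4 ^+ n * b ^+ n).
  by rewrite expr_div_n (exprMn n 4 b) expr_div_n (exprAC x) (exprAC v).
rewrite P.
have nz (x : R) : x != 0 -> x ^+ n != 0 by move=> x0; rewrite expf_neq0.
have p0 : (4 * pi : R) != 0 by rewrite mulf_neq0// gt_eqF// pi_gt0.
have := nz _ p0; have := nz _ s0; have := nz _ (lt0r_neq0 a0).
have f4 : (4 : R) != 0 by []; have := nz _ f4.
(* With the powers generalized, [field] sees atoms whose nonvanishing is at hand. *)
move: ((4 * pi) ^+ n) (sinh (lam / 2) ^+ n) (a ^+ n) (4 ^+ n) (lam ^+ n) (Num.sqrt pi ^+ n).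
move=> u v w x y z x0 w0 v0 u0; field.
by rewrite u0 v0 w0 x0.
Qed.

Lemma heat_fiber_L2 lam : lam != 0 -> L2 mX (fun x => (heat_half_FT (x, lam))%:C%C).
Proof.
move=> l0; split; first exact: cmeasurable_heat_fiber.
by rewrite sq_heat_fiber// ltry.
Qed.

Lemma ae_neq0 : {ae leb, forall lam : R, lam != 0}.
Proof.
exists [set 0]; split; [exact: measurable_set1|exact: lebesgue_measure_set1|].
by move=> s /= /negP; rewrite negbK => /eqP.
Qed.

(** The fiber norms are [heat_const] times [(lam / sinh lam) ^+ n], integrable in [lam] because at
    least one power is present; for [n = 0] they would be constant. *)
Lemma heat_half_FT_L2 : (0 < n)%N ->
  L2 (haar R n) (fun k => (heat_half_FT k)%:C%C).
Proof.
move=> n0; have mh := cmeasurable_real measurable_heat_half_FT.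
split => //.
have m2 := measurable_sq mh.
have p2 (k : Heis R n) : (0 <= (normc ((heat_half_FT k)%:C%C : R[i]) ^+ 2)%:E)%E.
  by rewrite lee_fin sqr_ge0.
rewrite /sqL2norm [X in (X < _)%E](fubini_tonelli2 (m1 := mX) (m2 := leb) _ m2 p2).
pose c := heat_const * 64 ^+ n.
have c0 : 0 <= c by rewrite mulr_ge0 ?exprn_ge0// ltW// heat_const_gt0.
apply: (@le_lt_trans _ _ (\int[leb]_l (c%:E * ((1 + l ^+ 2)^-1)%:E))%E); last first.
  have i1 := integrableZl measurableT c (@integrable_oneDsqrV R).
  exact: (integrable_lty measurableT i1).
apply: ae_ge0_le_integral => //.
- by move=> l _; apply: integral_ge0 => x _; exact: (p2 (x, l)).
- exact: (measurable_fun_fubini_tonelli_G _ m2 p2).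
- by move=> l _; rewrite -EFinM lee_fin mulr_ge0// invr_ge0 addr_ge0// sqr_ge0.
- apply: emeasurable_funM => //; exact: measurable_int (@integrable_oneDsqrV R).
- apply: (aeS (mu := leb) _ ae_neq0) => l l0 _.
  have -> : fubini_G mX (fun k => (normc ((heat_half_FT k)%:C%C : R[i]) ^+ 2)%:E) l =
    (heat_const * (l / sinh l) ^+ n)%:E := sq_heat_fiber l0.
  rewrite -EFinM lee_fin /c -(mulrA heat_const) ler_wpM2l ?(ltW heat_const_gt0)//.
  have q0 : 0 < 1 + l ^+ 2 by rewrite ltr_pwDl// sqr_ge0.
  apply: (@le_trans _ _ ((64 / (1 + l ^+ 2)) ^+ n)).
    by rewrite lerXn2r ?nnegrE ?divr_sinh_ge0 ?divr_sinh_le// divr_ge0// ltW.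
  rewrite (exprMn n 64) ler_wpM2l ?exprn_ge0//.
  (* One power is kept for integrability, and the other [n - 1] are bounded by 1. *)
  rewrite -[leRHS]expr1 ler_wiXn2l// ?invr_ge0 ?(ltW q0)//.
  by rewrite invf_le1// lerDl sqr_ge0.
Qed.

End HeatKernel.

(** * The operators Pi *)

Section PiFiberwise.
Context (R : realType) (n : nat).
Local Notation leb := (@lebesgue_measure R).
Local Notation mR := (measurableTypeR R).
Local Notation X := (R2n R n).
Local Notation mX := (leb2n R n).
Local Notation H := (Heis R n).
Local Notation mH := (haar R n).
Local Notation sq := (sqL2norm mH).
Implicit Types (f g F G P Q : H -> R[i]) (zeta : C2n R n) (s lam : R).

Lemma ae_L2_fiber2 f : L2 mH f -> {ae leb, forall l : mR, L2 mX (fun x => f (x, l))}.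
Proof.
move=> [mf foo].
have m2 := measurable_sq mf.
have p2 (k : H) : (0 <= (normc (f k) ^+ 2)%:E)%E by rewrite lee_fin sqr_ge0.
have mF : measurable_fun setT (fun l : mR => \int[mX]_x (normc (f (x, l)) ^+ 2)%:E)%E.
  exact: (measurable_fun_fubini_tonelli_G _ m2 p2).
have iF : leb.-integrable setT (fun l : mR => \int[mX]_x (normc (f (x, l)) ^+ 2)%:E)%E.
  apply/integrableP; split => //.
  under eq_integral do rewrite gee0_abs ?integral_ge0//.
  by rewrite -(fubini_tonelli2 (m1 := mX) (m2 := leb) _ m2 p2).
apply: (aeS (mu := leb) _ (integrable_ae measurableT iF)) => l /(_ I) fl; split.
  by apply: (cmeasurable_comp mf); exact: measurable_fun_pair.
by rewrite -ge0_fin_numE// integral_ge0.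
Qed.

Lemma measurable_c_lam : measurable_fun setT (fun k : H => c_lam n k.2).
Proof.
have ml : measurable_fun setT (fun k : H => k.2 : R) by exact: measurable_snd.
apply: measurable_funM => //; apply: measurable_funX; apply: measurable_funM => //.
apply: (measurableT_comp (@measurable_inv R)).
exact: (measurableT_comp (@measurable_sinh R)).
Qed.

Lemma c_lam_ge0 lam : 0 <= c_lam n lam.
Proof.
by rewrite mulr_ge0 ?exprn_ge0 ?divr_sinh_ge0// invr_ge0 exprn_ge0// mulr_ge0// pi_ge0.
Qed.

Lemma c_lam_le lam : c_lam n lam <= (4 * pi) ^- n * 64 ^+ n.
Proof.
have q0 : 0 < 1 + lam ^+ 2 by rewrite ltr_pwDl// sqr_ge0.
rewrite ler_wpM2l ?invr_ge0 ?exprn_ge0 ?mulr_ge0 ?pi_ge0//.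
rewrite lerXn2r ?nnegrE ?divr_sinh_ge0//.
apply: le_trans (divr_sinh_le lam) _.
by rewrite ler_pdivrMr// ler_peMr// lerDl sqr_ge0.
Qed.

Lemma L2_sqrt_c_lam F : L2 mH F ->
  L2 mH (fun k => (Num.sqrt (c_lam n k.2))%:C%C * F k).
Proof.
move=> LF; apply: (L2_mulb (C := Num.sqrt ((4 * pi) ^- n * 64 ^+ n)) LF).
  apply: cmeasurable_real.
  apply: (@measurableT_comp _ _ _ _ _ _ (@Num.sqrt R)); last exact: measurable_c_lam.
  by apply: continuous_measurable_fun; exact: sqrt_continuous.
move=> k; rewrite normc_real ger0_norm ?sqrtr_ge0//.
by rewrite ler_wsqrtr// c_lam_le.
Qed.

Lemma measurable_Pi_phase :
  measurable_fun setT (fun z : C2n R n * mR => Pi_phase z.2 z.1).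
Proof.
have ml : measurable_fun setT (fun z : C2n R n * mR => z.2 : R) by exact: measurable_snd.
have ml2 : measurable_fun setT (fun z : C2n R n * mR => z.2 / 2 : R) by exact: measurable_funM.
have md : measurable_fun setT (fun z : C2n R n * mR => dot2 z.1.1 z.1.2).
  apply: (measurableT_comp (g := fun z : C2n R n * mR => z.1) (@measurable_dot2 R n)).
  exact: measurable_fst.
apply: measurable_funB; apply: measurable_funM => //; apply: measurable_funM => //.
- exact: (measurableT_comp (@measurable_coth R)).
- exact: (measurableT_comp (@measurable_tanh R)).
Qed.

Definition Pi_fiberwise zeta P : H -> R[i] :=
  fun k => Pi_lam k.2 zeta (fun x => P (x, k.2)) k.1.

(** The point at which [Pi_fiberwise] evaluates its argument. It translates each fiber by a vector
    depending on [lam], so it preserves the measure by Tonelli. *)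
Definition central_shift zeta (k : H) : H := (sub2 k.1 (Pi_shift k.2 zeta), k.2).

Lemma measurable_central_shift :
  measurable_fun setT (fun z : C2n R n * H => central_shift z.1 z.2).
Proof.
apply: measurable_fun_pair; last exact: measurableT_comp.
apply: (measurableT_comp (g := fun z : C2n R n * H => (z.2.1, Pi_shift z.2.2 z.1))
  (@measurable_sub2 R n)).
apply: measurable_fun_pair; first exact: measurableT_comp.
apply: (measurableT_comp (g := fun z : C2n R n * H => (z.1, z.2.2))
  (@measurable_Pi_shift R n)).
by apply: measurable_fun_pair => //; exact: measurableT_comp.
Qed.

Lemma cmeasurable_Pi_fiberwise P : cmeasurable P ->
  cmeasurable (fun z : C2n R n * H => Pi_fiberwise z.1 P z.2).
Proof.
move=> mP; rewrite /Pi_fiberwise.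
have mz : measurable_fun setT (fun z : C2n R n * H => (z.1, z.2.2)).
  by apply: measurable_fun_pair => //; exact: measurableT_comp.
rewrite (_ : (fun z => _) = (fun z : C2n R n * H => cis (Pi_phase z.2.2 z.1) *
    (P (central_shift z.1 z.2) * cis (- dot2 (Pi_freq z.2.2 z.1) z.2.1)))); last first.
  by apply/funext => z; rewrite Pi_lamE.
apply: cmeasurableM.
  by apply: cmeasurable_cis; exact: (measurableT_comp measurable_Pi_phase mz).
apply: cmeasurableM; first exact: (cmeasurable_comp mP measurable_central_shift).
apply: cmeasurable_cis; apply: measurable_funN.
apply: (measurableT_comp (g := fun z : C2n R n * H => (Pi_freq z.2.2 z.1, z.2.1))
  (@measurable_dot2 R n)).
apply: measurable_fun_pair; last exact: measurableT_comp.
exact: (measurableT_comp (@measurable_Pi_freq R n) mz).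
Qed.

Lemma ge0_integral_central_shift zeta (h : H -> \bar R) : measurable_fun setT h ->
  (forall k, 0 <= h k)%E ->
  (\int[mH]_k h (central_shift zeta k) = \int[mH]_k h k)%E.
Proof.
move=> mh h0.
have mhS : measurable_fun setT (fun k => h (central_shift zeta k)).
  apply: (measurableT_comp mh).
  apply: (measurableT_comp (g := fun k => (zeta, k)) measurable_central_shift).
  exact: measurable_fun_pair.
rewrite [LHS](fubini_tonelli2 (m1 := mX) (m2 := leb) _ mhS)//.
rewrite [RHS](fubini_tonelli2 (m1 := mX) (m2 := leb) _ mh h0).
apply: eq_integral => l _.
have mhl : measurable_fun setT (fun x : X => h (x, l)).
  by apply: (measurableT_comp mh); exact: measurable_fun_pair.
exact: (ge0_integral_sub2 (Pi_shift l zeta) mhl).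
Qed.

Lemma normc_Pi_fiberwise zeta P k :
  normc (Pi_fiberwise zeta P k) = normc (P (central_shift zeta k)).
Proof. by rewrite /Pi_fiberwise Pi_lamE !normcM !normc_cis mul1r mulr1. Qed.

Lemma sq_Pi_fiberwise zeta P : cmeasurable P -> sq (Pi_fiberwise zeta P) = sq P.
Proof.
move=> mP; rewrite /sqL2norm -(ge0_integral_central_shift zeta (measurable_sq mP)).
  by apply: eq_integral => k _; rewrite normc_Pi_fiberwise.
by move=> k; rewrite lee_fin sqr_ge0.
Qed.

Lemma L2_Pi_fiberwise zeta P : L2 mH P -> L2 mH (Pi_fiberwise zeta P).
Proof.
move=> [mP Poo]; split; last by rewrite sq_Pi_fiberwise.
apply: (cmeasurable_comp (h := fun k : H => (zeta, k)) (cmeasurable_Pi_fiberwise mP)).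
exact: measurable_fun_pair.
Qed.

(** Follows from the isometry applied to [P - Q]. It is needed because [Pi] acts on the
    representative of the transform chosen by [xget]. *)
Lemma ae_Pi_fiberwise zeta P Q : L2 mH P -> L2 mH Q -> ae_eq mH setT P Q ->
  ae_eq mH setT (Pi_fiberwise zeta P) (Pi_fiberwise zeta Q).
Proof.
move=> LP LQ PQ; have mD := cmeasurableB LP.1 LQ.1.
have LB := L2B (L2_Pi_fiberwise zeta LP) (L2_Pi_fiberwise zeta LQ).
apply: ae_eq_sub0; apply: sqL2norm_eq0; first exact: LB.1.
transitivity (sq (Pi_fiberwise zeta (fun k => P k - Q k))).
  by apply: eq_sqL2norm => k; rewrite /Pi_fiberwise !Pi_lamE -mulrBr -mulrBl.
rewrite sq_Pi_fiberwise// (sqL2norm_ae mD (cmeasurable_cst _ 0)).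
  rewrite /sqL2norm integral0_eq// => k _.
  by rewrite normc0 expr0n.
by apply: (aeS _ PQ) => k /= /[apply] ->; rewrite subrr.
Qed.

Lemma L2_cisM s P : L2 mH P -> L2 mH (fun k => cis (k.2 * s) * P k).
Proof.
move=> LP; apply: (L2_mulb (C := 1) LP).
  apply: cmeasurable_cis.
  have ml : measurable_fun setT (fun k : H => k.2 : R) by exact: measurable_snd.
  exact: measurable_funM.
by move=> k; rewrite normc_cis.
Qed.

End PiFiberwise.

(** * Inner products fiber by fiber *)

Section FiberInner.
Context (R : realType) (n : nat).
Local Notation leb := (@lebesgue_measure R).
Local Notation mR := (measurableTypeR R).
Local Notation X := (R2n R n).
Local Notation mX := (leb2n R n).
Local Notation H := (Heis R n).
Local Notation mH := (haar R n).
Implicit Types (f g F G P Q : H -> R[i]) (zeta : C2n R n) (s lam : R).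

Lemma L2inner_invFT g G Q : L2 mH g -> is_central_transform 1 g G -> L2 mH Q ->
  L2inner mH g (invFT Q) = ((2 * pi)^-1)%:C%C * L2inner mH G Q.
Proof.
move=> Lg cG LQ.
have cQ := central_transformP (or_intror erefl) LQ.
rewrite /invFT L2innerZr//; last exact: cQ.1.
by congr (_ * _); apply/esym; exact: (central_duality (or_introl erefl) Lg LQ cG cQ).
Qed.

Definition fiber_inner G P (z : C2n R n * mR) : R[i] :=
  L2inner mX (fun x => G (x, z.2)) (Pi_lam z.2 z.1 (fun x => P (x, z.2))).

Lemma cmeasurable_fiber_inner G P : cmeasurable G -> cmeasurable P ->
  cmeasurable (fiber_inner G P).
Proof.
move=> mG mP.
apply: (cmeasurable_cintegral1 mX (f := fun w : (C2n R n * mR) * X =>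
  G (w.2, w.1.2) * conjc (Pi_fiberwise w.1.1 P (w.2, w.1.2)))).
have mw : measurable_fun setT (fun w : (C2n R n * mR) * X => (w.2, w.1.2) : H).
  by apply: measurable_fun_pair => //; exact: measurableT_comp.
apply: cmeasurableM; first exact: (cmeasurable_comp mG mw).
apply: cmeasurable_conjc.
apply: (cmeasurable_comp
  (h := fun w : (C2n R n * mR) * X => (w.1.1, (w.2, w.1.2) : H))
  (cmeasurable_Pi_fiberwise mP)).
by apply: measurable_fun_pair => //; exact: measurableT_comp.
Qed.

(** By Fubini the inner product is the Fourier transform at [s] of [fiber_inner] as a function of
    [l]. That function is a marginal of a product of two L2 functions, hence integrable, while its
    square integral may be infinite for a given [zeta]. *)
Lemma plancherel_fiber_inner zeta G P : L2 mH G -> L2 mH P ->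
  (\int[leb]_s (normc (L2inner mH G
     (fun k => cis (k.2 * s) * Pi_fiberwise zeta P k)) ^+ 2)%:E =
   (2 * kappa R)%:E * \int[leb]_l (normc (fiber_inner G P (zeta, l)) ^+ 2)%:E)%E.
Proof.
move=> LG LP; pose u k := G k * conjc (Pi_fiberwise zeta P k).
have iu : cintegrable (prodm mX leb) u := cintegrable_inner LG (L2_Pi_fiberwise zeta LP).
have iI := cintegrable_prodm2 iu.
apply: etrans _ (plancherel_line (or_intror erefl) iI).
apply: eq_integral => s _; congr (normc _ ^+ 2)%:E.
have mk : measurable_fun setT (fun k : X * mR => -1 * s * k.2).
  have m2 : measurable_fun setT (fun k : X * mR => k.2 : R) by exact: measurable_snd.
  exact: measurable_funM.
have ius := cintegrable_cis iu mk.
transitivity (cintegral (prodm mX leb) setT (fun k => u k * cis (-1 * s * k.2))).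
  congr cintegral; apply/funext => k; rewrite /u conjcM -cisN.
  by rewrite (_ : - (k.2 * s) = -1 * s * k.2); ring.
apply: etrans (esym (cintegral_prodm2 ius)) _; apply: ae_eq_cintegral.
- exact: cintegrable_cmeasurable (cintegrable_prodm2 ius).
- apply: cintegrable_cmeasurable; apply: (cintegrable_cis iI).
  exact: measurable_funM.
- apply: (aeS (mu := leb) _ (ae_cintegrable_prodm2 iu)) => l il _.
  rewrite /= [RHS]mulrC -cintegralZ//.
  by congr cintegral; apply/funext => x /=; rewrite mulrC.
Qed.

Lemma cmeasurable_L2inner_cis G Q : cmeasurable G -> cmeasurable Q ->
  cmeasurable (fun s : mR => L2inner mH G (fun k => cis (k.2 * s) * Q k)).
Proof.
move=> mG mQ.
apply: (cmeasurable_cintegral1 mH (f := fun z : mR * H =>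
  G z.2 * conjc (cis (z.2.2 * z.1) * Q z.2))).
have m1 : measurable_fun setT (fun z : mR * H => z.1 : R) by exact: measurable_fst.
have m2 : measurable_fun setT (fun z : mR * H => z.2.2 : R).
  by apply: (measurableT_comp (f := snd)); exact: measurable_snd.
apply: cmeasurableM; first by apply: (cmeasurable_comp mG); exact: measurable_snd.
apply: cmeasurable_conjc; apply: cmeasurableM.
  by apply: cmeasurable_cis; exact: measurable_funM.
by apply: (cmeasurable_comp mQ); exact: measurable_snd.
Qed.

(** Plancherel constant on [R^(2n)], prefactor of [c_lam], and constant of the heat kernel norm. *)
Definition fiber_const : R :=
  (2 * kappa R) ^+ n * (2 * kappa R) ^+ n * (4 * pi) ^- n * heat_const R n.

Lemma fiber_const_gt0 : 0 < fiber_const.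
Proof.
have k0 : 0 < (2 * kappa R) ^+ n by rewrite exprn_gt0// mulr_gt0// kappa_gt0.
have p0 : 0 < (4 * pi : R) ^- n by rewrite invr_gt0 exprn_gt0// mulr_gt0// pi_gt0.
exact: mulr_gt0 (mulr_gt0 (mulr_gt0 k0 k0) p0) (heat_const_gt0 R n).
Qed.

(** One factor [(lam / sinh lam) ^+ n] comes from [c_lam] and one from the norm of the heat kernel;
    together they cancel the Jacobian in [Pi_lam_isometry]. *)
Lemma integral_fiber_inner lam (F : X -> R[i]) : lam != 0 -> L2 mX F ->
  (\int[lebC2n R n]_zeta (normc (L2inner mX
      (fun x => (Num.sqrt (c_lam n lam))%:C%C * F x)
      (Pi_lam lam zeta (fun x => (heat_half_FT (x, lam))%:C%C))) ^+ 2)%:E =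
   fiber_const%:E * sqL2norm mX F)%E.
Proof.
move=> l0 LF.
have LsF := L2Z (Num.sqrt (c_lam n lam)) LF.
have := Pi_lam_isometry l0 LsF (heat_fiber_L2 n l0).
set I := (\int[lebC2n R n]_zeta _)%E.
rewrite sq_heat_fiber// sqL2normZ; last exact: LF.1.
rewrite sqr_sqrtr ?c_lam_ge0// -(fineK (L2_fin_num LF)).
set be := lam / sinh lam; set S := fine _.
have be0 : 0 < be ^+ n by rewrite exprn_gt0// divr_sinh_gt0.
move=> E; rewrite -[I]mul1e.
rewrite (_ : 1%E = ((be ^+ n * be ^+ n)^-1)%:E * (be ^+ n * be ^+ n)%:E :> \bar R)%E; last first.
  by rewrite -EFinM mulVf// gt_eqF// mulr_gt0.
rewrite -muleA E -!EFinM; congr EFin.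
rewrite /c_lam -/be /fiber_const.
move: (be ^+ n) be0 ((4 * pi) ^- n) (heat_const R n) ((2 * kappa R) ^+ n) => b b0 p h k.
by field; rewrite gt_eqF.
Qed.

End FiberInner.

(** * Integration over [lam] and [zeta] *)

Section MainTheorem.
Context (R : realType) (n : nat).
Local Notation leb := (@lebesgue_measure R).
Local Notation mR := (measurableTypeR R).
Local Notation X := (R2n R n).
Local Notation mX := (leb2n R n).
Local Notation H := (Heis R n).
Local Notation mH := (haar R n).
Local Notation sq := (sqL2norm mH).
Local Notation P := (fun k : H => (heat_half_FT k)%:C%C : R[i]).

Lemma integral_fiber_inner_heat F : L2 mH P -> L2 mH F ->
  (\int[lebC2n R n]_zeta \int[leb]_l
     (normc (fiber_inner (fun k => (Num.sqrt (c_lam n k.2))%:C%C * F k) P (zeta, l)) ^+ 2)%:E =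
   (fiber_const R n)%:E * sq F)%E.
Proof.
move=> LP LF; have LG := L2_sqrt_c_lam LF.
have mI := measurable_sq (cmeasurable_fiber_inner LG.1 LP.1).
have I0 (z : C2n R n * mR) : (0 <= (normc (fiber_inner
    (fun k => (Num.sqrt (c_lam n k.2))%:C%C * F k) P z) ^+ 2)%:E)%E.
  by rewrite lee_fin sqr_ge0.
have m2 := measurable_sq LF.1.
have p2 (k : H) : (0 <= (normc (F k) ^+ 2)%:E)%E by rewrite lee_fin sqr_ge0.
have c0 : 0 <= fiber_const R n by rewrite ltW// fiber_const_gt0.
rewrite (fubini_tonelli (m1 := lebC2n R n) (m2 := leb) _ mI I0).
rewrite /sqL2norm [X in (_ * X)%E](fubini_tonelli2 (m1 := mX) (m2 := leb) _ m2 p2).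
rewrite -ge0_integralZl//; last 2 first.
- exact: (measurable_fun_fubini_tonelli_G _ m2 p2).
- by move=> l _; apply: integral_ge0 => x _; exact: (p2 (x, l)).
apply: ge0_ae_eq_integral => //.
- exact: (measurable_fun_fubini_tonelli_G _ mI I0).
- apply: emeasurable_funM => //; exact: (measurable_fun_fubini_tonelli_G _ m2 p2).
- by move=> l _; apply: integral_ge0 => x _; exact: I0.
- by move=> l _; apply: mule_ge0 => //; apply: integral_ge0 => x _; exact: (p2 (x, l)).
- apply: (aeS2 (mu := leb) _ (ae_neq0 R) (ae_L2_fiber2 LF)) => l l0 Ll _.
  exact: (integral_fiber_inner l0 Ll).
Qed.

(** The multiplier is bounded, so the product stays in L2, and surjectivity of the transform
    supplies the inhabitant that keeps [xget] from its default. *)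
Lemma Tmul_transform f : L2 mH f -> L2 mH (Tmul f) /\
  is_central_transform 1 (Tmul f) (fun k => (Num.sqrt (c_lam n k.2))%:C%C * FT f k).
Proof.
move=> Lf; have LF := (central_transformP (or_introl erefl) Lf).1.
have [g Lg cg] := central_transform_surj (or_introl erefl) (L2_sqrt_c_lam LF).
exact: (@xgetI _ (fun=> 0) [set g | L2 mH g /\ is_central_transform 1 g
  (fun k => (Num.sqrt (c_lam n k.2))%:C%C * FT f k)] g (conj Lg cg)).
Qed.

Lemma heat_half_transform : (0 < n)%N -> L2 mH heat_half /\
  is_central_transform 1 (heat_half : H -> R[i]) P.
Proof.
move=> n0.
have [g Lg cg] := central_transform_surj (or_introl erefl) (heat_half_FT_L2 R n0).
exact: (@xgetI _ (fun=> 0) [set p | L2 mH p /\ is_central_transform 1 p P]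
  g (conj Lg cg)).
Qed.

(** Duality moves the inverse transform in [Pi] to the left argument, where it meets the known
    transform of [Tmul f]. The chosen transform of [heat_half] agrees with the explicit formula only
    almost everywhere, and is replaced under [Pi_fiberwise]. *)
Lemma L2inner_Tmul_Pi f zeta s : (0 < n)%N -> L2 mH f ->
  L2inner mH (Tmul f) (Pi zeta s heat_half) = ((2 * pi)^-1)%:C%C *
  L2inner mH (fun k => (Num.sqrt (c_lam n k.2))%:C%C * FT f k)
     (fun k => cis (k.2 * s) * Pi_fiberwise zeta P k).
Proof.
move=> n0 Lf; have [LT cT] := Tmul_transform Lf.
have [Lp cp] := heat_half_transform n0; have LP := cp.1.
have cp' := central_transformP (or_introl erefl) Lp; have LP' := cp'.1.
have LQ := L2_cisM s (L2_Pi_fiberwise zeta LP).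
have LQ' := L2_cisM s (L2_Pi_fiberwise zeta LP').
apply: etrans (L2inner_invFT LT cT LQ') _; congr (_ * _).
apply: L2inner_ae; [exact: cT.1.1|exact: cT.1.1|exact: LQ'.1|exact: LQ.1|by apply: aeW|].
have E := central_transform_unique (or_introl erefl) Lp cp' cp.
by apply: (aeS _ (ae_Pi_fiberwise zeta LP' LP E)) => k /= /[apply] ->.
Qed.

End MainTheorem.

Theorem mainTheorem6 (R : realType) (n : nat) (n_gt0 : (0 < n)%N) :
  exists2 c : R, 0 < c &
    forall f : Heis R n -> R[i], L2 (haar R n) f ->
      (\int[lebC2n R n]_zeta \int[lebesgue_measure]_s
         (normc (L2inner (haar R n) (Tmul f) (Pi zeta s heat_half)) ^+ 2)%:E
       = c%:E * \int[haar R n]_h (normc (f h) ^+ 2)%:E)%E.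
Proof.
have k2 : 0 < 2 * kappa R by rewrite mulr_gt0// kappa_gt0.
(* The square of the prefactor of [invFT], times the constant of Plancherel in [s]. *)
pose a : R := ((2 * pi)^-1) ^+ 2 * (2 * kappa R).
have a0 : 0 < a by rewrite mulr_gt0// exprn_gt0// invr_gt0 mulr_gt0// pi_gt0.
(* The last factor relates the norm of [FT f] to that of [f]. With [kappa R = pi] the whole product
   is [4 ^- n]. *)
exists (a * fiber_const R n * (2 * kappa R)).
  exact: mulr_gt0 (mulr_gt0 a0 (fiber_const_gt0 R n)) k2.
move=> f Lf; have LP := heat_half_FT_L2 R n_gt0.
have cF := central_transformP (or_introl erefl) Lf; have LF := cF.1.
pose G k := (Num.sqrt (c_lam n k.2))%:C%C * FT f k.
have LG : L2 (haar R n) G := L2_sqrt_c_lam LF.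
pose P (k : Heis R n) : R[i] := (heat_half_FT k)%:C%C.
have mI := measurable_sq (cmeasurable_fiber_inner LG.1 LP.1).
have I0 (z : C2n R n * measurableTypeR R) : (0 <= (normc (fiber_inner G P z) ^+ 2)%:E)%E.
  by rewrite lee_fin sqr_ge0.
transitivity (\int[lebC2n R n]_zeta (a%:E *
    \int[lebesgue_measure]_l (normc (fiber_inner G P (zeta, l)) ^+ 2)%:E))%E.
  apply: eq_integral => zeta _; rewrite /a EFinM -muleA.
  rewrite -(plancherel_fiber_inner zeta LG LP) -ge0_integralZl//.
  - apply: eq_integral => s _; rewrite (L2inner_Tmul_Pi zeta s n_gt0 Lf).
    by rewrite normcM exprMn normc_real real_normK ?num_real// EFinM.
  - apply: measurable_sq; apply: cmeasurable_L2inner_cis LG.1 _.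
    exact: (L2_Pi_fiberwise zeta LP).1.
  - by move=> s _; rewrite lee_fin sqr_ge0.
  - by rewrite lee_fin sqr_ge0.
rewrite ge0_integralZl//; last 3 first.
- exact: (measurable_fun_fubini_tonelli_F _ mI I0).
- by move=> zeta _; apply: integral_ge0 => l _; exact: I0.
- by rewrite lee_fin ltW.
rewrite (integral_fiber_inner_heat LP LF) -(fineK (L2_fin_num LF)).
rewrite (sq_central_transform (or_introl erefl) Lf cF).
rewrite -[X in _ = (_ * X)%E](fineK (L2_fin_num Lf)) -!EFinM; congr EFin.
ring.
Qed.
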